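(* Fix an integer $N\geq 2$. Suppose that the driving process $Y$ satisfies assumptions (i) and (ii) of the context, and let $\mathbf X^N=(X^1,\dots,X^N)$ be the Fleming-Viot type process driven by $Y$, with $\mathbf X^N_0\in F^N$ almost surely and with lifetime $\tau_\infty$ (not assumed to be infinite). Then, almost surely, there exists a unique infinite sequence $((a_1,b_1),(a_2,b_2),\dots)$ such that every finite initial subsequence of it is equal to the label $\mathcal L(X^i_s)$ for some $1\leq i\leq N$ and some $s\geq 0$ (with $s<\tau_\infty$).
   Context: **Driving process.** $E$ is a topological space, $F$ is a Borel proper subset of $E$, and $F^c=E\setminus F$. $Y_t$, $t\ge 0$, is a continuous time strong Markov process with state space $E$, whose almost all sample paths are right continuous (transition probabilities need not be time homogeneous). For $s\ge0$ let $\tau_{F,s}=\inf\{t>s: Y_t\in F^c\}$; it is assumed that $\tau_{F,s}$ is a stopping time with respect to the natural filtration of $Y$ for all $s\ge 0$. The set $F^c$ is absorbing, i.e., $Y_t=Y_{\tau_{F,s}}$ for all $t\ge\tau_{F,s}$, a.s. Assumptions: (i) $\mathbb P(s<\tau_{F,s}<\infty\mid Y_s=x)=1$ for all $x\in F$ and $s\ge0$. (ii) For every $x\in F$ and $s\ge 0$, the conditional distribution of $\tau_{F,s}$ given $\{Y_s=x\}$ has no atoms. **Fleming-Viot process.** Let $\{U^i_k: 1\le i\le N, k\ge1\}$ be jointly independent random variables with $U^i_k$ uniform on $\{1,\dots,N\}\setminus\{i\}$. Let $\tau_0=0$, $(X^{1,1}_0,\dots,X^{1,N}_0)\in F^N$,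 and let $X^{1,1}_t,\dots,X^{1,N}_t$, $t\ge0$, be independent processes with the transition probabilities of $Y$, independent of the family $\{U^i_k\}$. Let $\tau_1=\inf\{t>0:\exists\, 1\le i\le N,\ X^{1,i}_t\in F^c\}$. Inductively, suppose that $X^{j,1},\dots,X^{j,N}$ and $\tau_j$ are defined for $j\le k$; let $i_j$ be the (a.s. unique) index with $X^{j,i_j}_{\tau_j}\in F^c$. Put $X^{k+1,m}_{\tau_k}=X^{k,m}_{\tau_k}$ for $m\ne i_k$ and $X^{k+1,i_k}_{\tau_k}=X^{k,U^{i_k}_k}_{\tau_k}$. Given the history of the particles up to time $\tau_k$ and the family $\{U^i_k\}$, let $X^{k+1,1}_t,\dots,X^{k+1,N}_t$, $t\ge\tau_k$, be $N$ independent processes with the transition probabilities of $Y$ starting from $X^{k+1,m}_{\tau_k}$, $1\le m\le N$, at time $\tau_k$. Let $\tau_{k+1}=\inf\{t>\tau_k:\exists\, 1\le i\le N,\ X^{k+1,i}_t\in F^c\}$. Define $\mathbf X^N_t=(X^1_t,\dots,X^N_t)$ by $X^m_t=X^{k,m}_t$ for $\tau_{k-1}\le t<\tau_k$, $k\ge1$, $m=1,\dots,N$. The process is defined up to its lifetime $\tau_\infty=\lim_{k\to\infty}\tau_k$. **Labels.** Let $\mathcal A$ be the family of all finite sequences $((a_1,b_1),\dots,(a_k,b_k))$ with $a_i\in\{1,\dots,N\}$ and $b_i\in\mathbb N$ (including $0$). For $\alpha\in\mathcal A$, $\alpha+(m,n)$ denotes $\alpha$ with $(m,n)$ appended. The label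 function $\mathcal L:\{1,\dots,N\}\times[0,\tau_\infty)\to\mathcal A$, with $\mathcal L(i,s)$ written as $\mathcal L(X^i_s)$, is defined as follows. $\mathcal L(X^i_s)=((i,0))$ for $0\le s<\tau_1$, $1\le i\le N$. If $\mathcal L(X^i_s)=\alpha$ for $\tau_{k-1}\le s<\tau_k$, $i\ne i_k$ and $i\ne U^{i_k}_k$, then $\mathcal L(X^i_s)=\alpha$ for $\tau_k\le s<\tau_{k+1}$. If $i=U^{i_k}_k$ and $\mathcal L(X^i_s)=\alpha$ for $\tau_{k-1}\le s<\tau_k$, then $\mathcal L(X^i_s)=\alpha+(i,k)$ and $\mathcal L(X^{i_k}_s)=\alpha+(i_k,k)$ for $\tau_k\le s<\tau_{k+1}$. *)

(* Defs.v *)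
(* MathComp + MathComp-Analysis *)
From HB Require Import structures.
From mathcomp Require Export all_boot all_order all_algebra.
From mathcomp Require Export all_classical all_reals all_analysis.

Set Implicit Arguments.
Unset Strict Implicit.
Unset Printing Implicit Defensive.

Import Order.TTheory GRing.Theory Num.Theory.
Import numFieldNormedType.Exports.

Local Open Scope classical_set_scope.
Local Open Scope ring_scope.
Local Open Scope ereal_scope.

Notation borel E := (g_sigma_algebraType (@open E)).

(** * Processes and stopping times *)

(* Only times t >= 0 are meaningful.  The infimum of the empty set is +oo. *)
Definition hitting_time (R : realType) (E W : Type) (F : set E)
    (Y : R -> W -> E) (s : R) (w : W) : \bar R :=
  ereal_inf [set t%:E | t in [set t : R | (s < t)%R /\ ~ F (Y t w)]].

Definition past_events (R : realType) (E : ptopologicalType) (W : Type)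
    (Y : R -> W -> E) (t : R) : set (set W) :=
  [set B | exists (u : R) (A : set E),
     [/\ (0 <= u <= t)%R, measurable (A : set (borel E)) & B = Y u @^-1` A]].

Definition natural_filtration (R : realType) (E : ptopologicalType) (W : Type)
    (Y : R -> W -> E) (t : R) : set (set W) :=
  <<s past_events Y t >>.

Definition stopping_time (R : realType) (E : ptopologicalType) (W : Type)
    (Y : R -> W -> E) (T : W -> \bar R) : Prop :=
  forall t : R, (0 <= t)%R ->
    natural_filtration Y t [set w | T w <= t%:E].

Definition stopped_sigma_algebra (R : realType) (E : ptopologicalType)
    d (W : measurableType d) (Y : R -> W -> E) (T : W -> \bar R) :
    set (set W) :=
  [set H | measurable H /\ forall t : R, (0 <= t)%R ->
     natural_filtration Y t (H `&` [set w | T w <= t%:E])].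

Definition progressively_measurable (R : realType) (E : ptopologicalType)
    d (W : measurableType d) (Y : R -> W -> E) : Prop :=
  forall t : R, (0 <= t)%R ->
    measurable_fun
      (`[0%R, t] `*` setT
       : set (measurableTypeR R * g_sigma_algebraType (past_events Y t)))
      (fun p : measurableTypeR R * g_sigma_algebraType (past_events Y t) =>
         Y p.1 p.2 : borel E).

(** * The driving process *)

(* A time-inhomogeneous Markov process is a family of laws: PY (s, x) is the
   conditional law of the process given that it is at x at time s, so that the
   transition probabilities are PY (s, x) (Y t @^-1` A), for s <= t.
   For a general topological space E, the measurability of (t, w) |-> Y t w is
   not a consequence of right continuity; as usual it is part of the definition
   of a strong Markov process (it makes Y at a stopping time a random element).
   The kernel is only used at times s >= 0. *)
Record strong_markov (R : realType) (E : ptopologicalType)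
    d (W : measurableType d) (Y : R -> W -> E)
    (PY : R.-pker (measurableTypeR R * borel E) ~> W) : Prop := {
  sm_measurable : forall t : R, (0 <= t)%R ->
    measurable_fun setT (Y t : W -> borel E) ;
  sm_progressive : progressively_measurable Y ;
  sm_start : forall (s : R) (x : E) (A : set (borel E)),
    (0 <= s)%R -> measurable A ->
    PY (s, x) (Y s @^-1` A) = (\1_A x)%:E ;
  sm_markov : forall (s : R) (x : E) (T : W -> \bar R) (H : set W) (u : R)
      (A : set (borel E)),
    (0 <= s)%R -> stopping_time Y T -> (forall w, s%:E <= T w) ->
    stopped_sigma_algebra Y T H -> (0 <= u)%R -> measurable A ->
    PY (s, x) (H `&` [set w | T w < +oo /\ A (Y (fine (T w) + u)%R w)]) =
    \int[PY (s, x)]_(w in H `&` [set w | T w < +oo])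
      PY (fine (T w), Y (fine (T w)) w) (Y (fine (T w) + u)%R @^-1` A) }.

Record driving_process (R : realType) (E : ptopologicalType) (F : set E)
    d (W : measurableType d) (Y : R -> W -> E)
    (PY : R.-pker (measurableTypeR R * borel E) ~> W) : Prop := {
  dp_strong_markov : strong_markov Y PY ;
  dp_right_continuous : forall (s : R) (x : E), (0 <= s)%R ->
    {ae PY (s, x), forall w, forall t : R, (s <= t)%R ->
       Y u w @[u --> t^'+] --> Y t w} ;
  dp_stopping : forall s : R, (0 <= s)%R ->
    stopping_time Y (hitting_time F Y s) ;
  dp_absorbing : forall (s : R) (x : E), (0 <= s)%R ->
    {ae PY (s, x), forall w, forall t : R, hitting_time F Y s w <= t%:E ->
       Y t w = Y (fine (hitting_time F Y s w)) w} }.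

Definition assumption_i (R : realType) (E : ptopologicalType) (F : set E)
    d (W : measurableType d) (Y : R -> W -> E)
    (PY : R.-pker (measurableTypeR R * borel E) ~> W) : Prop :=
  forall (s : R) (x : E), (0 <= s)%R -> F x ->
    PY (s, x) [set w | s%:E < hitting_time F Y s w < +oo] = 1.

Definition assumption_ii (R : realType) (E : ptopologicalType) (F : set E)
    d (W : measurableType d) (Y : R -> W -> E)
    (PY : R.-pker (measurableTypeR R * borel E) ~> W) : Prop :=
  forall (s : R) (x : E) (r : \bar R), (0 <= s)%R -> F x ->
    PY (s, x) [set w | hitting_time F Y s w = r] = 0.

(** * The Fleming-Viot process *)

Definition mutually_independent d (Om : measurableType d) (R : realType)
    (P : probability Om R) (I : eqType) (C : I -> set (set Om)) : Prop :=
  forall (J : seq I) (B : I -> set Om), uniq J ->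
    (forall j, j \in J -> C j (B j)) ->
    P (\bigcap_(j in [set` J]) B j) = \prod_(j <- J) P (B j).

(* Particles are numbered by 'I_N = {0, ..., N - 1}.  X k m is the process
   X^{k,m} and U k i the variable U^i_k; as in the construction both are used
   for k >= 1 only, and X k m t is used for t >= tau_{k-1} only. *)

Fixpoint jump_time (R : realType) (E Om : Type) (F : set E) (N : nat)
    (X : nat -> 'I_N -> R -> Om -> E) (k : nat) (w : Om) : \bar R :=
  if k is k'.+1 then
    ereal_inf [set t%:E | t in [set t : R |
      jump_time F X k' w < t%:E /\ exists i : 'I_N, ~ F (X k'.+1 i t w)]]
  else 0.

Definition lifetime (R : realType) (E Om : Type) (F : set E) (N : nat)
    (X : nat -> 'I_N -> R -> Om -> E) (w : Om) : \bar R :=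
  limn (fun k => jump_time F X k w).

(* Junk value Z 0 where T is infinite; for T = tau_k this has probability 0. *)
Definition at_time (R : realType) (E Om : Type) (Z : R -> Om -> E)
    (T : Om -> \bar R) (w : Om) : E :=
  Z (fine (T w)) w.

(* The index i_k; None when no particle is in the complement of F at the k-th
   jump time, and arbitrary when several are (both have probability zero). *)
Definition exiting (R : realType) (E Om : Type) (F : set E) (N : nat)
    (X : nat -> 'I_N -> R -> Om -> E) (k : nat) (w : Om) : option 'I_N :=
  [pick i : 'I_N | `[< ~ F (at_time (X k i) (jump_time F X k) w) >]].

(* The particle whose position X^{k+1,m} takes over at the k-th jump time. *)
Definition parent (R : realType) (E Om : Type) (F : set E) (N : nat)
    (X : nat -> 'I_N -> R -> Om -> E) (U : nat -> 'I_N -> Om -> 'I_N)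
    (k : nat) (m : 'I_N) (w : Om) : 'I_N :=
  if exiting F X k w == Some m then U k m w else m.

Definition initial_events (R : realType) (E : ptopologicalType) (Om : Type)
    (N : nat) (X : nat -> 'I_N -> R -> Om -> E) : set (set Om) :=
  [set B | exists (m : 'I_N) (A : set E),
     measurable (A : set (borel E)) /\ B = X 1%N m 0%R @^-1` A].

(* The sigma-algebra generated by the whole family U and by the history of the
   particles up to the k-th jump time: the initial positions, the jump times
   tau_j, j <= k, and the pieces X^{j,m}_t, tau_{j-1} <= t <= tau_j, j <= k. *)
Definition history (R : realType) (E : ptopologicalType) (Om : Type)
    (F : set E) (N : nat) (X : nat -> 'I_N -> R -> Om -> E)
    (U : nat -> 'I_N -> Om -> 'I_N) (k : nat) : set (set Om) :=
  <<s [set B | exists (l : nat) (i a : 'I_N),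
         (0 < l)%N /\ B = U l i @^-1` [set a]]
      `|` initial_events X
      `|` [set B | exists (j : nat) (t : R),
             (j <= k)%N /\ B = [set w | jump_time F X j w <= t%:E]]
      `|` [set B | exists (j : nat) (m : 'I_N) (t : R) (A : set E),
             [/\ (j < k)%N, (0 <= t)%R, measurable (A : set (borel E)) &
              B = [set w | jump_time F X j w <= t%:E /\
                     A (at_time (X j.+1 m)
                          (fun w => mine t%:E (jump_time F X j.+1 w)) w)]] ] >>.

(* A process with the transition probabilities of Y that starts from x at time
   s is a copy of Y under PY (s, x): xi k m is a random point of the sample
   space W of Y, and X^{k,m} is its sample path.  (When W is a space of paths
   with evaluation maps Y t, xi k m is the path of X^{k,m} itself.) *)
Definition copy_path (R : realType) (E W Om : Type) (N : nat)
    (Y : R -> W -> E) (xi : nat -> 'I_N -> Om -> W) :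
    nat -> 'I_N -> R -> Om -> E :=
  fun k m t w => Y t (xi k m w).

Record fleming_viot (R : realType) (E : ptopologicalType) (F : set E)
    d (W : measurableType d) (Y : R -> W -> E)
    (PY : R.-pker (measurableTypeR R * borel E) ~> W)
    d' (Om : measurableType d') (P : probability Om R) (N : nat)
    (xi : nat -> 'I_N -> Om -> W) (U : nat -> 'I_N -> Om -> 'I_N)
    (X := copy_path Y xi) (tau := jump_time F X) : Prop := {
  fv_xi_measurable : forall k m, (0 < k)%N -> measurable_fun setT (xi k m) ;
  fv_U_measurable : forall k i a, (0 < k)%N ->
    measurable (U k i @^-1` [set a]) ;
  fv_U_uniform : forall k (i a : 'I_N), (0 < k)%N ->
    P (U k i @^-1` [set a]) = (if a == i then 0 else (N.-1%:R^-1)%:E) ;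
  (* joint independence of the U^i_k and the initial configuration *)
  fv_U_independent : mutually_independent P
    (fun c : option (nat * 'I_N) =>
       if c is Some (k, i) then [set U k.+1 i @^-1` S | S in setT]
       else <<s initial_events X >>) ;
  fv_start : {ae P, forall w, forall m, F (X 1%N m 0%R w)} ;
  fv_restart : forall k, (0 < k)%N ->
    {ae P, forall w, forall m,
       at_time (X k.+1 m) (tau k) w =
       at_time (X k (parent F X U k m w)) (tau k) w} ;
  (* conditionally on the history, the X^{k+1,m}, 1 <= m <= N, are independent
     copies of Y started at time tau_k from X^{k+1,m}_{tau_k} *)
  fv_evolution : forall (k : nat) (H : set Om) (B : 'I_N -> set W),
    history F X U k H -> (forall m, measurable (B m)) ->
    P (H `&` \bigcap_(m in [set: 'I_N]) (xi k.+1 m @^-1` B m)) =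
    \int[P]_(w in H)
      \prod_(m < N) PY (fine (tau k w), at_time (X k.+1 m) (tau k) w) (B m) }.

(** * Labels *)

(* The label of particle i on the time interval [tau_k, tau_{k+1}[. *)
Fixpoint stage_label (R : realType) (E Om : Type) (F : set E) (N : nat)
    (X : nat -> 'I_N -> R -> Om -> E) (U : nat -> 'I_N -> Om -> 'I_N)
    (k : nat) (i : 'I_N) (w : Om) : seq ('I_N * nat) :=
  if k is k'.+1 then
    let lab j := stage_label F X U k' j w in
    if exiting F X k w is Some ik then
      let u := U k ik w in
      if (i == u) || (i == ik) then rcons (lab u) (i, k) else lab i
    else lab i
  else [:: (i, 0%N)].

Definition stage (R : realType) (E Om : Type) (F : set E) (N : nat)
    (X : nat -> 'I_N -> R -> Om -> E) (s : R) (w : Om) : nat :=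
  xget 0%N [set k | jump_time F X k w <= s%:E < jump_time F X k.+1 w].

(* Meaningful for 0 <= s < lifetime. *)
Definition label (R : realType) (E Om : Type) (F : set E) (N : nat)
    (X : nat -> 'I_N -> R -> Om -> E) (U : nat -> 'I_N -> Om -> 'I_N)
    (i : 'I_N) (s : R) (w : Om) : seq ('I_N * nat) :=
  stage_label F X U (stage F X s w) i w.

(* Main.v *)
From HB Require Import structures.
Require Import Defs.
From mathcomp Require Import all_boot all_order all_algebra.
From mathcomp Require Import finmap ring lra zify.
From mathcomp Require Import all_classical all_reals all_analysis.
From mathcomp Require Import measurable_realfun.

Set Implicit Arguments.
Unset Strict Implicit.
Unset Printing Implicit Defensive.

Import Order.TTheory GRing.Theory Num.Theory.
Import numFieldNormedType.Exports.

Local Open Scope classical_set_scope.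
Local Open Scope ring_scope.
Local Open Scope ereal_scope.

(** Write a stage for the time between two jumps.  The labels in use at a given
    stage are pairwise incomparable for the prefix order, and every label in use
    later extends exactly one of them.  Hence the infinite label exists and is
    unique as soon as, after every stage, the whole population eventually
    descends from a single particle of that stage.

    For this coalescence, take the (rational) time z that is, up to constants,
    the largest median of the exit times of the N particles at some stage.  With
    probability bounded below the particle realizing this maximum survives z and
    all the others leave F before z.  Each particle that leaves F is reborn on
    the surviving family with probability at least 1/(N-1); by conditional
    independence and the strong Markov property at the jump, the event that the
    family survives z while the remaining particles do not keeps a conditional
    probability bounded below.  After at most N-1 such jumps everybody descends
    from the survivor, so coalescence has conditional probability bounded below
    by a constant depending on N alone, and the trials are repeated. *)

(** The lifetime may be finite, so time is never sent to infinity: estimates are conditional on what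
    is known at a stage and are iterated over stages. The quantity that is propagated is [survive],
    and the maximal median makes it at least 3^-N at the start. Each particle is in F at its own
    median with probability between 1/3 and 2/3; at the largest median its owner is in F with
    probability at least 1/3, and any other particle, being past its own median, is outside F with
    probability at least 1/3. As the laws have no atoms, these times can be rational, which matters
    twice: being in F at time z means exiting after z only off a null set that depends on z, and a
    random z with countably many values splits the space into countably many events. The obstacle is
    that the jump is a random time for the survivors. Conditional independence removes it: given the
    other paths, the exit time of the particle that jumps is a constant for a survivor, and the
    Markov property is applied at that constant. Hence the care given below to integrating out one
    path while all the others are frozen. *)

(** * Functionals that behave like an integral *)

Section integral_like.
Context d (T : measurableType d) (R : realType).
Implicit Types (f g : T -> \bar R) (I J : (T -> \bar R) -> \bar R).

Definition mfun_ge0 f := measurable_fun setT f /\ forall x, 0 <= f x.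

(** An integral seen only through its action on nonnegative functions. Iterated integrals with a
    random kernel have these properties, so two of them can be compared without constructing the
    measures that they define. *)
Record integral_like I : Prop := {
  ilike_ge0 : forall f, mfun_ge0 f -> 0 <= I f ;
  ilikeD : forall f g, mfun_ge0 f -> mfun_ge0 g ->
    I (fun x => f x + g x) = I f + I g ;
  ilikeZ : forall (r : R) f, (0 <= r)%R -> mfun_ge0 f ->
    I (fun x => r%:E * f x) = r%:E * I f ;
  ilike_le : forall f g, mfun_ge0 f -> mfun_ge0 g ->
    (forall x, f x <= g x) -> I f <= I g ;
  ilike_lim : forall (f : nat -> T -> \bar R), (forall n, mfun_ge0 (f n)) ->
    (forall x, nondecreasing_seq (f ^~ x)) ->
    I (fun x => limn (f ^~ x)) = limn (fun n => I (f n)) }.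

Import HBNNSimple.

(** Linearity carries the equality from indicators to simple functions, and monotone limits carry it
    to nonnegative measurable functions. *)
Lemma integral_like_eq I J : integral_like I -> integral_like J ->
  (forall A, measurable A ->
     I (fun x => (\1_A x)%:E) = J (fun x => (\1_A x)%:E)) ->
  forall f, mfun_ge0 f -> I f = J f.
Proof.
move=> hI hJ IJ1 f [mf f0].
have mind (A : set T) : measurable A -> mfun_ge0 (fun x => (\1_A x)%:E).
  move=> mA; split => [|x]; last by rewrite lee_fin.
  by apply/measurable_EFinP; rewrite (_ : \1_A = mindic R mA).
have IJs (h : {nnsfun T >-> R}) :
    I (fun x => (h x)%:E) = J (fun x => (h x)%:E).
  (* The absolute value changes nothing on the range of [h], but it makes every coefficient
     admissible for [ilikeZ] in the induction on the list. *)
  have -> : (fun x => (h x)%:E) = (fun x => \sum_(r <- fset_set (range h))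
      (`|r|%:E * (\1_(h @^-1` [set r]) x)%:E)).
    apply/funext => x; rewrite fimfunE -fsumEFin// fsbig_finite//=.
    apply: eq_big_seq => r; rewrite in_fset_set// => /set_mem[y _ <-].
    by rewrite EFinM ger0_norm.
  have mt r : mfun_ge0 (fun x => `|r|%:E * (\1_(h @^-1` [set r]) x)%:E).
    have /mind[m1 g1] : measurable (h @^-1` [set r]) by exact: measurable_sfunP.
    by split; [exact: measurable_funeM | move=> x; rewrite mule_ge0].
  elim: (enum_fset _) => [|r s IH].
    under [X in I X]eq_fun do rewrite big_nil.
    under [X in J X]eq_fun do rewrite big_nil.
    by have := IJ1 set0 measurable0; rewrite indic0.
  under [X in I X]eq_fun do rewrite big_cons.
  under [X in J X]eq_fun do rewrite big_cons.
  have ms : mfun_ge0 (fun x => \sum_(r <- s)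
      (`|r|%:E * (\1_(h @^-1` [set r]) x)%:E)).
    split; first by apply: emeasurable_sum => q; case: (mt q).
    by move=> x; apply: sume_ge0 => q _; case: (mt q).
  rewrite (ilikeD hI)// (ilikeD hJ)// IH; congr (_ + _).
  have mr : measurable (h @^-1` [set r]) by exact: measurable_sfunP.
  by rewrite (ilikeZ hI)//; [rewrite (ilikeZ hJ)//; [rewrite IJ1|exact: mind]
     |exact: mind].
pose f_ := nnsfun_approx measurableT mf.
have fE : f = (fun x => limn (fun n => (f_ n x)%:E)).
  by apply/funext => x; apply/esym/cvg_lim => //; exact: cvg_nnsfun_approx.
have mf_ n : mfun_ge0 (fun x => (f_ n x)%:E).
  by split => [|x]; [exact/measurable_EFinP | rewrite lee_fin].
have nf_ x : nondecreasing_seq (fun n => (f_ n x)%:E).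
  by move=> m n mn; rewrite lee_fin; exact/lefP/nd_nnsfun_approx.
rewrite fE (ilike_lim hI)// (ilike_lim hJ)//.
by congr (limn _); apply/funext => n; exact: IJs.
Qed.

End integral_like.

Section integral_like_ex.
Context d (T : measurableType d) d' (T' : measurableType d') (R : realType).

Lemma integral_like_integral (mu : {measure set T' -> \bar R}) (S : set T')
    (J : T' -> (T -> \bar R) -> \bar R) : measurable S ->
  (forall w, integral_like (J w)) ->
  (forall f, mfun_ge0 f -> measurable_fun setT (J ^~ f)) ->
  integral_like (fun f => \int[mu]_(w in S) J w f).
Proof.
move=> mS hJ mJ; have mJS f : mfun_ge0 f -> measurable_fun S (J ^~ f).
  by move=> mf; apply: measurable_funTS; exact: mJ.
split.
- by move=> f mf; apply: integral_ge0 => w _; exact: (ilike_ge0 (hJ w)).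
- move=> f g mf mg; rewrite -ge0_integralD//.
  + by apply: eq_integral => w _; rewrite (ilikeD (hJ w)).
  + by move=> w _; exact: (ilike_ge0 (hJ w)).
  + exact: mJS.
  + by move=> w _; exact: (ilike_ge0 (hJ w)).
  + exact: mJS.
- move=> r f r0 mf; rewrite -ge0_integralZl//.
  + by apply: eq_integral => w _; rewrite (ilikeZ (hJ w)).
  + exact: mJS.
  + by move=> w _; exact: (ilike_ge0 (hJ w)).
- move=> f g mf mg fg; apply: ge0_le_integral => //.
  + by move=> w _; exact: (ilike_ge0 (hJ w)).
  + exact: mJS.
  + exact: mJS.
  + by move=> w _; exact: (ilike_le (hJ w)).
- move=> f mf ndf; rewrite -monotone_convergence//.
  + by apply: eq_integral => w _; rewrite (ilike_lim (hJ w)).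
  + by move=> n; exact: mJS.
  + by move=> n w _; exact: (ilike_ge0 (hJ w)).
  + move=> w _ m n mn; apply: (ilike_le (hJ w)) => // x; exact: ndf.
Qed.

(** A weighted Dirac mass. Averaging it with [integral_like_integral] yields the functionals
    compared below. *)
Lemma integral_like_eval (x : T) (c : R) : (0 <= c)%R ->
  @integral_like _ T R (fun f => c%:E * f x).
Proof.
move=> c0; split.
- by move=> f [_ f0]; rewrite mule_ge0.
- by move=> f g [_ f0] [_ g0]; rewrite ge0_muleDr.
- by move=> r f r0 [_ f0]; rewrite muleCA.
- by move=> f g _ _ fg; rewrite lee_wpmul2l.
- move=> f mf ndf; apply/esym/cvg_lim => //.
  by apply: cvgeZl => //; exact: ereal_nondecreasing_is_cvgn.
Qed.

End integral_like_ex.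

Section integral_like_ex2.
Context d (T : measurableType d) d' (T' : measurableType d') (R : realType).

Lemma integral_like_comp (mu : {measure set T' -> \bar R}) (phi : T' -> T) :
  measurable_fun setT phi ->
  @integral_like _ T R (fun f => \int[mu]_w f (phi w)).
Proof.
move=> mphi.
suff : integral_like (fun f : T -> \bar R => \int[mu]_w (1%:E * f (phi w))).
  have -> // : (fun f : T -> \bar R => \int[mu]_w (1%:E * f (phi w))) =
    (fun f => \int[mu]_w f (phi w)).
  by apply/funext => f; apply: eq_integral => w _; rewrite mul1e.
apply: integral_like_integral => //.
- by move=> w; exact: integral_like_eval.
- move=> f [mf _]; under eq_fun do rewrite mul1e.
  exact: measurableT_comp.
Qed.

End integral_like_ex2.

Section integral_like_pi.
Context d (T : measurableType d) (R : realType).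
Variables (C : set (set T)) (I J : (T -> \bar R) -> \bar R).
Hypotheses (mC : measurable = <<s C >>) (CI : setI_closed C) (CT : C setT).
Hypotheses (hI : integral_like I) (hJ : integral_like J).
Hypothesis Ioo : I (fun=> 1) < +oo.
Hypothesis IJC : forall A, C A ->
  I (fun x => (\1_A x)%:E) = J (fun x => (\1_A x)%:E).

Let mind (A : set T) : measurable A -> @mfun_ge0 _ T R (fun x => (\1_A x)%:E).
Proof.
move=> mA; split => [|x]; last by rewrite lee_fin.
by apply/measurable_EFinP; rewrite (_ : \1_A = mindic R mA).
Qed.

Let Ifin (A : set T) : measurable A -> I (fun x => (\1_A x)%:E) \is a fin_num.
Proof.
move=> mA; rewrite ge0_fin_numE; last exact: (ilike_ge0 hI (mind mA)).
apply: le_lt_trans Ioo; apply: (ilike_le hI); first exact: mind.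
  by split.
by move=> x; rewrite lee_fin indicE; case: (_ \in _).
Qed.

Let indic_setC (A : set T) : measurable A ->
  (fun=> 1) = (fun x => (\1_A x)%:E + (\1_(~` A) x)%:E) :> (T -> \bar R).
Proof.
move=> mA; apply/funext => x; rewrite -EFinD !indicE in_setC.
by case: (x \in A) => /=; rewrite ?addr0 ?add0r.
Qed.

(** By Dynkin's theorem, agreement passes from a pi-system to the sigma-algebra that it generates.
    Finiteness of [I] at 1 allows the subtraction in the step for complements. *)
Lemma integral_like_pi f : mfun_ge0 f -> I f = J f.
Proof.
apply: integral_like_eq => //; rewrite mC.
apply: (@dynkin_induction _ T C) => //=.
- exact: IJC.
- move=> S mS IJS; have mS' := measurableC mS.
  have := congr1 I (indic_setC mS); rewrite (ilikeD hI)//; try exact: mind.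
  have := congr1 J (indic_setC mS); rewrite (ilikeD hJ)//; try exact: mind.
  have <- : I (fun=> 1) = J (fun=> 1).
    have <- : (fun x => (\1_(setT : set T) x)%:E) = (fun=> 1) :> (T -> \bar R).
      by apply/funext => x; rewrite indicT.
    exact: IJC.
  move=> -> /esym; rewrite -IJS => e.
  have := congr1 (fun u => u - I (fun x => (\1_S x)%:E)) e.
  by rewrite ![_ + I (fun x => (\1_(~` S) x)%:E)]addeC [_ + J _]addeC
    !addeK// Ifin.
- move=> F mF tF IJF.
  pose S n := \big[setU/set0]_(i < n) F i.
  have mS n : measurable (S n) by exact: bigsetU_measurable.
  have IJS n : I (fun x => (\1_(S n) x)%:E) = J (fun x => (\1_(S n) x)%:E).
    elim: n => [|n IHn].
      rewrite /S big_ord0.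
      have -> : (fun x => (\1_(set0 : set T) x)%:E) =
                (fun x => 0%:E * (\1_(setT : set T) x)%:E) :> (T -> \bar R).
        by apply/funext => x; rewrite mul0e indic0.
      have mT := mind measurableT.
      by rewrite (ilikeZ hI)// (ilikeZ hJ)// !mul0e.
    have -> : (fun x => (\1_(S n.+1) x)%:E) =
        (fun x => (\1_(S n) x)%:E + (\1_(F n) x)%:E) :> (T -> \bar R).
      apply/funext => x; rewrite /S big_ord_recr/= -EFinD; congr EFin.
      rewrite !indicE in_setU.
      have : ~ ((x \in \big[setU/set0]_(i < n) F i) /\ x \in F n).
        move=> -[/set_mem + /set_mem Fnx]; rewrite -bigcup_mkord => -[i /= ilt Fix].
        have ni := tF i n Logic.I Logic.I (ex_intro _ x (conj Fix Fnx)).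
        by rewrite ni ltnn in ilt.
      case: (x \in \big[_/_]_(_ < _) _); case: (x \in F n) => //= h;
        rewrite ?addr0 ?add0r//.
      by exfalso; apply: h.
    by rewrite (ilikeD hI)//; try exact: mind; rewrite (ilikeD hJ)//;
      try exact: mind; rewrite IHn IJF.
  have ndS x : nondecreasing_seq (fun n => (\1_(S n) x)%:E : \bar R).
    move=> m n mn; rewrite lee_fin !indicE ler_nat.
    case: (boolP (x \in S m)) => //= /set_mem xm.
    by rewrite mem_set//=; apply: subset_bigsetU xm.
  have -> : (fun x => (\1_(\bigcup_k F k) x)%:E) =
      (fun x => limn (fun n => (\1_(S n) x)%:E : \bar R)).
    apply/funext => x; apply/esym/cvg_lim => //.
    rewrite indicE; case: (boolP (x \in _)) => [/set_mem[k _ Fkx]|nx].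
      apply: cvg_near_cst; exists k.+1 => // n /= kn.
      rewrite indicE mem_set// /S -bigcup_mkord; by exists k.
    apply: cvg_near_cst; apply: nearW => n.
    rewrite indicE memNset// /S -bigcup_mkord => -[k _ Fkx].
    by move/negP: nx; apply; apply: mem_set; exists k.
  rewrite (ilike_lim hI)//; try by move=> n; exact: mind.
  rewrite (ilike_lim hJ)//; try by move=> n; exact: mind.
  by congr (limn _); apply/funext => n.
Qed.

End integral_like_pi.

(** * Kernels evaluated at a random point *)

Section kernel_precomp.
Context d1 d2 d3 (X : measurableType d1) (T : measurableType d2)
  (Y : measurableType d3) (R : realType).
Variables (Z : X -> T) (mZ : measurable_fun setT Z) (k : R.-pker T ~> Y).

(** The proof of measurability is an argument so that the kernel structure can be attached to the
    definition. *)
Definition precomp_kernel of measurable_fun setT Z :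
  X -> {measure set Y -> \bar R} := fun x => k (Z x).

Let kZ := precomp_kernel mZ.

Let measurable_precomp U : measurable U -> measurable_fun [set: X] (kZ ^~ U).
Proof.
by move=> mU; apply: (measurableT_comp (measurable_kernel k U mU) mZ).
Qed.

HB.instance Definition _ := isKernel.Build _ _ _ _ _ kZ measurable_precomp.

Let precomp_prob x : kZ x [set: Y] = 1.
Proof. exact: prob_kernel. Qed.

HB.instance Definition _ := Kernel_isProbability.Build _ _ _ _ _ kZ precomp_prob.

Lemma measurable_integral_precomp (f : X * Y -> \bar R) : mfun_ge0 f ->
  measurable_fun setT (fun x => \int[k (Z x)]_y f (x, y)).
Proof.
by case=> mf f0; exact: (measurable_fun_integral_finite_kernel f kZ).
Qed.

End kernel_precomp.

Section pker.
Context d (T : measurableType d) d' (W : measurableType d') (R : realType).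
Variable k : R.-pker T ~> W.

Lemma pker_le1 x B : measurable B -> k x B <= 1.
Proof.
move=> mB; have <- : k x setT = 1 by exact: prob_kernel.
by apply: le_measure => //; rewrite inE.
Qed.

Lemma pker_fin_num x B : measurable B -> k x B \is a fin_num.
Proof.
by move=> mB; rewrite ge0_fin_numE// (le_lt_trans (pker_le1 x mB))// ltry.
Qed.

End pker.

(** * Disintegration over a sub-sigma-algebra *)

Section sub_sigma_algebra.
Context dO (Om : measurableType dO) (R : realType) (P : probability Om R).
Variables (G : set (set Om)).
Hypothesis Gm : G `<=` measurable.

Lemma g_sigma_measurable (A : set Om) : <<s G >> A -> measurable A.
Proof.
by apply: smallest_sub; [exact: sigma_algebra_measurable | exact: Gm].
Qed.

Lemma measurable_fun_g_sigma d (T : measurableType d) (f : Om -> T) :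
  measurable_fun (setT : set (g_sigma_algebraType G)) f ->
  measurable_fun setT f.
Proof.
by move=> mf mT A mA; apply: g_sigma_measurable; exact: mf.
Qed.

Lemma measurable_id_g_sigma :
  measurable_fun setT (id : Om -> g_sigma_algebraType G).
Proof. by move=> _ A mA; rewrite setTI; exact: g_sigma_measurable. Qed.

(** [h] acts as the conditional probability of [E] given [<<s G >>]; its defining relation on events
    extends to integrands. *)
Lemma integral_weighted (E : set Om) (h : Om -> \bar R) : measurable E ->
  measurable_fun setT h -> (forall w, 0 <= h w) ->
  (forall w, h w \is a fin_num) ->
  (forall K, <<s G >> K -> P (K `&` E) = \int[P]_(w in K) h w) ->
  forall g : g_sigma_algebraType G -> \bar R, mfun_ge0 g ->
  \int[P]_(w in E) g w = \int[P]_w (h w * g w).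
Proof.
move=> mE mh h0 hfin PE.
have mg (g : g_sigma_algebraType G -> \bar R) : mfun_ge0 g ->
    measurable_fun (setT : set Om) g.
  by case=> mg _; exact: measurable_fun_g_sigma.
pose I (g : g_sigma_algebraType G -> \bar R) := \int[P]_(w in E) (1%:E * g w).
pose J (g : g_sigma_algebraType G -> \bar R) :=
  \int[P]_w ((fine (h w))%:E * g w).
suff IJ : forall g, mfun_ge0 g -> I g = J g.
  move=> g /IJ; rewrite /I /J.
  under eq_integral do rewrite mul1e.
  by under [X in _ = X -> _]eq_integral do rewrite fineK//.
apply: integral_like_eq.
- apply: integral_like_integral => // [w|g /mg mg'].
    exact: integral_like_eval.
  by under eq_fun do rewrite mul1e.
- apply: integral_like_integral => // [w|g /mg mg'].
    by apply: integral_like_eval; rewrite fine_ge0.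
  by under eq_fun do rewrite fineK//; exact: emeasurable_funM.
- move=> A mA; have mA' := g_sigma_measurable mA.
  rewrite /I /J; under eq_integral do rewrite mul1e.
  rewrite integral_indic//; transitivity (\int[P]_(w in A) h w); first exact: PE.
  rewrite integral_mkcond.
  apply: eq_integral => w _; rewrite patchE fineK// indicE.
  by case: (w \in A) => /=; rewrite ?mule1 ?mule0.
Qed.

(** [k (Z w)] is the conditional law of [xi] given [<<s G >>]. On measurable rectangles, which form
    a generating pi-system, the formula is the hypothesis. *)
Lemma integral_disintegration d (T : measurableType d) d' (W : measurableType d')
    (k : R.-pker T ~> W) (Z : g_sigma_algebraType G -> T) (xi : Om -> W) :
  measurable_fun setT Z -> measurable_fun setT xi ->
  (forall K B, <<s G >> K -> measurable B ->
     P (K `&` xi @^-1` B) = \int[P]_(w in K) k (Z w) B) ->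
  forall f : g_sigma_algebraType G * W -> \bar R, mfun_ge0 f ->
  \int[P]_w f (w, xi w) = \int[P]_w \int[k (Z w)]_y f (w, y).
Proof.
move=> mZ mxi PK.
pose C := [set A `*` B | A in @measurable _ (g_sigma_algebraType G) &
                         B in @measurable _ W].
have mpair : measurable_fun setT
    (fun w : Om => (w : g_sigma_algebraType G, xi w)).
  by apply: measurable_fun_pair => //; exact: measurable_id_g_sigma.
apply: (@integral_like_pi _ _ _ C) => //=.
- exact: measurable_prod_measurableType.
- move=> _ _ [X1 mX1 [X2 mX2 <-]] [Y1 mY1 [Y2 mY2 <-]].
  exists (X1 `&` Y1); first exact: measurableI.
  by exists (X2 `&` Y2); [exact: measurableI|rewrite setXI].
- by exists setT => //; exists setT => //; rewrite setXTT.
- exact: integral_like_comp.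
- apply: integral_like_integral => // [w|f mf].
    apply: integral_like_comp; exact: pair1_measurable.
  by apply: measurable_fun_g_sigma; exact: measurable_integral_precomp.
- rewrite integral_cst// mul1e; apply: (@le_lt_trans _ _ 1); last exact: ltry.
  exact: probability_le1.
- move=> _ [A mA [B mB <-]].
  have mA' := g_sigma_measurable mA.
  under eq_integral => w _.
    rewrite (_ : \1__ _ = \1_(A `&` xi @^-1` B) w); last first.
      by rewrite !indicE in_setI in_setX.
    over.
  rewrite integral_indic//; last first.
    by apply: measurableI => //; rewrite -[X in measurable X]setTI; exact: mxi.
  rewrite setIT; transitivity (\int[P]_(w in A) k (Z w) B); first exact: PK.
  rewrite integral_mkcond; apply: eq_integral => w _.
  rewrite patchE; case: ifPn => wA.
    under eq_integral => y _.
      rewrite (_ : \1__ _ = \1_B y); last by rewrite !indicE in_setX/= wA.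
      over.
    by rewrite integral_indic// setIT.
  rewrite integral0_eq// => y _.
  by rewrite indicE in_setX/= (negbTE wA).
Qed.

End sub_sigma_algebra.

(** * Conditionally independent copies *)

Section conditional_copies.
Context dO (Om : measurableType dO) (R : realType) (P : probability Om R).
Context d (T : measurableType d) d' (W : measurableType d').
Variables (k : R.-pker T ~> W) (N : nat) (xi : 'I_N -> Om -> W).
Variables (G : set (set Om)) (Z : 'I_N -> Om -> T).
Hypothesis Gm : G `<=` measurable.
Hypothesis mxi : forall m, measurable_fun setT (xi m).
Hypothesis mZ : forall m,
  measurable_fun (setT : set (g_sigma_algebraType G)) (Z m).
Hypothesis copies : forall H (B : 'I_N -> set W), <<s G >> H ->
  (forall m, measurable (B m)) ->
  P (H `&` \bigcap_(m in [set: 'I_N]) (xi m @^-1` B m)) =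
  \int[P]_(w in H) \prod_(m < N) k (Z m w) (B m).

(** The copies in [D] are left out, since [B m] must be the whole space there. These events form a
    pi-system generating the sigma-algebra of [G] and the remaining copies. *)
Definition copy_events (D : set 'I_N) : set (set Om) :=
  [set K | exists H (B : 'I_N -> set W),
     [/\ <<s G >> H, forall m, measurable (B m), forall m, D m -> B m = setT &
         K = H `&` \bigcap_(m in [set: 'I_N]) (xi m @^-1` B m)]].

Let mbigcap (B : 'I_N -> set W) : (forall m, measurable (B m)) ->
  measurable (\bigcap_(m in [set: 'I_N]) (xi m @^-1` B m)).
Proof.
move=> mB; apply: fin_bigcap_measurable => // m _.
by rewrite -[X in measurable X]setTI; exact: mxi.
Qed.

Lemma copy_events_measurable D : copy_events D `<=` measurable.
Proof.
move=> _ [H [B [GH mB _ ->]]]; apply: measurableI; last exact: mbigcap.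
exact: g_sigma_measurable GH.
Qed.

Lemma copy_events_sub D : <<s G >> `<=` copy_events D.
Proof.
move=> H GH; exists H, (fun=> setT); split => //.
by rewrite (_ : \bigcap_(m in _) _ = setT) ?setIT// -subTset.
Qed.

Lemma copy_events_setI D : setI_closed (copy_events D).
Proof.
move=> _ _ [H [B [GH mB DB ->]]] [H' [B' [GH' mB' DB' ->]]].
exists (H `&` H'), (fun m => B m `&` B' m); split => //.
- exact: (@measurableI _ (g_sigma_algebraType G)).
- by move=> m; exact: measurableI.
- by move=> m Dm; rewrite DB// DB'// setIT.
- by rewrite setIACA; congr (_ `&` _); rewrite -bigcapI.
Qed.

Lemma copy_events_preimage (D : set 'I_N) m B : ~ D m -> measurable B ->
  copy_events D (xi m @^-1` B).
Proof.
move=> Dm mB; exists setT, (fun j => if j == m then B else setT); split.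
- exact: (@measurableT _ (g_sigma_algebraType G)).
- by move=> j; case: ifP.
- by move=> j Dj; case: eqP => // jm; rewrite jm in Dj.
- rewrite setTI; apply/seteqP; split => [w Bw j _|w].
    by rewrite /=; case: eqP => // ->.
  by move/(_ m Logic.I); rewrite /= eqxx.
Qed.

Let kprod_fin (B : 'I_N -> set W) w : (forall m, measurable (B m)) ->
  \prod_(m < N) k (Z m w) (B m) \is a fin_num.
Proof.
by move=> mB; apply: prode_fin_num => m _; exact: pker_fin_num.
Qed.

Lemma measurable_kernel_Z m (B : set W) : measurable B ->
  measurable_fun (setT : set (g_sigma_algebraType G)) (fun w => k (Z m w) B).
Proof.
by move=> mB; exact: (measurableT_comp (measurable_kernel k B mB) (mZ m)).
Qed.

Lemma emeasurable_prod (I : Type) (s : seq I) dT (X : measurableType dT)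
    (h : I -> X -> \bar R) (Q : pred I) :
  (forall i, Q i -> measurable_fun setT (h i)) ->
  measurable_fun setT (fun x => \prod_(i <- s | Q i) h i x).
Proof.
move=> mh; elim: s => [|i s IH].
  by under eq_fun do rewrite big_nil; exact: measurable_cst.
under eq_fun do rewrite big_cons.
by case Qi : (Q i) => //; apply: emeasurable_funM => //; exact: mh.
Qed.

Lemma copies_integral (B : 'I_N -> set W) (g : g_sigma_algebraType G -> \bar R) :
  (forall m, measurable (B m)) -> mfun_ge0 g ->
  \int[P]_(w in \bigcap_(m in [set: 'I_N]) (xi m @^-1` B m)) g w =
  \int[P]_w ((\prod_(m < N) k (Z m w) (B m)) * g w).
Proof.
move=> mB; apply: integral_weighted => //.
- exact: mbigcap.
- apply: measurable_fun_g_sigma Gm _ _ _ _; apply: emeasurable_prod => m _.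
  exact: measurable_kernel_Z.
- by move=> w; apply: prode_ge0 => m _.
- by move=> w; exact: kprod_fin.
- by move=> K GK; exact: copies.
Qed.

(* Conditional independence: given G and the copies other than the n-th one,
   the n-th copy still has conditional law k (Z n). *)
Lemma copies_indep n K B : <<s copy_events [set n] >> K -> measurable B ->
  P (K `&` xi n @^-1` B) = \int[P]_(w in K) k (Z n w) B.
Proof.
move=> sK mB.
have mK : measurable K.
  by move: sK; apply: g_sigma_measurable; exact: copy_events_measurable.
have mxiB : measurable (xi n @^-1` B).
  by rewrite -[X in measurable X]setTI; exact: mxi.
have mkn := measurable_fun_g_sigma Gm (measurable_kernel_Z n mB).
have knfin w : k (Z n w) B \is a fin_num by exact: pker_fin_num.
pose S := g_sigma_algebraType (copy_events [set n]).
have mS (f : S -> \bar R) : mfun_ge0 f -> measurable_fun (setT : set Om) f.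
  by case=> mf _; apply: measurable_fun_g_sigma mf; exact: copy_events_measurable.
pose I (f : S -> \bar R) := \int[P]_(w in xi n @^-1` B) (1%:E * f w).
pose J (f : S -> \bar R) := \int[P]_w ((fine (k (Z n w) B))%:E * f w).
suff /(_ (fun w => (\1_K w)%:E)) : forall f, mfun_ge0 f -> I f = J f.
  rewrite /I /J; under eq_integral do rewrite mul1e.
  rewrite integral_indic// => ->.
    rewrite [RHS]integral_mkcond; apply: eq_integral => w _; rewrite patchE indicE.
    by rewrite fineK//; case: (w \in K) => /=; rewrite ?mule1 ?mule0.
  split => [|x]; last by rewrite lee_fin.
  by apply/measurable_EFinP; rewrite (_ : \1_K = mindic R (sK : measurable (K : set S))).
apply: (@integral_like_pi _ S R (copy_events [set n])) => //.
- exact: copy_events_setI.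
- by apply: copy_events_sub; exact: (@measurableT _ (g_sigma_algebraType G)).
- apply: integral_like_integral => // [w|f /mS mf].
    exact: integral_like_eval.
  by under eq_fun do rewrite mul1e.
- apply: integral_like_integral => // [w|f /mS mf].
    by apply: integral_like_eval; rewrite fine_ge0.
  by under eq_fun do rewrite fineK//; exact: emeasurable_funM.
- rewrite /I; under eq_integral do rewrite mul1e.
  rewrite integral_cst// mul1e; apply: (@le_lt_trans _ _ 1); last exact: ltry.
  exact: probability_le1.
- move=> _ [H [C [GH mC Cn ->]]].
  have mH := g_sigma_measurable Gm GH.
  rewrite /I /J; under eq_integral do rewrite mul1e.
  rewrite integral_indic//; last by apply: measurableI => //; exact: mbigcap.
  (* The n-th slot is free because [C n] is the whole space; [B] is put there, so that the product
     formula applies to the intersection. *)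
  pose C' m := if m == n then B else C m.
  have -> : H `&` \bigcap_(m in [set: 'I_N]) (xi m @^-1` C m) `&` xi n @^-1` B =
      H `&` \bigcap_(m in [set: 'I_N]) (xi m @^-1` C' m).
    rewrite -setIA; congr (_ `&` _); apply/seteqP; split => [w [Cw Bw] m _|w C'w].
      by rewrite /C' /=; case: eqP => [->//|_]; exact: Cw.
    split; last by have := C'w n Logic.I; rewrite /C' /= eqxx.
    move=> m _; have := C'w m Logic.I; rewrite /C' /=; case: eqP => // -> _.
    by rewrite Cn.
  transitivity (\int[P]_(w in H) \prod_(m < N) k (Z m w) (C' m)).
    by apply: copies => // m; rewrite /C'; case: ifP.
  pose g (w : g_sigma_algebraType G) := (\1_H w)%:E * k (Z n w) B.
  have mg : mfun_ge0 g.
    split; last by move=> w; rewrite mule_ge0.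
    apply: emeasurable_funM; last exact: measurable_kernel_Z.
    by apply/measurable_EFinP; rewrite (_ : \1_H = mindic R (GH : measurable (H : set (g_sigma_algebraType G)))).
  pose E := \bigcap_(m in [set: 'I_N]) (xi m @^-1` C m).
  transitivity (\int[P]_w (g \_ E) w); last first.
    apply: eq_integral => w _; rewrite patchE /g fineK// !indicE in_setI -/E.
    by case: (w \in H); case: (w \in E) => /=;
      rewrite ?mule1 ?mul1e ?mule0 ?mul0e.
  rewrite -integral_mkcond (copies_integral mC mg) integral_mkcond.
  apply: eq_integral => w _.
  rewrite patchE /g indicE; case: (w \in H) => /=; last by rewrite mul0e mule0.
  rewrite mul1e (bigD1 n)//= [in RHS](bigD1 n)//= /C' eqxx Cn// prob_kernel mul1e.
  by rewrite muleC; congr (_ * _); apply: eq_bigr => m /negbTE ->.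
Qed.

(** The form in which conditional independence is used: the integrand may depend on all the other
    copies, which stay fixed while the n-th one is averaged over its law. *)
Lemma copies_disintegration n
    (f : g_sigma_algebraType (copy_events [set n]) * W -> \bar R) :
  mfun_ge0 f ->
  \int[P]_w f (w, xi n w) = \int[P]_w \int[k (Z n w)]_y f (w, y).
Proof.
apply: integral_disintegration => //.
- exact: copy_events_measurable.
- move=> _ A mA; rewrite setTI; apply: sub_sigma_algebra; apply: copy_events_sub.
  by have := mZ n measurableT mA; rewrite setTI.
- by move=> K B; exact: copies_indep.
Qed.

End conditional_copies.

(** * Joint measurability of paths and hitting times *)

Lemma emeasurable_fun_leP d (T : measurableType d) (R : realType)
    (f : T -> \bar R) :
  (forall r : R, measurable [set x | f x <= r%:E]) -> measurable_fun setT f.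
Proof.
move=> mf; apply: (measurability _ (ErealGenOInfty.measurableE R)).
move=> _ [_ [r ->] <-]; rewrite setTI.
rewrite (_ : _ @^-1` _ = ~` [set x | f x <= r%:E]); first exact: measurableC.
by apply/seteqP; split => x /=; rewrite in_itv/= andbT ltNge => /negP.
Qed.

Lemma measurable_fun_bool_set d (T : measurableType d) (f : T -> bool) :
  measurable_fun setT f -> measurable [set x | f x].
Proof. by move=> /(_ measurableT [set true]); rewrite setTI; exact. Qed.

Section hitting_time_facts.
Context (R : realType) (E W : Type) (F : set E) (Y : R -> W -> E).

Lemma hitting_time_lb s w : s%:E <= hitting_time F Y s w.
Proof. by apply: le_ereal_inf_tmp => _ [t [st _] <-]; rewrite lee_fin ltW. Qed.

Lemma hitting_time_le s t w : (s < t)%R -> ~ F (Y t w) ->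
  hitting_time F Y s w <= t%:E.
Proof. by move=> st Ft; apply: ereal_inf_lbound; exists t. Qed.

Lemma hitting_time_ltP s w (c : \bar R) : hitting_time F Y s w < c <->
  exists t, [/\ (s < t)%R, ~ F (Y t w) & t%:E < c].
Proof.
split; last by move=> [t [st Ft]]; apply: le_lt_trans; exact: hitting_time_le.
by move=> /ereal_inf_lt[_ [t [st Ft] <-] tc]; exists t.
Qed.

(** The inequality [s < t] is strict, so the starting time can be moved to a rational. Joint
    measurability in [s] and [w] is thus reduced to countably many starting times. *)
Lemma hitting_time_rat s w (c : \bar R) : hitting_time F Y s w < c <->
  exists q : rat, (s < ratr q)%R /\ hitting_time F Y (ratr q) w < c.
Proof.
split=> [/hitting_time_ltP[t [st Ft tc]]|[q [sq /hitting_time_ltP[t [qt Ft tc]]]]].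
  have [q /andP[]] := rat_in_itvoo st; rewrite !bnd_simp => sq qt.
  by exists q; split => //; apply/hitting_time_ltP; exists t.
by apply/hitting_time_ltP; exists t; split => //; exact: lt_trans qt.
Qed.

End hitting_time_facts.

(** Time is cut off at 0 because [Y] is meaningful at nonnegative times only, whereas joint
    measurability is stated on the whole line. *)
Definition nnpart (R : realType) (s : R) : R := Num.max 0%R s.

Lemma nnpart_ge0 (R : realType) (s : R) : (0 <= nnpart s)%R.
Proof. by rewrite /nnpart le_max lexx. Qed.

Lemma ge0_nnpart (R : realType) (s : R) : (0 <= s)%R -> nnpart s = s.
Proof. by move=> s0; exact/max_idPr. Qed.

Lemma measurable_nnpart (R : realType) :
  measurable_fun setT (fun s : measurableTypeR R => nnpart s : measurableTypeR R).
Proof. exact: measurable_maxr. Qed.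

Section driving_process.
Context (R : realType) (E : ptopologicalType) (F : set E)
  (dW : measure_display) (W : measurableType dW) (Y : R -> W -> E)
  (PY : R.-pker (measurableTypeR R * borel E) ~> W).
Hypothesis mF : measurable (F : set (borel E)).
Hypothesis dp : driving_process F Y PY.
Hypothesis ai : assumption_i F Y PY.
Hypothesis aii : assumption_ii F Y PY.

Let sm := dp_strong_markov dp.

Lemma natural_filtration_measurable t A :
  natural_filtration Y t A -> measurable A.
Proof.
apply: smallest_sub; first exact: sigma_algebra_measurable.
move=> _ [u [B [u0t mB ->]]]; have /andP[u0 _] := u0t; rewrite -[X in measurable X]setTI.
exact: (sm_measurable sm).
Qed.

Lemma natural_filtration_le s t A : (s <= t)%R ->
  natural_filtration Y s A -> natural_filtration Y t A.
Proof.
move=> st; have sub : past_events Y s `<=` past_events Y t.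
  move=> _ [u [B [us mB ->]]]; have /andP[u0 u_s] := us.
  by exists u, B; split => //; rewrite u0 (le_trans u_s).
exact: (sub_sigma_algebra2 sub).
Qed.

Lemma measurable_hitting s : (0 <= s)%R ->
  measurable_fun setT (hitting_time F Y s).
Proof.
move=> s0; apply: emeasurable_fun_leP => r.
have [r0|r0] := leP 0%R r.
  exact: natural_filtration_measurable (dp_stopping dp s0 r0).
rewrite (_ : mkset _ = set0)//; apply/seteqP; split => // w /=.
move=> /(le_trans (hitting_time_lb F Y s w)); rewrite lee_fin => /(le_trans s0).
by rewrite leNgt r0.
Qed.

(** Progressive measurability gives this on each strip of times at most [n], and the strips cover
    everything. *)
Lemma measurable_Y_joint : measurable_fun setT
  (fun p : measurableTypeR R * W => Y (nnpart p.1) p.2 : borel E).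
Proof.
pose En (n : nat) : set (measurableTypeR R * W) := [set p | (p.1 <= n%:R)%R].
have mEn n : measurable (En n).
  rewrite (_ : En n = `]-oo, n%:R]%classic `*` setT).
    by apply: measurableX => //; exact: measurable_itv.
  by apply/seteqP; split => -[x w] /=; rewrite /En/= in_itv/=; tauto.
have <- : \bigcup_n En n = setT.
  rewrite -subTset => -[x w] _; exists (Num.truncn (x : R)).+1 => //; rewrite /En/=.
  exact: ltW (truncnS_gt (x : R)).
apply/measurable_fun_bigcup => // n.
have n0 : (0 <= n%:R :> R)%R by [].
pose past := g_sigma_algebraType (past_events Y n%:R).
have := sm_progressive sm n0.
rewrite -/past => mprog.
rewrite (_ : (fun p => _) =
  (fun p : measurableTypeR R * past => Y p.1 p.2 : borel E) \o
  (fun p : measurableTypeR R * W => (nnpart p.1 : measurableTypeR R, p.2 : past)))//.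
apply: (measurable_comp _ _ mprog).
- apply: measurableX => //; exact: measurable_itv.
- move=> _ [[x w] Ex <-]; split => //=; rewrite in_itv/=.
  by rewrite nnpart_ge0 /nnpart ge_max n0.
- apply: measurable_funTS; apply: measurable_fun_pair.
  + exact: (measurableT_comp (@measurable_nnpart R) measurable_fst).
  + have mid : measurable_fun setT (id : W -> past).
      by move=> _ A mA; rewrite setTI; exact: natural_filtration_measurable mA.
    exact: (measurableT_comp mid measurable_snd).
Qed.

Lemma measurable_hitting_joint : measurable_fun setT
  (fun p : measurableTypeR R * W => hitting_time F Y (nnpart p.1) p.2).
Proof.
apply: (measurability _ (ErealGenInftyO.measurableE R)).
move=> _ [_ [r ->] <-]; rewrite setTI.
rewrite (_ : _ @^-1` _ = \bigcup_(q : rat)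
   if (0 <= ratr q :> R)%R then
     [set x : measurableTypeR R | (nnpart x < ratr q)%R] `*`
     [set w | hitting_time F Y (ratr q) w < r%:E]
   else set0).
  apply: bigcupT_measurable_rat => q; case: ifPn => // q0.
  apply: measurableX.
    apply: (measurable_fun_bool_set (f := fun x : measurableTypeR R => (nnpart x < ratr q)%R)).
    exact: measurable_fun_ltr (@measurable_nnpart R) (measurable_cst _).
  rewrite -[X in measurable X]setTI; apply: emeasurable_fun_infty_o => //.
  exact: measurable_hitting.
apply/seteqP; split => [[x w]|[x w] [q _]]/=.
  rewrite in_itv/= => /hitting_time_rat[q [xq hq]].
  exists q => //; rewrite ifT//.
  by apply: le_trans (ltW xq); exact: nnpart_ge0.
case: ifPn => //= q0 [xq hq]; rewrite in_itv/=.
by apply/hitting_time_rat; exists q.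
Qed.

End driving_process.

(** * Survival probabilities of the driving process *)

Section driving_process2.
Context (R : realType) (E : ptopologicalType) (F : set E)
  (dW : measure_display) (W : measurableType dW) (Y : R -> W -> E)
  (PY : R.-pker (measurableTypeR R * borel E) ~> W).
Hypothesis mF : measurable (F : set (borel E)).
Hypothesis dp : driving_process F Y PY.
Hypothesis ai : assumption_i F Y PY.
Hypothesis aii : assumption_ii F Y PY.

Let sm := dp_strong_markov dp.

Let mhit s : (0 <= s)%R -> measurable_fun setT (hitting_time F Y s).
Proof. by move=> s0; exact: measurable_hitting dp _ s0. Qed.

Lemma measurable_preimage_Y t (D : set E) : (0 <= t)%R ->
  measurable (D : set (borel E)) -> measurable (Y t @^-1` D).
Proof.
move=> t0 mD; rewrite -[X in measurable X]setTI.
exact: (sm_measurable sm t0).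
Qed.

Lemma pker_setC (x : measurableTypeR R * borel E) (S : set W) : measurable S ->
  PY x (~` S) = 1 - PY x S.
Proof.
move=> mS; have h : PY x S + PY x (~` S) = 1.
  rewrite -measureU//; [|exact: measurableC|by rewrite setICr].
  by rewrite setUv; exact: prob_kernel.
by rewrite -h (addeC (PY x S)) addeK// pker_fin_num.
Qed.

Lemma pker_ae1 (x : measurableTypeR R * borel E) (S : set W) : measurable S ->
  PY x S = 1 -> {ae PY x, forall w, S w}.
Proof.
move=> mS PS; exists (~` S); split => //; first exact: measurableC.
by rewrite pker_setC// PS subee.
Qed.

(** The path reaches some point outside [F], and by absorption this point is its value at the
    hitting time; so it is outside [F] at the hitting time itself and ever after. Before that time
    it is in [F], at [s] by the initial condition. *)
Lemma driving_ae s x : (0 <= s)%R -> F x ->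
  {ae PY (s, x), forall w,
    [/\ s%:E < hitting_time F Y s w < +oo,
        ~ F (Y (fine (hitting_time F Y s w)) w) &
        forall z, (s <= z)%R ->
          (F (Y z w) <-> z%:E < hitting_time F Y s w)]}.
Proof.
move=> s0 Fx.
have mS : measurable [set w | s%:E < hitting_time F Y s w < +oo].
  rewrite (_ : mkset _ = [set w | s%:E < hitting_time F Y s w] `&`
     [set w | hitting_time F Y s w < +oo]); last first.
    by apply/seteqP; split => w /= => [/andP[]|[-> ->]].
  apply: measurableI; rewrite -[X in measurable X]setTI.
    exact: emeasurable_fun_o_infty (mhit s0) _.
  exact: emeasurable_fun_infty_o (mhit s0) _.
have h1 := pker_ae1 mS (ai s0 Fx).
have h2 : {ae PY (s, x), forall w, (Y s @^-1` F) w}.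
  apply: pker_ae1; first exact: measurable_preimage_Y.
  by rewrite (sm_start sm)// indicE mem_set.
have h3 := dp_absorbing dp x s0.
apply: filterS3 h1 h2 h3 => w h1 h2 h3.
have nFhit : ~ F (Y (fine (hitting_time F Y s w)) w).
  have /andP[_ /hitting_time_ltP[t [st Ft _]]] := h1.
  by rewrite -(h3 t)//; exact: hitting_time_le.
split => // z sz; split => [Fz|hz].
  rewrite ltNge; apply/negP => hz; apply: nFhit.
  by rewrite -(h3 z hz).
apply: contrapT => nFz; move: sz; rewrite le_eqVlt => /predU1P[sz|sz].
  by apply: nFz; rewrite -sz.
by have := @hitting_time_le R E W F Y s z w sz nFz; rewrite leNgt hz.
Qed.

(** The strong Markov property at the constant time [t]. The event of exiting later than [t] is
    known at time [t] because the hitting time is a stopping time. *)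
Lemma markov_at s t z x (D : set E) : (0 <= s)%R -> (s <= t)%R -> (t <= z)%R ->
  measurable (D : set (borel E)) ->
  PY (s, x) ([set w | t%:E < hitting_time F Y s w] `&` Y z @^-1` D) =
  \int[PY (s, x)]_(w in [set w | t%:E < hitting_time F Y s w])
     PY (t, Y t w) (Y z @^-1` D).
Proof.
move=> s0 st tz mD; set H := [set w | _].
have t0 : (0 <= t)%R by exact: le_trans st.
have e : (t + (z - t))%R = z by rewrite addrC subrK.
have ZT : [set w : W | t%:E < +oo] = setT by apply/seteqP; split => // w _ /=; rewrite ltry.
have mH : natural_filtration Y t H.
  have -> : H = ~` [set w | hitting_time F Y s w <= t%:E].
    by apply/seteqP; split => w; rewrite /H /= ltNge => /negP.
  apply: (@measurableC _ (g_sigma_algebraType (past_events Y t))).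
  exact: dp_stopping dp s s0 t t0.
have := sm_markov sm (s := s) x (T := fun=> t%:E) (H := H) (u := (z - t)%R)
  (A := D) s0.
rewrite /= e ZT setIT => <- //.
- congr (PY _ (H `&` _)); apply/seteqP; split => [w Dw|w []//].
  by split; rewrite ?ltry.
- move=> r r0; have [tr|tr] := leP t r.
    rewrite (_ : mkset _ = setT); last first.
      by apply/seteqP; split => // w _ /=; rewrite lee_fin.
    exact: (@measurableT _ (g_sigma_algebraType (past_events Y r))).
  rewrite (_ : mkset _ = set0); last first.
    by apply/seteqP; split => // w /=; rewrite lee_fin leNgt tr.
  exact: (@measurable0 _ (g_sigma_algebraType (past_events Y r))).
- split; first exact: (natural_filtration_measurable dp mH).
  move=> r r0; have [tr|tr] := leP t r.
    rewrite (_ : [set w | _ <= _] = setT) ?setIT; last first.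
      by apply/seteqP; split => // w _ /=; rewrite lee_fin.
    exact: natural_filtration_le tr mH.
  rewrite (_ : [set w | _ <= _] = set0) ?setI0; last first.
    by apply/seteqP; split => // w /=; rewrite lee_fin leNgt tr.
  exact: (@measurable0 _ (g_sigma_algebraType (past_events Y r))).
- by rewrite subr_ge0.
Qed.

Let surv s x z := PY (s, x) [set w | z%:E < hitting_time F Y s w].

Let msurv s z : (0 <= s)%R -> measurable [set w | z%:E < hitting_time F Y s w].
Proof.
move=> s0; rewrite -[X in measurable X]setTI.
exact: emeasurable_fun_o_infty (mhit s0) _.
Qed.

Let survE s x z : (0 <= s)%R -> F x -> (s <= z)%R ->
  PY (s, x) (Y z @^-1` F) = surv s x z.
Proof.
move=> s0 Fx sz; have [N [mN N0 NS]] := driving_ae s0 Fx.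
have z0 : (0 <= z)%R by exact: le_trans sz.
have key A B : measurable A -> measurable B -> A `<=` B `|` N ->
    PY (s, x) A <= PY (s, x) B.
  move=> mA mB AB; apply: (@le_trans _ _ (PY (s, x) (B `|` N))).
    by apply: le_measure => //; rewrite inE//; exact: measurableU.
  by rewrite measureU0.
apply/eqP; rewrite eq_le; apply/andP; split; apply: key.
- exact: measurable_preimage_Y.
- exact: msurv.
- move=> w Fw; have [Nw|Nw] := pselect (N w); [by right|left].
  by apply: contrapT => nh; apply/Nw/NS => -[_ _ /(_ _ sz)[/(_ Fw)]].
- exact: msurv.
- exact: measurable_preimage_Y.
- move=> w hw; have [Nw|Nw] := pselect (N w); [by right|left].
  by apply: contrapT => nh; apply/Nw/NS => -[_ _ /(_ _ sz)[_ /(_ hw)]].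
Qed.

Let surv_le s x z z' : (0 <= s)%R -> (z <= z')%R -> surv s x z' <= surv s x z.
Proof.
move=> s0 zz'; apply: le_measure; rewrite ?inE; [exact: msurv|exact: msurv|].
by move=> w /=; apply: le_lt_trans; rewrite lee_fin.
Qed.

(** Continuity from below: the events of exiting after [z + 1/(n+1)] increase to that of exiting
    after [z]. *)
Let surv_right s x z c : (0 <= s)%R -> c < surv s x z ->
  exists z', (z < z')%R /\ c < surv s x z'.
Proof.
move=> s0 cz; apply: contrapT => h.
have hle n : surv s x (z + n.+1%:R^-1) <= c.
  rewrite leNgt; apply/negP => cn; apply: h.
  by exists (z + n.+1%:R^-1)%R; rewrite ltrDl.
have cv : surv s x (z + n.+1%:R^-1) @[n --> \oo] --> surv s x z.
  rewrite /surv (_ : [set w | z%:E < _] =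
      \bigcup_n [set w | (z + n.+1%:R^-1)%:E < hitting_time F Y s w]).
    apply: nondecreasing_cvg_mu.
    - by move=> n; exact: msurv.
    - by apply: bigcupT_measurable => n; exact: msurv.
    - move=> m n mn; apply/subsetPset => w /=; apply: le_lt_trans.
      by rewrite lee_fin lerD2l lef_pV2 ?posrE// ler_nat.
  apply/seteqP; split => [w /= zh|w [n _ /=]]; last first.
    by apply: le_lt_trans; rewrite lee_fin lerDl.
  have [r [zr rh]] : exists r : R, (z < r)%R /\ r%:E < hitting_time F Y s w.
    move: zh; case: (hitting_time F Y s w) => [h'| |//].
      rewrite lte_fin => zh; exists ((z + h') / 2)%R.
      by rewrite lte_fin; split; lra.
    by move=> _; exists (z + 1)%R; rewrite ltry ltrDl.
  have [n nr] := ltr_add_invr zr.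
  by exists n => //=; apply: lt_trans rh; rewrite lte_fin.
have : limn (fun n => surv s x (z + n.+1%:R^-1)) <= c.
  by apply: lime_le; [exact: cvgP cv | exact: nearW].
by rewrite (cvg_lim _ cv)// leNgt cz.
Qed.

(** Positions are traded for hitting times by [survE], and the events of exiting after a given time
    are nested. *)
Lemma survival_nonincreasing s x z z' : (0 <= s)%R -> F x -> (s <= z)%R ->
  (z <= z')%R -> PY (s, x) (Y z' @^-1` F) <= PY (s, x) (Y z @^-1` F).
Proof.
move=> s0 Fx sz zz'; rewrite !survE//; last exact: le_trans zz'.
exact: surv_le.
Qed.

(* The law of the hitting time has no atom, so its median can be approximated
   by rational times. *)
Lemma survival_median s x : (0 <= s)%R -> F x ->
  exists q : rat, (s <= ratr q)%R /\
    (3^-1)%:E <= PY (s, x) (Y (ratr q) @^-1` F) <= (1 - 3^-1)%:E.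
Proof.
move=> s0 Fx.
(* Times at which the survival probability exceeds 2/3. Beyond the supremum [z0] it is at most 2/3,
   and just beyond [z0] it is still above 1/3; a rational in between serves as [q]. *)
pose A := [set z : R | (s <= z)%R /\ (1 - 3^-1)%:E < surv s x z].
have gt01 : (0 < 3^-1 :> R)%R by lra.
have surv_s : surv s x s = 1.
  have := ai s0 Fx => h1; apply/eqP; rewrite eq_le pker_le1//=; last exact: msurv.
  rewrite -h1; apply: le_measure; rewrite ?inE; [|exact: msurv|].
    rewrite (_ : mkset _ = [set w | s%:E < hitting_time F Y s w] `&`
       [set w | hitting_time F Y s w < +oo]); last first.
      by apply/seteqP; split => w /= => [/andP[]|[-> ->]].
    apply: measurableI; first exact: msurv.
    rewrite -[X in measurable X]setTI.
    exact: emeasurable_fun_infty_o (mhit s0) _.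
  by move=> w /= /andP[].
have A0 : A s by split => //; rewrite surv_s lte_fin; lra.
(* The survival probability decreases to the mass of an infinite hitting time, which is 0 by [aii]
   at [+oo]. *)
have [M hM] : exists n : nat, surv s x n%:R <= (1 - 3^-1)%:E.
  apply: contrapT => h.
  have hge n : (1 - 3^-1)%:E <= surv s x n%:R.
    rewrite leNgt; apply/negP => cn; apply: h.
    by exists n; exact: ltW.
  have cv : surv s x n%:R @[n --> \oo] -->
      PY (s, x) [set w | hitting_time F Y s w = +oo].
    rewrite /surv (_ : [set w | _ = +oo] =
       \bigcap_n [set w | n%:R%:E < hitting_time F Y s w]).
      apply: nonincreasing_cvg_mu.
      - by rewrite -ge0_fin_numE//; apply: pker_fin_num; exact: msurv.
      - by move=> n; exact: msurv.
      - by apply: bigcapT_measurable => n; exact: msurv.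
      - move=> m n mn; apply/subsetPset => w /=; apply: le_lt_trans.
        by rewrite lee_fin ler_nat.
    apply/seteqP; split => [w /= hw n _ /=|w hw]; first by rewrite hw ltry.
    have {}hw n : n%:R%:E < hitting_time F Y s w by exact: hw n Logic.I.
    rewrite /=; move: hw; case: (hitting_time F Y s w) => [r| |]//= hw; last first.
      by have := hw 0%N.
    by have := hw (Num.truncn r).+1; rewrite lte_fin ltNge ltW// truncnS_gt.
  have : (1 - 3^-1)%:E <= limn (fun n => surv s x n%:R).
    by apply: lime_ge; [exact: cvgP cv | exact: nearW].
  rewrite (cvg_lim _ cv)// (aii +oo s0 Fx) lee_fin; lra.
have Aub : ubound A M%:R.
  move=> z [sz cz]; rewrite leNgt; apply/negP => Mz.
  by have := le_trans (surv_le x s0 (ltW Mz)) hM; rewrite leNgt cz.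
have hA : has_sup A by split; [exists s | exists M%:R].
pose z0 := sup A.
have sz0 : (s <= z0)%R by exact: ub_le_sup hA.2 _ A0.
have mge : measurable [set w | z0%:E <= hitting_time F Y s w].
  by rewrite -[X in measurable X]setTI; exact: emeasurable_fun_c_infty (mhit s0) _.
(* Members of [A] come arbitrarily close to [z0], so the left limit of the survival probability
   there is at least 2/3. *)
have left : (1 - 3^-1)%:E <= PY (s, x) [set w | z0%:E <= hitting_time F Y s w].
  have cv : surv s x (z0 - n.+1%:R^-1) @[n --> \oo] -->
      PY (s, x) [set w | z0%:E <= hitting_time F Y s w].
    rewrite /surv (_ : [set w | z0%:E <= _] =
       \bigcap_n [set w | (z0 - n.+1%:R^-1)%:E < hitting_time F Y s w]).
      apply: nonincreasing_cvg_mu.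
      - by rewrite -ge0_fin_numE//; apply: pker_fin_num; exact: msurv.
      - by move=> n; exact: msurv.
      - by apply: bigcapT_measurable => n; exact: msurv.
      - move=> m n mn; apply/subsetPset => w /=; apply: le_lt_trans.
        by rewrite lee_fin lerD2l lerN2 lef_pV2 ?posrE// ler_nat.
    apply/seteqP; split => [w /= zh n _ /=|w hw].
      by apply: lt_le_trans zh; rewrite lte_fin ltrBlDr ltrDl.
    rewrite /= leNgt; apply/negP => hz.
    have {}hw n : (z0 - n.+1%:R^-1)%:E < hitting_time F Y s w.
      by exact: hw n Logic.I.
    move: hz hw; case: (hitting_time F Y s w) => [r| |]//= rz hw; last first.
      by have := hw 0%N.
    have [n] := ltr_add_invr (rz : (r < z0)%R); rewrite -ltrBrDr => nr.
    by have := hw n; rewrite lte_fin ltNge ltW.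
  have hge n : (1 - 3^-1)%:E <= surv s x (z0 - n.+1%:R^-1).
    have zlt : (z0 - n.+1%:R^-1 < sup A)%R by rewrite ltrBlDr ltrDl.
    have [a [sa ca] za] := sup_gt (ex_intro _ s A0) zlt.
    by apply: ltW; apply: lt_le_trans ca _; apply: surv_le => //; exact: ltW.
  have : (1 - 3^-1)%:E <= limn (fun n => surv s x (z0 - n.+1%:R^-1)).
    by apply: lime_ge; [exact: cvgP cv | exact: nearW].
  by rewrite (cvg_lim _ cv).
(* There is no atom at [z0], so the bound 2/3 also holds for exiting strictly later; that 2/3 > 1/3
   leaves slack for moving to the right. *)
have surv_z0 : (3^-1)%:E < surv s x z0.
  have : [set w | z0%:E <= hitting_time F Y s w] =
      [set w | z0%:E < hitting_time F Y s w] `|`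
      [set w | hitting_time F Y s w = z0%:E].
    apply/seteqP; split => [w /=|w /= [/ltW//|->//]].
    by rewrite le_eqVlt => /predU1P[<-|]; [right|left].
  move: left => /[swap] ->; rewrite measureU0//; first last.
  - exact: aii.
  - rewrite -[X in measurable X]setTI.
    by apply: measurable_eqe => //; exact: mhit.
  - exact: msurv.
  by apply: lt_le_trans; rewrite lte_fin; lra.
have [r [zr cr]] := surv_right s0 surv_z0.
have [q] := rat_in_itvoo zr; rewrite in_itv/= => /andP[zq qr].
have sq : (s <= ratr q)%R by apply: le_trans sz0 (ltW zq).
exists q; split => //; rewrite survE//; apply/andP; split.
  by apply: ltW (lt_le_trans cr _); apply: surv_le => //; exact: ltW.
rewrite leNgt; apply/negP => cq.
have : A (ratr q) by [].
by move=> /(ub_le_sup hA.2); rewrite leNgt zq.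
Qed.

End driving_process2.

(** * Jump times and the information available at a stage *)

Lemma emeasurable_fun_ltP d (T : measurableType d) (R : realType)
    (f : T -> \bar R) :
  (forall r : R, measurable [set x | f x < r%:E]) -> measurable_fun setT f.
Proof.
move=> mf; apply: (measurability _ (ErealGenInftyO.measurableE R)).
move=> _ [_ [r ->] <-]; rewrite setTI.
by rewrite (_ : _ @^-1` _ = [set x | f x < r%:E]).
Qed.

Section jump_times.
Context (R : realType) (E W Om : Type) (F : set E) (Y : R -> W -> E) (N : nat)
  (xi : nat -> 'I_N -> Om -> W).
Let X := copy_path Y xi.
Let tau := jump_time F X.

(** The path [xi k.+1 m] is followed on its own, beyond the next jump if another particle exits
    first. *)
Definition exit_time k m w := hitting_time F Y (fine (tau k w)) (xi k.+1 m w).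

Lemma jump_time_ltP k w (c : \bar R) : tau k.+1 w < c <->
  exists i t, [/\ tau k w < t%:E, ~ F (X k.+1 i t w) & t%:E < c].
Proof.
split; last first.
  move=> [i [t [kt Ft tc]]]; apply: le_lt_trans tc.
  by apply: ereal_inf_lbound; exists t => //; split => //; exists i.
by move=> /ereal_inf_lt[_ [t [kt [i Ft]] <-] tc]; exists i, t.
Qed.

Lemma jump_time_ge0 k w : 0 <= tau k w.
Proof.
elim: k => [//|k IH]; apply: le_ereal_inf_tmp => _ [t [kt _] <-].
exact: le_trans (ltW kt).
Qed.

Lemma jump_time_le k w : tau k w <= tau k.+1 w.
Proof. by apply: le_ereal_inf_tmp => _ [t [kt _] <-]; exact: ltW. Qed.

Lemma fine_jump_time_ge0 k w : (0 <= fine (tau k w))%R.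
Proof. by rewrite fine_ge0// jump_time_ge0. Qed.

Lemma jump_timeE k w (c : \bar R) : tau k w < +oo ->
  tau k.+1 w < c <-> exists i, exit_time k i w < c.
Proof.
move=> koo; have kfin : tau k w \is a fin_num.
  by rewrite ge0_fin_numE// jump_time_ge0.
rewrite /exit_time.
split => [/jump_time_ltP[i [t [kt Ft tc]]]|[i /hitting_time_ltP[t [kt Ft tc]]]].
  by exists i; apply/hitting_time_ltP; exists t; split => //;
    rewrite -lte_fin fineK.
apply/jump_time_ltP; exists i, t; split => //.
by rewrite -lte_fin fineK in kt.
Qed.

End jump_times.

Section fv_measurability.
Context (R : realType) (E : ptopologicalType) (F : set E)
  (dW : measure_display) (W : measurableType dW) (Y : R -> W -> E)
  (PY : R.-pker (measurableTypeR R * borel E) ~> W)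
  (dO : measure_display) (Om : measurableType dO) (P : probability Om R)
  (N : nat) (xi : nat -> 'I_N -> Om -> W) (U : nat -> 'I_N -> Om -> 'I_N).
Hypothesis mF : measurable (F : set (borel E)).
Hypothesis dp : driving_process F Y PY.
Hypothesis fv : fleming_viot F Y PY P xi U.

Let X := copy_path Y xi.
Let tau := jump_time F X.

(** What is known on top of [G] at jump [k.+1], before the new parent is drawn. *)
Definition prejump_events k (G : set (set Om)) : set (set Om) :=
  G `|` [set B | exists t : R, B = [set w | tau k.+1 w <= t%:E]]
    `|` [set B | exists (m : 'I_N) (A : set E), measurable (A : set (borel E)) /\
          B = [set w | tau k.+1 w < +oo /\ A (X k.+1 m (fine (tau k.+1 w)) w)]].

Definition choice_events k : set (set Om) :=
  [set B | exists i a : 'I_N, B = U k i @^-1` [set a]].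

(** Unlike [history], which contains the whole family [U], this records only the choices up to jump
    [k], so that the next choice is independent of [prejump k]. Of the paths it keeps the positions
    at jump times, which determine the restart positions. *)
Fixpoint past k : set (set Om) :=
  if k is k'.+1 then prejump_events k' (past k') `|` choice_events k'.+1
  else initial_events X.

Definition prejump k := prejump_events k (past k).

(** After a jump, the starting position is read from the previous stage through [parent], which
    makes it a function of [past k]; [fv_restart] identifies it almost surely with that of the new
    path. *)
Definition restart k m w : E :=
  if k is k'.+1 then
    if tau k w < +oo then X k (parent F X U k m w) (fine (tau k w)) w else point
  else X 1%N m 0%R w.

Definition restart_point k m w : measurableTypeR R * borel E :=
  (fine (tau k w), restart k m w).

Section jump_measurable.
Variables (k : nat) (G : set (set Om)).
Hypothesis pG : prejump k `<=` <<s G >>.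
Let S := g_sigma_algebraType G.

Lemma measurable_jump_time_prejump : measurable_fun (setT : set S) (tau k.+1).
Proof.
apply: emeasurable_fun_leP => r.
by apply: pG; left; right; exists r.
Qed.

Let mfin : measurable ([set w | tau k.+1 w < +oo] : set S).
Proof.
rewrite -[X in measurable X]setTI.
exact: emeasurable_fun_infty_o measurable_jump_time_prejump _.
Qed.

Lemma measurable_jump_position m (A : set E) : measurable (A : set (borel E)) ->
  measurable ([set w | tau k.+1 w < +oo /\ A (X k.+1 m (fine (tau k.+1 w)) w)]
    : set S).
Proof. by move=> mA; apply: pG; right; exists m, A. Qed.

Lemma measurable_exiting (o : option 'I_N) :
  measurable ([set w | tau k.+1 w < +oo /\ exiting F X k.+1 w = o] : set S).
Proof.
pose Fc (b : bool) : set E := if b then ~` F else F.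
have mFc b : measurable (Fc b : set (borel E)).
  by case: b => //; exact: measurableC.
(* Split according to the set [D] of all particles outside [F] at the jump, which determines the
   value of [pick]. *)
rewrite (_ : mkset _ = \bigcup_(D in [set D : {set 'I_N} | [pick i in D] = o])
   ([set w | tau k.+1 w < +oo] `&`
    \bigcap_(i in [set: 'I_N]) [set w | tau k.+1 w < +oo /\
       Fc (i \in D) (X k.+1 i (fine (tau k.+1 w)) w)])).
  apply: fin_bigcup_measurable => // D _; apply: measurableI => //.
  by apply: fin_bigcap_measurable => // i _; exact: measurable_jump_position.
apply/seteqP; split => [w [koo <-]|w [D /= <-] [koo HD]].
  exists [set i | `[< ~ F (X k.+1 i (fine (tau k.+1 w)) w) >]]%SET.
    by rewrite /= /exiting; apply: eq_pick => i; rewrite inE.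
  split => // i _; split => //; rewrite /Fc inE; case: asboolP => //=.
  exact: contrapT.
split => //; rewrite /exiting; apply: eq_pick => i.
have [_] := HD i Logic.I; rewrite /Fc.
by case: (i \in D) => Fi; apply/asboolP => //; apply.
Qed.

End jump_measurable.

Lemma past_sub k : past k `<=` past k.+1.
Proof. by move=> B pB; left; left; left. Qed.

Lemma prejump_past k : prejump k `<=` past k.+1.
Proof. by move=> B pB; left. Qed.

Lemma measurable_jump_time_past k :
  measurable_fun (setT : set (g_sigma_algebraType (past k))) (tau k).
Proof.
case: k => [|k]; first exact: measurable_cst.
apply: measurable_jump_time_prejump => B pB; apply: sub_sigma_algebra.
exact: prejump_past.
Qed.

Lemma measurable_parent k m p :
  measurable ([set w | tau k.+1 w < +oo /\ parent F X U k.+1 m w = p]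
    : set (g_sigma_algebraType (past k.+1))).
Proof.
have pG : prejump k `<=` <<s past k.+1 >>.
  by move=> B pB; apply: sub_sigma_algebra; exact: prejump_past.
pose S := g_sigma_algebraType (past k.+1).
have mt := measurable_jump_time_prejump pG.
have mfin : measurable ([set w | tau k.+1 w < +oo] : set S).
  by rewrite -[X in measurable X]setTI; exact: emeasurable_fun_infty_o mt _.
have mE o := measurable_exiting pG o.
have mU i a : measurable (U k.+1 i @^-1` [set a] : set S).
  by apply: sub_sigma_algebra; right; exists i, a.
rewrite (_ : mkset _ =
  ([set w | tau k.+1 w < +oo /\ exiting F X k.+1 w = Some m] `&`
     U k.+1 m @^-1` [set p]) `|`
  ([set w | tau k.+1 w < +oo] `\`
     [set w | tau k.+1 w < +oo /\ exiting F X k.+1 w = Some m]) `&`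
     (if m == p then setT else set0)).
  apply: measurableU; first exact: measurableI.
  apply: measurableI; first exact: measurableD.
  by case: ifP.
apply/seteqP; split => w /=; rewrite /parent.
  move=> [koo]; case: eqP => [e <-|ne <-]; first by left.
  by right; rewrite eqxx; split => //; split => // -[].
move=> [[[koo ->] <-]|[[koo ne]]]; first by rewrite eqxx.
case: eqP => [<-|//] _; split => //; case: eqP => // e.
by exfalso; apply: ne.
Qed.

Lemma measurable_restart k m :
  measurable_fun (setT : set (g_sigma_algebraType (past k)))
    (restart k m : _ -> borel E).
Proof.
case: k => [|k] _ A mA; rewrite setTI.
  by apply: sub_sigma_algebra; exists m, A.
have pG : prejump k `<=` <<s past k.+1 >>.
  by move=> B pB; apply: sub_sigma_algebra; exact: prejump_past.
pose S := g_sigma_algebraType (past k.+1).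
have mt := measurable_jump_time_prejump pG.
have mfin : measurable ([set w | tau k.+1 w < +oo] : set S).
  by rewrite -[X in measurable X]setTI; exact: emeasurable_fun_infty_o mt _.
have mpar := @measurable_parent k m.
rewrite (_ : _ @^-1` _ =
  (~` [set w | tau k.+1 w < +oo] `&` (if `[< A point >] then setT else set0)) `|`
  \bigcup_(p in [set: 'I_N])
    ([set w | tau k.+1 w < +oo /\ parent F X U k.+1 m w = p] `&`
     [set w | tau k.+1 w < +oo /\ A (X k.+1 p (fine (tau k.+1 w)) w)])).
  apply: measurableU.
    by apply: measurableI; [exact: measurableC|case: ifP].
  apply: fin_bigcup_measurable => // p _; apply: measurableI => //.
  exact: measurable_jump_position.
apply/seteqP; split => w /=.
  case: ifPn => [koo Aw|/negP koo Aw].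
    by right; exists (parent F X U k.+1 m w).
  by left; split => //; case: asboolP.
by move=> [[/negP/negbTE -> ]|[p _ [[koo <-] [_ Aw]]]]; [case: asboolP|rewrite koo].
Qed.

Lemma measurable_restart_point k m :
  measurable_fun (setT : set (g_sigma_algebraType (past k))) (restart_point k m).
Proof.
apply: measurable_fun_pair; last exact: measurable_restart.
apply: measurableT_comp; last exact: measurable_jump_time_past.
exact: fine_measurable.
Qed.

Lemma historyS k : history F X U k `<=` history F X U k.+1.
Proof.
apply: sub_sigma_algebra2 => B [[[]|]|].
- by move=> h; left; left; left.
- by move=> h; left; left; right.
- by move=> [j [t [jk ->]]]; left; right; exists j, t; split => //; exact: leqW.
- move=> [j [m [t [A [jk t0 mA ->]]]]]; right; exists j, m, t, A; split => //.
  exact: leqW.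
Qed.

Lemma past_history k : <<s past k >> `<=` history F X U k.
Proof.
elim: k => [|k IH].
  by apply: sub_sigma_algebra2 => B h; left; left; right.
apply: smallest_sub; first exact: smallest_sigma_algebra.
pose S := g_sigma_algebraType ([set B | exists (l : nat) (i a : 'I_N),
         (0 < l)%N /\ B = U l i @^-1` [set a]]
      `|` initial_events X
      `|` [set B | exists (j : nat) (t : R),
             (j <= k.+1)%N /\ B = [set w | jump_time F X j w <= t%:E]]
      `|` [set B | exists (j : nat) (m : 'I_N) (t : R) (A : set E),
             [/\ (j < k.+1)%N, (0 <= t)%R, measurable (A : set (borel E)) &
              B = [set w | jump_time F X j w <= t%:E /\
                     A (at_time (X j.+1 m)
                          (fun w => mine t%:E (jump_time F X j.+1 w)) w)]] ]).
move=> B [[[pB|[t ->]]|[m [A [mA ->]]]]|[i [a ->]]].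
- by apply: historyS; apply: IH; exact: sub_sigma_algebra.
- by apply: sub_sigma_algebra; left; right; exists k.+1, t.
(* [history] records positions at the minimum of a fixed time and the jump time. On the event that
   the jump occurs by [n] this minimum is the jump time, and the union over [n] exhausts finite jump
   times. *)
- rewrite (_ : mkset _ = \bigcup_n ([set w | tau k.+1 w <= n%:R%:E] `&`
    [set w | tau k w <= n%:R%:E /\ A (at_time (X k.+1 m)
                          (fun w => mine n%:R%:E (jump_time F X k.+1 w)) w)])).
    apply: (@bigcupT_measurable _ S) => n; apply: measurableI.
      by apply: sub_sigma_algebra; left; right; exists k.+1, n%:R.
    by apply: sub_sigma_algebra; right; exists k, m, n%:R, A; split.
  apply/seteqP; split => w /=.
    move=> [koo Aw]; have kfin : tau k.+1 w \is a fin_num.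
      by rewrite ge0_fin_numE// jump_time_ge0.
    exists (Num.truncn (fine (tau k.+1 w))).+1 => //.
    have le1 : tau k.+1 w <= (Num.truncn (fine (tau k.+1 w))).+1%:R%:E.
      by rewrite -[leLHS]fineK// lee_fin ltW// truncnS_gt.
    split => //=; split; first exact: le_trans (jump_time_le _ _ _ _ _) le1.
    by rewrite /at_time (min_idPr le1).
  move=> [n _ [/= le1 [_]]]; rewrite /at_time (min_idPr le1) => Aw.
  by split => //; apply: le_lt_trans le1 _; exact: ltry.
- by apply: sub_sigma_algebra; left; left; left; exists k.+1, i, a.
Qed.

End fv_measurability.

Section fv_stage.
Context (R : realType) (E : ptopologicalType) (F : set E)
  (dW : measure_display) (W : measurableType dW) (Y : R -> W -> E)
  (PY : R.-pker (measurableTypeR R * borel E) ~> W)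
  (dO : measure_display) (Om : measurableType dO) (P : probability Om R)
  (N : nat) (xi : nat -> 'I_N -> Om -> W) (U : nat -> 'I_N -> Om -> 'I_N).
Hypothesis mF : measurable (F : set (borel E)).
Hypothesis dp : driving_process F Y PY.
Hypothesis fv : fleming_viot F Y PY P xi U.

Let X := copy_path Y xi.
Let tau := jump_time F X.

Local Notation past := (past F Y xi U).
Local Notation prejump := (prejump F Y xi U).
Local Notation exit_time := (exit_time F Y xi).
Local Notation copy_sigma k D :=
  (g_sigma_algebraType (copy_events (xi k.+1) (past k) D)).

Lemma measurable_past_copy k (D : set 'I_N) d (T : measurableType d) (f : Om -> T) :
  measurable_fun (setT : set (g_sigma_algebraType (past k))) f ->
  measurable_fun (setT : set (copy_sigma k D)) f.
Proof.
move=> mf _ A mA; apply: sub_sigma_algebra; apply: copy_events_sub.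
by have := mf measurableT A mA.
Qed.

Lemma measurable_copy k (D : set 'I_N) m : ~ D m ->
  measurable_fun (setT : set (copy_sigma k D)) (xi k.+1 m).
Proof.
move=> Dm _ B mB; rewrite setTI; apply: sub_sigma_algebra.
exact: copy_events_preimage.
Qed.

Lemma measurable_copy_jump_time k D :
  measurable_fun (setT : set (copy_sigma k D)) (tau k).
Proof. by apply: measurable_past_copy; exact: measurable_jump_time_past. Qed.

Lemma measurable_copy_fine_jump_time k D :
  measurable_fun (setT : set (copy_sigma k D))
    (fun w => fine (tau k w) : measurableTypeR R).
Proof.
apply: measurableT_comp; last exact: measurable_copy_jump_time.
exact: fine_measurable.
Qed.

Lemma measurable_hitting_comp d (T : measurableType d)
    (s : T -> measurableTypeR R) (x : T -> W) :
  measurable_fun setT s -> measurable_fun setT x -> (forall t, (0 <= s t)%R) ->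
  measurable_fun setT (fun t => hitting_time F Y (s t) (x t)).
Proof.
move=> ms mx s0.
rewrite (_ : (fun t => _) = (fun p : measurableTypeR R * W =>
  hitting_time F Y (nnpart p.1) p.2) \o (fun t => (s t, x t))); last first.
  by apply/funext => t /=; rewrite ge0_nnpart.
apply: measurableT_comp; first exact: measurable_hitting_joint dp.
exact: measurable_fun_pair.
Qed.

Lemma measurable_Y_comp d (T : measurableType d)
    (s : T -> measurableTypeR R) (x : T -> W) :
  measurable_fun setT s -> measurable_fun setT x -> (forall t, (0 <= s t)%R) ->
  measurable_fun setT (fun t => Y (s t) (x t) : borel E).
Proof.
move=> ms mx s0.
rewrite (_ : (fun t => _) = (fun p : measurableTypeR R * W =>
  Y (nnpart p.1) p.2 : borel E) \o (fun t => (s t, x t))); last first.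
  by apply/funext => t /=; rewrite ge0_nnpart.
apply: measurableT_comp; first exact: measurable_Y_joint dp.
exact: measurable_fun_pair.
Qed.

Lemma measurable_copy_exit_time k D m : ~ D m ->
  measurable_fun (setT : set (copy_sigma k D)) (exit_time k m).
Proof.
move=> Dm; apply: measurable_hitting_comp.
- exact: measurable_copy_fine_jump_time.
- exact: measurable_copy.
- by move=> w; exact: fine_jump_time_ge0.
Qed.

(** The next jump time is the least exit time, hence a function of the past and of the copies of the
    stage; the positions then follow from joint measurability of [Y]. *)
Lemma prejump_copy_events k :
  prejump k `<=` <<s copy_events (xi k.+1) (past k) set0 >>.
Proof.
pose S := copy_sigma k set0.
have mtk := @measurable_copy_jump_time k set0.
have mt : measurable_fun (setT : set S) (tau k.+1).
  apply: emeasurable_fun_ltP => r.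
  rewrite (_ : mkset _ = [set w | tau k w < +oo] `&`
      \bigcup_(m in [set: 'I_N]) [set w | exit_time k m w < r%:E]).
    apply: measurableI.
      rewrite -[X in measurable X]setTI; exact: emeasurable_fun_infty_o mtk _.
    apply: fin_bigcup_measurable => // m _.
    rewrite -[X in measurable X]setTI.
    apply: emeasurable_fun_infty_o => //.
    exact: measurable_copy_exit_time.
  apply/seteqP; split => w /=.
    move=> h; have koo : tau k w < +oo.
      by apply: le_lt_trans (jump_time_le F Y xi k w) (lt_trans h (ltry _)).
    by split => //; have [i hi] := (jump_timeE r%:E koo).1 h; exists i.
  by move=> [koo [i _ hi]]; apply/(jump_timeE r%:E koo); exists i.
move=> B [[pB|[t ->]]|[m [A [mA ->]]]].
- apply: sub_sigma_algebra; apply: copy_events_sub; exact: sub_sigma_algebra.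
- have : measurable ([set: S] `&` [set w | tau k.+1 w <= t%:E]).
    exact: emeasurable_fun_infty_c.
  by rewrite setTI.
- have m1 : measurable ([set w | tau k.+1 w < +oo] : set S).
    rewrite -[X in measurable X]setTI; exact: emeasurable_fun_infty_o mt _.
  have mY : measurable_fun (setT : set S)
      (fun w => Y (fine (tau k.+1 w)) (xi k.+1 m w) : borel E).
    apply: measurable_Y_comp.
    + by apply: measurableT_comp; [exact: fine_measurable | exact: mt].
    + exact: measurable_copy.
    + by move=> w; exact: fine_jump_time_ge0.
  have m2 := mY measurableT A mA; rewrite setTI in m2.
  exact: (measurableI _ _ m1 m2).
Qed.

Lemma past_measurable k : past k `<=` measurable.
Proof.
elim: k => [|k IH].
  move=> _ [m [A [mA ->]]]; rewrite -[X in measurable X]setTI.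
  have mY : measurable_fun setT (fun w => Y 0%R (xi 1%N m w) : borel E).
    apply: measurable_Y_comp => //.
    exact: fv_xi_measurable fv _ _ _.
  exact: mY measurableT A mA.
move=> B [pB|[i [a ->]]]; last exact: fv_U_measurable fv _ _ _ _.
have := prejump_copy_events pB; apply: g_sigma_measurable.
apply: copy_events_measurable => //.
by move=> m; exact: fv_xi_measurable fv _ _ _.
Qed.

Lemma measurable_past_Om k d (T : measurableType d) (f : Om -> T) :
  measurable_fun (setT : set (g_sigma_algebraType (past k))) f ->
  measurable_fun setT f.
Proof. by apply: measurable_fun_g_sigma; exact: past_measurable. Qed.

End fv_stage.

(** * Almost sure behaviour of a stage *)

Lemma ae_forall_count d (T : measurableType d) (R : realType)
    (mu : {measure set T -> \bar R}) (I : countType) (Q : I -> T -> Prop) :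
  (forall i, {ae mu, forall x, Q i x}) -> {ae mu, forall x, forall i, Q i x}.
Proof.
move=> h.
have : {ae mu, forall x, forall n : nat,
    if @choice.unpickle I n is Some i then Q i x else True}.
  apply: ae_foralln => n; case: (choice.unpickle n) => [i|]; first exact: h.
  exact: aeW.
by apply: filterS => x hx i; have := hx (choice.pickle i); rewrite choice.pickleK.
Qed.

Section fv_regularity.
Context (R : realType) (E : ptopologicalType) (F : set E)
  (dW : measure_display) (W : measurableType dW) (Y : R -> W -> E)
  (PY : R.-pker (measurableTypeR R * borel E) ~> W)
  (dO : measure_display) (Om : measurableType dO) (P : probability Om R)
  (N : nat) (xi : nat -> 'I_N -> Om -> W) (U : nat -> 'I_N -> Om -> 'I_N).
Hypothesis mF : measurable (F : set (borel E)).
Hypothesis dp : driving_process F Y PY.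
Hypothesis fv : fleming_viot F Y PY P xi U.

Let X := copy_path Y xi.
Let tau := jump_time F X.

Local Notation past := (past F Y xi U).
Local Notation copy_sigma k D :=
  (g_sigma_algebraType (copy_events (xi k.+1) (past k) D)).

Local Notation restart := (restart F Y xi U).
Local Notation restart_point := (restart_point F Y xi U).

Definition regular k w := tau k w < +oo /\ forall m, F (restart k m w).

Lemma measurable_kernel_restart k m (B : set W) : measurable B ->
  measurable_fun (setT : set (g_sigma_algebraType (past k)))
    (fun w => PY (restart_point k m w) B).
Proof.
move=> mB; apply: (measurableT_comp (f := fun x => PY x B)).
  exact: measurable_kernel.
exact: (measurable_restart_point mF).
Qed.

(** [fv_evolution] with its starting points replaced by [restart_point], almost surely the same. It
    is kept for the whole history because that contains the future choices. *)
Lemma fv_copies_history k : {ae P, forall w, tau k w < +oo} ->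
  forall H (B : 'I_N -> set W), history F X U k H -> measurable H ->
  (forall m, measurable (B m)) ->
  P (H `&` \bigcap_(m in [set: 'I_N]) (xi k.+1 m @^-1` B m)) =
  \int[P]_(w in H) \prod_(m < N) PY (restart_point k m w) (B m).
Proof.
move=> aek H B hH mH mB.
rewrite (fv_evolution fv)//.
have mtau : measurable_fun setT (fun w : Om => fine (tau k w) : measurableTypeR R).
  apply: measurableT_comp; first exact: fine_measurable.
  exact: (measurable_past_Om dp fv (measurable_jump_time_past (k := k))).
apply: ge0_ae_eq_integral => //.
- apply: measurable_funTS; apply: emeasurable_prod => m _.
  have mp : measurable_fun setT (fun w : Om => (fine (tau k w) : measurableTypeR R,
      at_time (X k.+1 m) (tau k) w : borel E)).
    apply: measurable_fun_pair => //; apply: (measurable_Y_comp dp) => //.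
      exact: fv_xi_measurable fv _ _ _.
    by move=> w; exact: fine_jump_time_ge0.
  exact: measurableT_comp (measurable_kernel PY (B m) (mB m)) mp.
- apply: measurable_funTS; apply: emeasurable_prod => m _.
  exact: (measurable_past_Om dp fv (measurable_kernel_restart (k := k) m (mB m))).
- by move=> w _; apply: prode_ge0.
- by move=> w _; apply: prode_ge0.
- case: k => [|k] in aek hH mtau *; first exact: aeW.
  apply: filterS2 aek (fv_restart fv (ltn0Sn k)) => w koo hr _.
  by apply: eq_bigr => m _; rewrite hr /restart_point /restart -/tau koo.
Qed.

Lemma fv_copies k : {ae P, forall w, tau k w < +oo} ->
  forall H (B : 'I_N -> set W), <<s past k >> H -> (forall m, measurable (B m)) ->
  P (H `&` \bigcap_(m in [set: 'I_N]) (xi k.+1 m @^-1` B m)) =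
  \int[P]_(w in H) \prod_(m < N) PY (restart_point k m w) (B m).
Proof.
move=> aek H B pH mB; apply: fv_copies_history => //; first exact: past_history.
by move: pH; apply: g_sigma_measurable; exact: past_measurable dp fv _.
Qed.

(** An almost sure property of the driving process passes to the m-th copy. [Q] may also involve the
    past and the other copies, which conditional independence allows to be held fixed. *)
Lemma fv_copies_ae k m (Q : Om -> W -> Prop) : {ae P, forall w, regular k w} ->
  measurable [set p : copy_sigma k [set m] * W | Q p.1 p.2] ->
  (forall w, regular k w -> {ae PY (restart_point k m w), forall y, Q w y}) ->
  {ae P, forall w, Q w (xi k.+1 m w)}.
Proof.
move=> regk mQ Qae.
pose A := [set p : copy_sigma k [set m] * W | ~ Q p.1 p.2].
have mA : measurable A by exact: measurableC.
have mf : mfun_ge0 (fun p : copy_sigma k [set m] * W => (\1_A p)%:E : \bar R).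
  split => [|p]; last by rewrite lee_fin.
  by apply/measurable_EFinP; rewrite (_ : \1_A = mindic R mA).
have cop : {ae P, forall w, tau k w < +oo} by apply: filterS regk => w [].
have := copies_disintegration (past_measurable dp fv (k:=k))
  (fun m => fv_xi_measurable fv m (ltn0Sn k))
  (measurable_restart_point mF (k:=k)) (fv_copies cop) mf.
have mxi : measurable_fun (setT : set Om) (fun w => (w : copy_sigma k [set m], xi k.+1 m w)).
  apply: measurable_fun_pair; last exact: fv_xi_measurable fv _ _ _.
  apply: measurable_id_g_sigma; apply: copy_events_measurable.
    exact: past_measurable dp fv _.
  by move=> n; exact: fv_xi_measurable fv _ _ _.
have mN : measurable [set w | ~ Q w (xi k.+1 m w)].
  by have := mxi measurableT A mA; rewrite setTI.
rewrite [X in X = _](_ : _ = P [set w | ~ Q w (xi k.+1 m w)]); last first.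
  rewrite -[in RHS](setIT [set w | _]) -integral_indic//.
rewrite [X in _ = X](_ : _ = 0); last first.
  rewrite (ae_eq_integral (cst 0))//.
  - by rewrite integral0.
  - apply: measurable_fun_g_sigma; last first.
      apply: measurable_integral_precomp mf.
      apply: measurable_past_copy; exact: (measurable_restart_point mF).
    apply: copy_events_measurable; first exact: past_measurable dp fv _.
    by move=> n; exact: fv_xi_measurable fv _ _ _.
  - apply: filterS regk => w rw _ /=.
    have [M [mM M0 MQ]] := Qae w rw.
    apply/eqP; rewrite eq_le; apply/andP; split; last exact: integral_ge0.
    rewrite -M0 -[in leRHS](setIT M) -integral_indic//.
    apply: ge0_le_integral => //.
    + by case: mf => mf _; exact: (measurableT_comp mf (pair1_measurable _)).
    + by apply/measurable_EFinP; rewrite (_ : \1_M = mindic R mM).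
    + move=> y _; rewrite lee_fin !indicE ler_nat.
      case: (boolP (_ \in A)) => // /set_mem nQ.
      by rewrite mem_set//; exact: MQ.
by move=> P0; exists [set w | ~ Q w (xi k.+1 m w)]; split.
Qed.

End fv_regularity.

Section fv_stages.
Context (R : realType) (E : ptopologicalType) (F : set E)
  (dW : measure_display) (W : measurableType dW) (Y : R -> W -> E)
  (PY : R.-pker (measurableTypeR R * borel E) ~> W)
  (dO : measure_display) (Om : measurableType dO) (P : probability Om R)
  (N : nat) (xi : nat -> 'I_N -> Om -> W) (U : nat -> 'I_N -> Om -> 'I_N).
Hypothesis mF : measurable (F : set (borel E)).
Hypothesis dp : driving_process F Y PY.
Hypothesis fv : fleming_viot F Y PY P xi U.

Let X := copy_path Y xi.
Let tau := jump_time F X.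

Hypothesis ai : assumption_i F Y PY.
Hypothesis aii : assumption_ii F Y PY.

Local Notation past := (past F Y xi U).
Local Notation exit_time := (exit_time F Y xi).
Local Notation copy_sigma k D :=
  (g_sigma_algebraType (copy_events (xi k.+1) (past k) D)).

Local Notation restart := (restart F Y xi U).
Local Notation regular := (regular F Y xi U).
Hypothesis N2 : (2 <= N)%N.

Let s0 k w : (0 <= fine (tau k w))%R.
Proof. exact: fine_jump_time_ge0. Qed.

Lemma measurable_pair_fine k (D : set 'I_N) :
  measurable_fun (setT : set (copy_sigma k D * W))
    (fun p => fine (tau k p.1) : measurableTypeR R).
Proof.
apply: (measurableT_comp (f := fun w : copy_sigma k D => fine (tau k w) : measurableTypeR R)).
  exact: measurable_copy_fine_jump_time.
exact: measurable_fst.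
Qed.

Lemma measurable_pair_hitting k (D : set 'I_N) :
  measurable_fun (setT : set (copy_sigma k D * W))
    (fun p => hitting_time F Y (fine (tau k p.1)) p.2).
Proof.
apply: (measurable_hitting_comp dp) => //.
exact: measurable_pair_fine.
Qed.

Lemma exit_time_ae k m : {ae P, forall w, regular k w} ->
  {ae P, forall w, (fine (tau k w))%:E < exit_time k m w < +oo /\
     ~ F (Y (fine (exit_time k m w)) (xi k.+1 m w))}.
Proof.
move=> regk.
pose Q w y := (fine (tau k w))%:E < hitting_time F Y (fine (tau k w)) y < +oo /\
     ~ F (Y (fine (hitting_time F Y (fine (tau k w)) y)) y).
apply: (fv_copies_ae mF dp fv (Q := Q) regk); last first.
  move=> w [_ Fw]; apply: filterS (driving_ae mF dp ai (s0 k w) (Fw m)).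
  by move=> y [? ? _]; split.
have mh := @measurable_pair_hitting k [set m].
have mf := @measurable_pair_fine k [set m].
have mF' : measurable_fun (setT : set (copy_sigma k [set m] * W))
   (fun p => Y (fine (hitting_time F Y (fine (tau k p.1)) p.2)) p.2 : borel E).
  apply: (measurable_Y_comp dp).
  - apply: measurableT_comp; [exact: fine_measurable | exact: mh].
  - exact: measurable_snd.
  - move=> p; apply: fine_ge0.
    by apply: le_trans (hitting_time_lb F Y (fine (tau k p.1)) p.2); rewrite lee_fin.
have m1 : measurable [set p : copy_sigma k [set m] * W |
    (fine (tau k p.1))%:E < hitting_time F Y (fine (tau k p.1)) p.2].
  rewrite -[X in measurable X]setTI; apply: measurable_lte => //.
  exact/measurable_EFinP.
have m2 : measurable [set p : copy_sigma k [set m] * W |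
    hitting_time F Y (fine (tau k p.1)) p.2 < +oo].
  rewrite -[X in measurable X]setTI; exact: emeasurable_fun_infty_o mh _.
have m3 := mF' measurableT _ (measurableC mF); rewrite setTI in m3.
have := measurableI _ _ (measurableI _ _ m1 m2) m3.
congr measurable; apply/seteqP; split => p; rewrite /Q /=.
  by move=> [[-> ->] ?]; split.
by move=> [/andP[? ?] ?]; split.
Qed.

Lemma exit_time_gt_ae k m z : {ae P, forall w, regular k w} ->
  {ae P, forall w, (fine (tau k w) <= z)%R ->
     (F (Y z (xi k.+1 m w)) <-> z%:E < exit_time k m w)}.
Proof.
move=> regk; have [z0|z0] := ltP z 0%R.
  by apply: aeW => w /(le_trans (s0 k w)); rewrite leNgt z0.
pose Q w y := (fine (tau k w) <= z)%R ->
     (F (Y z y) <-> z%:E < hitting_time F Y (fine (tau k w)) y).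
apply: (fv_copies_ae mF dp fv (Q := Q) regk); last first.
  move=> w [_ Fw]; apply: filterS (driving_ae mF dp ai (s0 k w) (Fw m)).
  by move=> y [_ _]; exact.
have mh := @measurable_pair_hitting k [set m].
have mf := @measurable_pair_fine k [set m].
have mF' : measurable_fun (setT : set (copy_sigma k [set m] * W))
   (fun p => Y z p.2 : borel E).
  apply: (measurable_Y_comp dp) => //; exact: measurable_snd.
have m1 : measurable [set p : copy_sigma k [set m] * W | (fine (tau k p.1) <= z)%R].
  by apply: measurable_fun_bool_set; exact: measurable_fun_ler.
have m2 : measurable [set p : copy_sigma k [set m] * W |
    z%:E < hitting_time F Y (fine (tau k p.1)) p.2].
  rewrite -[X in measurable X]setTI; exact: emeasurable_fun_o_infty mh _.
have m3 := mF' measurableT _ mF; rewrite setTI in m3.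
have := measurableU _ _ (measurableC m1) (measurableU _ _ (measurableI _ _ m2 m3)
   (measurableI _ _ (measurableC m2) (measurableC m3))).
congr measurable; apply/seteqP; split => p; rewrite /Q /=; first by tauto.
by have [|] := pselect (is_true (fine (tau k p.1) <= z)%R);
  have [|] := pselect (F (Y z p.2)); tauto.
Qed.

(** Given all copies but the m-th, the exit time of [n] is a constant, and by [aii] it is not an
    atom for the exit time of [m]. *)
Lemma exit_time_neq_ae k m n : m != n -> {ae P, forall w, regular k w} ->
  {ae P, forall w, exit_time k m w <> exit_time k n w}.
Proof.
move=> mn regk.
pose Q w y := hitting_time F Y (fine (tau k w)) y <> exit_time k n w.
apply: (fv_copies_ae mF dp fv (Q := Q) regk); last first.
  move=> w [_ Fw]; exists [set y | hitting_time F Y (fine (tau k w)) y = exit_time k n w].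
  split; first last.
  - by move=> y /contrapT.
  - exact: aii.
  - rewrite -[X in measurable X]setTI; apply: measurable_eqe => //.
    exact: (measurable_hitting dp).
have mh := @measurable_pair_hitting k [set m].
have mt : measurable_fun (setT : set (copy_sigma k [set m] * W))
    (fun p => exit_time k n p.1).
  apply: (measurableT_comp (f := fun w : copy_sigma k [set m] => exit_time k n w)).
    apply: (measurable_copy_exit_time dp) => /= nm.
    by rewrite nm eqxx in mn.
  exact: measurable_fst.
rewrite (_ : mkset _ = ~` [set p | hitting_time F Y (fine (tau k p.1)) p.2 =
   exit_time k n p.1])//.
apply: measurableC; rewrite -[X in measurable X]setTI.
exact: measurable_eqe.
Qed.

(** The pathwise facts from which the next jump is described without probability. The last clause is
    limited to rational times because its exceptional set depends on the time. *)
Definition good_stage k w :=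
  [/\ tau k w < +oo,
      forall m, tau k w < exit_time k m w < +oo /\
         ~ F (Y (fine (exit_time k m w)) (xi k.+1 m w)),
      forall m n, m != n -> exit_time k m w <> exit_time k n w &
      forall (q : rat) m, tau k w <= (ratr q)%:E ->
         (F (Y (ratr q) (xi k.+1 m w)) <-> (ratr q)%:E < exit_time k m w)].

Lemma good_stage_ae k : {ae P, forall w, regular k w} ->
  {ae P, forall w, good_stage k w}.
Proof.
move=> regk.
have h1 : {ae P, forall w m, (fine (tau k w))%:E < exit_time k m w < +oo /\
     ~ F (Y (fine (exit_time k m w)) (xi k.+1 m w))}.
  by apply: ae_forall_count => m; exact: exit_time_ae.
have h2 : {ae P, forall w (mn : 'I_N * 'I_N), mn.1 != mn.2 ->
    exit_time k mn.1 w <> exit_time k mn.2 w}.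
  apply: ae_forall_count => -[m n] /=; have [mn|mn] := boolP (m != n).
    by apply: filterS (exit_time_neq_ae mn regk).
  by apply: aeW.
have h3 : {ae P, forall w (qm : rat * 'I_N), (fine (tau k w) <= ratr qm.1)%R ->
     (F (Y (ratr qm.1) (xi k.+1 qm.2 w)) <-> (ratr qm.1)%:E < exit_time k qm.2 w)}.
  by apply: ae_forall_count => -[q m] /=; exact: exit_time_gt_ae.
apply: filter_app h3; apply: filterS3 regk h1 h2 => w [koo _] h1' h2' h3'.
have kfin : tau k w \is a fin_num by rewrite ge0_fin_numE// jump_time_ge0.
split => // [m|m n|q m].
- by have := h1' m; rewrite fineK.
- exact: h2' (m, n).
- by move=> h; apply: (h3' (q, m)); rewrite -lee_fin fineK.
Qed.

(** Exit times differ, so the first one has a unique owner. Any other particle is in [F] at that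
    moment, as a position outside [F] after [tau k] would bound its exit time. *)
Lemma next_jump k w : good_stage k w -> exists i,
  [/\ tau k.+1 w = exit_time k i w, tau k w < tau k.+1 w < +oo,
      forall j, j != i -> tau k.+1 w < exit_time k j w,
      exiting F X k.+1 w = Some i &
      forall j, j != i -> F (X k.+1 j (fine (tau k.+1 w)) w)].
Proof.
move=> [koo h1 h2 _].
have i0 : 'I_N by exact: Ordinal (ltnW N2).
pose i := [arg min_(i < i0) exit_time k i w]%O.
have imin j : exit_time k i w <= exit_time k j w.
  by rewrite /i; case: arg_minP => // i' _ h; exact: h.
have ti : tau k.+1 w = exit_time k i w.
  apply/eqP; rewrite eq_le; apply/andP; split; rewrite leNgt; apply/negP => h.
    suff : tau k.+1 w < tau k.+1 w by rewrite ltxx.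
    by apply/(jump_timeE _ koo); exists i.
  have [j hj] := (jump_timeE _ koo).1 h.
  by have := imin j; rewrite leNgt hj.
have lti j : j != i -> tau k.+1 w < exit_time k j w.
  move=> ji; rewrite ti lt_neqAle imin andbT; apply/eqP => e.
  by apply: (h2 _ _ ji).
have [/andP[ki ioo] nFi] := h1 i.
have Fj j : j != i -> F (X k.+1 j (fine (tau k.+1 w)) w).
  move=> ji; apply: contrapT => nF.
  have kfin : tau k w \is a fin_num by rewrite ge0_fin_numE// jump_time_ge0.
  have tfin : tau k.+1 w \is a fin_num.
    by rewrite ge0_fin_numE ?jump_time_ge0// ti.
  have klt : (fine (tau k w) < fine (tau k.+1 w))%R.
    by rewrite -lte_fin !fineK// ti.
  have := @hitting_time_le R E W F Y _ _ _ klt nF.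
  by rewrite fineK// leNgt lti.
exists i; split => //; first by rewrite ti ki.
rewrite /exiting; case: pickP => [j /asboolP|/(_ i) /asboolP].
  rewrite /at_time -/(tau k.+1 w) => nFj; congr Some.
  by apply/eqP; apply: contrapT => /negP /Fj.
by case; rewrite /at_time -/tau ti.
Qed.

Lemma choice_neq_ae : {ae P, forall w (ki : nat * 'I_N), U ki.1.+1 ki.2 w != ki.2}.
Proof.
apply: ae_forall_count => -[k i] /=.
exists (U k.+1 i @^-1` [set i]); split.
- exact: fv_U_measurable fv _ _ _ _.
- by rewrite (fv_U_uniform fv)// eqxx.
- by move=> w /negP; rewrite negbK => /eqP.
Qed.

(** Induction on stages: the particle that jumps takes the position of a different one, and all the
    others are in [F] at the jump. *)
Lemma regular_ae k : {ae P, forall w, regular k w}.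
Proof.
elim: k => [|k IH].
  by apply: filterS (fv_start fv) => w h; split => //=; rewrite ltry.
apply: filterS2 (good_stage_ae IH) choice_neq_ae => w /next_jump.
move=> [i [ti /andP[_ koo] lti ei Fj]] hU; split => // m.
rewrite /= /restart -/tau koo /parent ei; apply: Fj.
have [[->]|] := eqVneq (Some i) (Some m); first exact: hU (k, m).
by apply: contra => /eqP ->.
Qed.

End fv_stages.

(** * Independence of the choices from the past *)

Lemma indep_pi d (T : measurableType d) (R : realType) (P : probability T R)
    (C : set (set T)) (V : set T) (c : R) : C `<=` measurable ->
  setI_closed C -> C setT -> measurable V -> (0 <= c)%R ->
  (forall A, C A -> P (A `&` V) = c%:E * P A) ->
  forall A, <<s C >> A -> P (A `&` V) = c%:E * P A.
Proof.
move=> Cm CI CT mV c0 CV A sA.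
pose S := g_sigma_algebraType C.
pose I (f : S -> \bar R) := \int[P]_(w in V) (1%:E * f w).
pose J (f : S -> \bar R) := \int[P]_w (c%:E * f w).
have mS (f : S -> \bar R) : mfun_ge0 f -> measurable_fun (setT : set T) f.
  by case=> mf _; exact: measurable_fun_g_sigma mf.
have IE (B : set T) : measurable B -> I (fun w => (\1_B w)%:E) = P (B `&` V).
  by move=> mB; rewrite /I; under eq_integral do rewrite mul1e;
    rewrite integral_indic//.
have JE (B : set T) : measurable B -> J (fun w => (\1_B w)%:E) = c%:E * P B.
  move=> mB; rewrite /J ge0_integralZl//.
  - by rewrite integral_indic// setIT.
  - by apply/measurable_EFinP; rewrite (_ : \1_B = mindic R mB).
have mA := g_sigma_measurable Cm sA.
rewrite -IE// -JE//.
apply: (@integral_like_pi _ S R C) => //.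
- apply: integral_like_integral => // [w|f /mS mf].
    exact: integral_like_eval.
  by under eq_fun do rewrite mul1e.
- apply: integral_like_integral => // [w|f /mS mf].
    exact: integral_like_eval.
  exact: measurable_funeM.
- rewrite /I; under eq_integral do rewrite mul1e.
  rewrite integral_cst// mul1e; apply: (@le_lt_trans _ _ 1); last exact: ltry.
  exact: probability_le1.
- by move=> B CB; rewrite IE ?JE ?CV//; exact: Cm.
- split => [|x]; last by rewrite lee_fin.
  apply/measurable_EFinP.
  by rewrite (_ : \1_A = mindic R (sA : measurable (A : set S))).
Qed.

Section fv_choices.
Context (R : realType) (E : ptopologicalType) (F : set E)
  (dW : measure_display) (W : measurableType dW) (Y : R -> W -> E)
  (PY : R.-pker (measurableTypeR R * borel E) ~> W)
  (dO : measure_display) (Om : measurableType dO) (P : probability Om R)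
  (N : nat) (xi : nat -> 'I_N -> Om -> W) (U : nat -> 'I_N -> Om -> 'I_N).
Hypothesis mF : measurable (F : set (borel E)).
Hypothesis dp : driving_process F Y PY.
Hypothesis fv : fleming_viot F Y PY P xi U.

Let X := copy_path Y xi.
Let tau := jump_time F X.

Hypothesis ai : assumption_i F Y PY.
Hypothesis aii : assumption_ii F Y PY.

Local Notation past := (past F Y xi U).
Local Notation prejump := (prejump F Y xi U).

Local Notation restart_point := (restart_point F Y xi U).
Hypothesis N2 : (2 <= N)%N.

(** Constraints on the choices at the [n] jumps after jump [k]. A whole block is treated at once
    because the induction on [k] moves its first element into the past. *)
Definition choices_in k n (S : nat -> 'I_N -> set 'I_N) : set Om :=
  [set w | forall l i, (l < n)%N -> S l i (U (k + l).+1 i w)].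

Let pr k i (A : set 'I_N) : R := fine (P (U k i @^-1` A)).

Definition choices_prob k n (S : nat -> 'I_N -> set 'I_N) : R :=
  (\prod_(l < n) \prod_(i < N) pr (k + l).+1 i (S l i))%R.

Let preimageE k i (A : set 'I_N) :
  U k.+1 i @^-1` A = \bigcup_(a in A) U k.+1 i @^-1` [set a].
Proof. by apply/seteqP; split => [w Aw|w [a Aa /= ->]//]; exists (U k.+1 i w). Qed.

Let mUS k i (A : set 'I_N) : measurable (U k.+1 i @^-1` A).
Proof.
rewrite preimageE; apply: fin_bigcup_measurable => [|a _].
  exact: finite_finset.
exact: fv_U_measurable fv _ _ _ _.
Qed.

Let choicesE k n S : choices_in k n S =
  \bigcap_(l in `I_n) \bigcap_(i in [set: 'I_N]) (U (k + l).+1 i @^-1` S l i).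
Proof.
by apply/seteqP; split => w h => [l ln i _|l i ln]; [exact: h|exact: (h l ln i)].
Qed.

Let mchoices k n S : measurable (choices_in k n S).
Proof.
rewrite choicesE; apply: fin_bigcap_measurable => // l _.
by apply: fin_bigcap_measurable => // i _; exact: mUS.
Qed.

Let choices_prob_ge0 k n S : (0 <= choices_prob k n S)%R.
Proof. by apply: prodr_ge0 => l _; apply: prodr_ge0 => i _; exact: fine_ge0. Qed.

Let choices_in_history j k n S : history F X U j (choices_in k n S).
Proof.
pose T := g_sigma_algebraType ([set B | exists (l : nat) (i a : 'I_N),
         (0 < l)%N /\ B = U l i @^-1` [set a]]
      `|` initial_events X
      `|` [set B | exists (j' : nat) (t : R),
             (j' <= j)%N /\ B = [set w | jump_time F X j' w <= t%:E]]
      `|` [set B | exists (j' : nat) (m : 'I_N) (t : R) (A : set E),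
             [/\ (j' < j)%N, (0 <= t)%R, measurable (A : set (borel E)) &
              B = [set w | jump_time F X j' w <= t%:E /\
                     A (at_time (X j'.+1 m)
                          (fun w => mine t%:E (jump_time F X j'.+1 w)) w)]] ]).
rewrite choicesE; apply: (@fin_bigcap_measurable _ T) => // l _.
apply: (@fin_bigcap_measurable _ T) => // i _.
rewrite preimageE; apply: (@fin_bigcup_measurable _ T) => [|a _].
  exact: finite_finset.
by apply: sub_sigma_algebra; left; left; left; exists (k + l).+1, i, a.
Qed.

(** Joint independence of [U] and the initial configuration, the latter being indexed by [None]. *)
Lemma initial_choices_indep n S A : <<s past 0 >> A ->
  P (A `&` choices_in 0 n S) = (choices_prob 0 n S)%:E * P A.
Proof.
move=> pA.
pose B (j : option (nat * 'I_N)) := if j is Some (l, i) then U l.+1 i @^-1` S l i else A.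
pose s := [seq Some p | p <- [seq (l, i) | l <- index_iota 0 n, i <- enum 'I_N]].
have sP l i : Some (l, i) \in s <-> (l < n)%N.
  split => [/mapP[[l' i'] /allpairsP[[l2 i2] [/= + _ [-> ->]]] [-> _]]|ln].
    by rewrite mem_index_iota.
  apply: map_f; apply/allpairsP; exists (l, i); split => //=.
    by rewrite mem_index_iota.
  by rewrite mem_enum.
have us : uniq (None :: s).
  rewrite /=; apply/andP; split; first by apply/negP => /mapP[].
  rewrite map_inj_uniq; last by move=> ? ? [].
  by apply: allpairs_uniq; [exact: iota_uniq|exact: enum_uniq|move=> [? ?] [? ?]].
have -> : A `&` choices_in 0 n S = \bigcap_(j in [set` None :: s]) B j.
  apply/seteqP; split => [w [Aw Sw] [[l i]|]//= |w h].
    by rewrite in_cons /= => /sP ln; exact: Sw.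
  split; first by apply: (h None); rewrite /= in_cons eqxx.
  move=> l i ln; apply: (h (Some (l, i))).
  by rewrite /= in_cons; apply/orP; right; apply/sP.
rewrite (fv_U_independent fv)//; last first.
  by move=> [[l i]|] _ //; exists (S l i).
rewrite big_cons /= muleC; congr (_ * _).
rewrite big_map big_allpairs_dep /= big_mkord /choices_prob.
rewrite (@big_morph _ _ EFin 1 *%E)//; apply: eq_bigr => l _.
rewrite (@big_morph _ _ EFin 1 *%E)// big_enum; apply: eq_bigr => i _.
by rewrite fineK//; exact: fin_num_measure.
Qed.

(** Adjoining the copies of stage [k]: their conditional law given the whole history, choices
    included, depends on [past k] only, so a choice event still contributes just its probability as
    a factor. *)
Let indep_step1 k :
  (forall n S A, <<s past k >> A ->
     P (A `&` choices_in k n S) = (choices_prob k n S)%:E * P A) ->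
  forall n S A, <<s copy_events (xi k.+1) (past k) set0 >> A ->
     P (A `&` choices_in k n S) = (choices_prob k n S)%:E * P A.
Proof.
move=> IH n S.
have mxi m : measurable_fun setT (xi k.+1 m) by exact: fv_xi_measurable fv _ _ _.
have mp := past_measurable dp fv (k := k).
have cop : {ae P, forall w, tau k w < +oo}.
  by apply: filterS (regular_ae mF dp fv ai aii N2 k) => w [].
apply: indep_pi => //.
- exact: copy_events_measurable.
- exact: copy_events_setI.
- by apply: copy_events_sub; exact: (@measurableT _ (g_sigma_algebraType (past k))).
- move=> _ [H [B [pH mB _ ->]]].
  have mH : measurable H by move: pH; exact: g_sigma_measurable.
  rewrite setIAC (fv_copies_history mF dp fv cop)//; first last.
  - exact: measurableI.
  - apply: (@measurableI _ (g_sigma_algebraType _)); last exact: choices_in_history.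
    exact: past_history pH.
  rewrite (fv_copies mF dp fv cop)//.
  pose g (w : g_sigma_algebraType (past k)) :=
    (\1_H w)%:E * \prod_(m < N) PY (restart_point k m w) (B m).
  have mg : mfun_ge0 g.
    split; last by move=> w; rewrite mule_ge0//; apply: prode_ge0.
    apply: emeasurable_funM.
      apply/measurable_EFinP.
      by rewrite (_ : \1_H = mindic R (pH : measurable (H : set (g_sigma_algebraType (past k))))).
    by apply: emeasurable_prod => m _; exact: measurable_kernel_restart.
  have gE (V : set Om) : \int[P]_(w in H `&` V) \prod_(m < N) PY (restart_point k m w) (B m)
      = \int[P]_(w in V) g w.
    rewrite integral_mkcondl; apply: eq_integral => w _.
    rewrite patchE /g indicE; case: (w \in H); first by rewrite mul1e.
    by rewrite mul0e.
  rewrite gE -[X in _ = _ * \int[P]_(w in X) _]setIT gE.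
  rewrite (integral_weighted (h := cst (choices_prob k n S)%:E) mp)//.
  - rewrite ge0_integralZl//.
    + by case: mg => mg _; exact: measurable_fun_g_sigma mg.
    + by move=> w _; case: mg.
    + by rewrite lee_fin.
  - by move=> w; rewrite lee_fin.
  - move=> K pK; rewrite IH// integral_cst//.
    by move: pK; exact: g_sigma_measurable.
Qed.

(** Adjoining the choice at jump [k.+1]: it is the first of [n.+1] choices after jump [k], to which
    the hypothesis at stage [k] applies. *)
Let indep_step2 k :
  (forall n S A, <<s copy_events (xi k.+1) (past k) set0 >> A ->
     P (A `&` choices_in k n S) = (choices_prob k n S)%:E * P A) ->
  forall n S A, <<s past k.+1 >> A ->
     P (A `&` choices_in k.+1 n S) = (choices_prob k.+1 n S)%:E * P A.
Proof.
move=> IH n S.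
have mxi m : measurable_fun setT (xi k.+1 m) by exact: fv_xi_measurable fv _ _ _.
have mp := past_measurable dp fv (k := k).
pose T := g_sigma_algebraType (copy_events (xi k.+1) (past k) set0).
pose C := [set K | exists A (S0 : 'I_N -> set 'I_N),
  <<s copy_events (xi k.+1) (past k) set0 >> A /\
  K = A `&` choices_in k 1 (fun=> S0)].
move=> A pA; have {pA} : <<s C >> A.
  move: A pA; apply: smallest_sub; first exact: smallest_sigma_algebra.
  move=> B [pB|[i [a ->]]]; apply: sub_sigma_algebra.
    exists B, (fun=> setT); split; first exact: (prejump_copy_events dp).
    by rewrite (_ : choices_in _ _ _ = setT) ?setIT// -subTset.
  exists setT, (fun j => if j == i then [set a] else setT); split.
    exact: (@measurableT _ T).
  rewrite setTI; apply/seteqP; split => w /=.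
    by move=> h l j; rewrite ltnS leqn0 => /eqP ->; rewrite addn0; case: eqP => // ->.
  by move=> /(_ 0%N i (ltn0Sn _)); rewrite addn0 eqxx.
have CS A0 S0 : <<s copy_events (xi k.+1) (past k) set0 >> A0 ->
    P (A0 `&` choices_in k 1 (fun=> S0)) =
    (\prod_(i < N) pr k.+1 i (S0 i))%R%:E * P A0.
  by move=> pA0; rewrite IH// /choices_prob big_ord1 addn0.
apply: indep_pi => //.
- move=> _ [B [S0 [pB ->]]]; apply: measurableI => //.
  by move: pB; apply: g_sigma_measurable; exact: copy_events_measurable.
- move=> _ _ [B [S0 [pB ->]]] [B' [S0' [pB' ->]]].
  exists (B `&` B'), (fun i => S0 i `&` S0' i); split.
    exact: (@measurableI _ T).
  rewrite setIACA; congr (_ `&` _); apply/seteqP; split => w.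
    by move=> [h h'] l i ln; split; [exact: h|exact: h'].
  by move=> h; split => l i ln; have [] := h l i ln.
- exists setT, (fun=> setT); split; first exact: (@measurableT _ T).
  by rewrite setTI; apply/seteqP; split.
- move=> _ [B [S0 [pB ->]]].
  pose S' l := if l is l'.+1 then S l' else S0.
  have -> : B `&` choices_in k 1 (fun=> S0) `&` choices_in k.+1 n S =
            B `&` choices_in k n.+1 S'.
    rewrite -setIA; congr (_ `&` _); apply/seteqP; split => w.
      by move=> [h h'] [|l] i ln; [exact: h|rewrite -addSnnS; exact: h'].
    move=> h; split => l i ln.
      by move: ln; rewrite ltnS leqn0 => /eqP ->; exact: (h 0%N i).
    by have := h l.+1 i ln; rewrite -addSnnS.
  rewrite IH// CS// muleA -EFinM; congr (_%:E * _).
  rewrite /choices_prob big_ord_recl mulrC; congr (_ * _)%R.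
    by apply: eq_bigr => l _; apply: eq_bigr => i _; rewrite /= /bump add1n addSnnS.
  by rewrite addn0.
Qed.

Let past_indep k n S A : <<s past k >> A ->
  P (A `&` choices_in k n S) = (choices_prob k n S)%:E * P A.
Proof.
elim: k n S A => [|k IH] n S A; first exact: initial_choices_indep.
by apply: indep_step2; exact: indep_step1.
Qed.

Lemma choice_indep k i m A : <<s prejump k >> A -> m != i ->
  P (A `&` U k.+1 i @^-1` [set m]) = (N.-1%:R^-1)%:E * P A.
Proof.
move=> pA mi.
pose S (l : nat) j := if j == i then [set m] else [set: 'I_N].
have -> : U k.+1 i @^-1` [set m] = choices_in k 1 S.
  apply/seteqP; split => w /=.
    by move=> h l j; rewrite ltnS leqn0 => /eqP ->; rewrite addn0 /S; case: eqP => // ->.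
  by move=> /(_ 0%N i (ltn0Sn _)); rewrite addn0 /S eqxx.
rewrite (indep_step1 (@past_indep k)); last first.
  move: pA; apply: smallest_sub; first exact: smallest_sigma_algebra.
  exact: (prejump_copy_events dp).
congr (_%:E * _); rewrite /choices_prob big_ord1 (bigD1 i)//= addn0 big1 => [|j ji].
  by rewrite mulr1 /pr /S eqxx (fv_U_uniform fv)// (negbTE mi).
by rewrite /pr /S (negbTE ji) preimage_setT probability_setT.
Qed.

End fv_choices.

(** * The first jump after a stage *)

Section fv_one_step.
Context (R : realType) (E : ptopologicalType) (F : set E)
  (dW : measure_display) (W : measurableType dW) (Y : R -> W -> E)
  (PY : R.-pker (measurableTypeR R * borel E) ~> W)
  (dO : measure_display) (Om : measurableType dO) (P : probability Om R)
  (N : nat) (xi : nat -> 'I_N -> Om -> W) (U : nat -> 'I_N -> Om -> 'I_N).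
Hypothesis mF : measurable (F : set (borel E)).
Hypothesis dp : driving_process F Y PY.
Hypothesis fv : fleming_viot F Y PY P xi U.

Let X := copy_path Y xi.
Let tau := jump_time F X.

Hypothesis ai : assumption_i F Y PY.
Hypothesis aii : assumption_ii F Y PY.

Local Notation past := (past F Y xi U).
Local Notation exit_time := (exit_time F Y xi).
Local Notation copy_sigma k D :=
  (g_sigma_algebraType (copy_events (xi k.+1) (past k) D)).

Hypothesis N2 : (2 <= N)%N.

Variables (k : nat) (z : R) (z0 : (0 <= z)%R) (D : 'I_N -> set E).
Hypothesis mD : forall m, measurable (D m : set (borel E)).
Variable i : 'I_N.

Let s w := fine (tau k w).
Let s0 w : (0 <= s w)%R.
Proof. exact: fine_jump_time_ge0. Qed.

Let T := exit_time k i.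
Let T0 w : (0 <= fine (T w))%R.
Proof.
apply: fine_ge0; apply: le_trans (hitting_time_lb F Y (s w) _).
by rewrite lee_fin.
Qed.

Let mYz j : measurable (Y z @^-1` D j).
Proof. exact: (measurable_preimage_Y dp). Qed.

Definition alive_at (j : 'I_N) (w : Om) (y : W) : \bar R :=
  (\1_[set y | (T w < hitting_time F Y (s w) y)%E /\ D j (Y z y)] y)%:E.

(** What the Markov property predicts for [alive_at] from the path up to the exit time [T] of
    particle [i]. *)
Definition alive_pred (j : 'I_N) (w : Om) (y : W) : \bar R :=
  (\1_[set y | (T w < hitting_time F Y (s w) y)%E] y)%:E *
  PY (fine (T w), Y (fine (T w)) y) (Y z @^-1` D j).

Section joint_measurability.
Context d (S : measurableType d) (f : S -> Om) (y : S -> W).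
Hypothesis mT : measurable_fun setT (T \o f).
Hypothesis ms : measurable_fun setT (fun t => s (f t) : measurableTypeR R).
Hypothesis my : measurable_fun setT y.

Let mlt : measurable [set t | T (f t) < hitting_time F Y (s (f t)) (y t)].
Proof.
rewrite -[X in measurable X]setTI; apply: measurable_lte => //.
exact: (measurable_hitting_comp dp).
Qed.

Lemma mfun_alive_at j : mfun_ge0 (fun t => alive_at j (f t) (y t)).
Proof.
split => [|t]; last by rewrite lee_fin.
have m2 : measurable [set t | D j (Y z (y t))].
  have := (measurable_Y_comp dp (measurable_cst (z : measurableTypeR R)) my (fun=> z0)).
  by move=> /(_ measurableT _ (mD j)); rewrite setTI.
have m3 := measurableI _ _ mlt m2.
apply/measurable_EFinP; rewrite (_ : (fun t => _) = mindic R m3)//.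
Qed.

Lemma mfun_alive_pred j : mfun_ge0 (fun t => alive_pred j (f t) (y t)).
Proof.
split => [|t]; last by rewrite mule_ge0// lee_fin.
apply: emeasurable_funM.
  apply/measurable_EFinP; rewrite (_ : (fun t => _) = mindic R mlt)//.
have mfT : measurable_fun setT (fun t => fine (T (f t)) : measurableTypeR R).
  by apply: measurableT_comp; [exact: fine_measurable|exact: mT].
apply: (measurableT_comp (f := fun x => PY x (Y z @^-1` D j))).
  exact: measurable_kernel.
apply: measurable_fun_pair => //.
exact: (measurable_Y_comp dp).
Qed.

End joint_measurability.

Let mfun_copy_alive_at n j : n != i -> n != j ->
  @mfun_ge0 _ (copy_sigma k [set n]) _ (fun w => alive_at j w (xi k.+1 j w)).
Proof.
move=> ni nj; apply: (@mfun_alive_at _ (copy_sigma k [set n]) id (xi k.+1 j)).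
- by apply: (measurable_copy_exit_time dp) => /= e; rewrite e eqxx in ni.
- exact: measurable_copy_fine_jump_time.
- by apply: measurable_copy => /= e; rewrite e eqxx in nj.
Qed.

Let mfun_copy_alive_pred n j : n != i -> n != j ->
  @mfun_ge0 _ (copy_sigma k [set n]) _ (fun w => alive_pred j w (xi k.+1 j w)).
Proof.
move=> ni nj; apply: (@mfun_alive_pred _ (copy_sigma k [set n]) id (xi k.+1 j)).
- by apply: (measurable_copy_exit_time dp) => /= e; rewrite e eqxx in ni.
- exact: measurable_copy_fine_jump_time.
- by apply: measurable_copy => /= e; rewrite e eqxx in nj.
Qed.

(** For fixed [w] the time [T w] does not depend on [y], so [markov_at] applies there; [T w <= z]
    puts the target in its future. *)
Lemma alive_atE w x j : T w <= z%:E ->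
  \int[PY (s w, x)]_y alive_at j w y = \int[PY (s w, x)]_y alive_pred j w y.
Proof.
move=> Tz; have sT : (s w)%:E <= T w by exact: hitting_time_lb.
have Tfin : T w \is a fin_num.
  by rewrite fin_real// (lt_le_trans _ sT) ?ltNyr//= (le_lt_trans Tz) ?ltry.
have mh : measurable [set y | T w < hitting_time F Y (s w) y].
  rewrite -[X in measurable X]setTI; apply: emeasurable_fun_o_infty => //.
  exact: (measurable_hitting dp).
have st : (s w <= fine (T w))%R by rewrite -lee_fin (fineK Tfin).
have tz : (fine (T w) <= z)%R by rewrite -lee_fin (fineK Tfin).
rewrite /alive_at integral_indic//; last exact: (measurableI _ _ mh (mYz j)).
rewrite setIT; have := markov_at dp x (s0 w) st tz (mD j).
rewrite (fineK Tfin) => ->; rewrite integral_mkcond; apply: eq_integral => y _.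
by rewrite patchE /alive_pred indicE; case: (y \in _); rewrite ?mul1e ?mul0e.
Qed.

(* By conditional independence and the Markov property at time T of the n-th
   particle, the indicator of [D n] at time z may be replaced by its conditional
   probability given the position at time T. *)
Lemma alive_replace n (g : copy_sigma k [set n] -> \bar R) : n != i ->
  mfun_ge0 g -> (forall w, z%:E < T w -> g w = 0) ->
  \int[P]_w (g w * alive_at n w (xi k.+1 n w)) =
  \int[P]_w (g w * alive_pred n w (xi k.+1 n w)).
Proof.
move=> ni [mg g0] gz.
have cop : {ae P, forall w, tau k w < +oo}.
  by apply: filterS (regular_ae mF dp fv ai aii N2 k) => w [].
have dis := copies_disintegration (past_measurable dp fv (k:=k))
  (fun m => fv_xi_measurable fv m (ltn0Sn k))
  (measurable_restart_point mF (k:=k)) (fv_copies mF dp fv cop) (n := n).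
have mT' : measurable_fun (setT : set (copy_sigma k [set n])) T.
  by apply: (measurable_copy_exit_time dp) => /= e; rewrite e eqxx in ni.
have mT2 : measurable_fun (setT : set (copy_sigma k [set n] * W))
    (T \o (fst : copy_sigma k [set n] * W -> copy_sigma k [set n])).
  exact: (measurableT_comp mT' measurable_fst).
have ms2 := @measurable_pair_fine R E F dW W Y dO Om N xi U k [set n].
have ma := mfun_alive_at mT2 ms2 measurable_snd n.
have mb := mfun_alive_pred mT2 ms2 measurable_snd n.
have mg2 : measurable_fun (setT : set (copy_sigma k [set n] * W)) (fun p => g p.1).
  exact: (measurableT_comp mg measurable_fst).
have mga : @mfun_ge0 _ (copy_sigma k [set n] * W)%type _
    (fun p => g p.1 * alive_at n p.1 p.2).
  by case: ma => ma a0; split => [|p]; [exact: emeasurable_funM|exact: mule_ge0].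
have mgb : @mfun_ge0 _ (copy_sigma k [set n] * W)%type _
    (fun p => g p.1 * alive_pred n p.1 p.2).
  by case: mb => mb b0; split => [|p]; [exact: emeasurable_funM|exact: mule_ge0].
rewrite (dis _ mga) (dis _ mgb); apply: eq_integral => w _ /=.
have [Tz|zT] := leP (T w) z%:E; last first.
  by rewrite !integral0_eq// => y _; rewrite gz// mul0e.
rewrite !ge0_integralZl//.
- by rewrite alive_atE.
- case: mb => mb _; have h := measurableT_comp mb (pair1_measurable (w : copy_sigma k [set n])).
  exact: h.
- by move=> y _; case: mb => _ b0; exact: (b0 (w, y)).
- case: ma => ma _; have h := measurableT_comp ma (pair1_measurable (w : copy_sigma k [set n])).
  exact: h.
- by move=> y _; rewrite lee_fin.
Qed.

(** The factors are exchanged one at a time. When the turn of [n] comes, all other factors are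
    measurable without the n-th copy, as [alive_replace] demands. *)
Lemma alive_all (H : set Om) : <<s past k >> H ->
  \int[P]_(w in H `&` [set w | T w <= z%:E])
     \prod_(j | j != i) alive_at j w (xi k.+1 j w) =
  \int[P]_(w in H `&` [set w | T w <= z%:E])
     \prod_(j | j != i) alive_pred j w (xi k.+1 j w).
Proof.
move=> pH; set HT := H `&` _; pose e w : \bar R := (\1_HT w)%:E.
have me n : n != i -> @mfun_ge0 _ (copy_sigma k [set n]) _ e.
  move=> ni; split => [|w]; last by rewrite lee_fin.
  have m1 : measurable (H : set (copy_sigma k [set n])).
    by apply: sub_sigma_algebra; exact: copy_events_sub.
  have m2 : measurable ([set w | T w <= z%:E] : set (copy_sigma k [set n])).
    rewrite -[X in measurable X]setTI; apply: emeasurable_fun_infty_c => //.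
    by apply: (measurable_copy_exit_time dp) => /= h; rewrite h eqxx in ni.
  have m3 := measurableI _ _ m1 m2.
  by apply/measurable_EFinP; rewrite (_ : \1__ = mindic R m3).
have intE f : \int[P]_(w in HT) f w = \int[P]_w (e w * f w).
  rewrite integral_mkcond; apply: eq_integral => w _.
  by rewrite patchE /e indicE; case: (w \in _); rewrite ?mul1e ?mul0e.
rewrite !intE.
(* The factors of [r1] are already predictions, those of [r2] are still indicators. *)
have hyb (r1 r2 : seq 'I_N) : uniq (r1 ++ r2) -> i \notin r1 ++ r2 ->
  \int[P]_w (e w * (\prod_(j <- r1) alive_pred j w (xi k.+1 j w) *
                    \prod_(j <- r2) alive_at j w (xi k.+1 j w))) =
  \int[P]_w (e w * \prod_(j <- r1 ++ r2) alive_pred j w (xi k.+1 j w)).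
  elim: r2 r1 => [|n r2 IH] r1 u ni.
    by rewrite cats0; under eq_integral do rewrite big_nil mule1.
  have ni' : n != i.
    by apply: contra ni => /eqP <-; rewrite mem_cat in_cons eqxx orbT.
  have nr1 : n \notin r1.
    by move: u; rewrite cat_uniq /= negb_or => /and3P[_ /andP[]].
  have nr2 : n \notin r2.
    by move: u; rewrite cat_uniq /= => /and4P[].
  rewrite -cat_rcons -IH ?cat_rcons//.
  pose g w := e w * (\prod_(j <- r1) alive_pred j w (xi k.+1 j w) *
                    \prod_(j <- r2) alive_at j w (xi k.+1 j w)).
  have mseq (r : seq 'I_N) (f : 'I_N -> Om -> \bar R) : n \notin r ->
      (forall j, n != j -> @mfun_ge0 _ (copy_sigma k [set n]) _ (f j)) ->
      @mfun_ge0 _ (copy_sigma k [set n]) _ (fun w => \prod_(j <- r) f j w).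
    move=> nr mf; split => [|w]; last first.
      rewrite big_seq; apply: prode_ge0 => j jr; have [|_] := mf j; last exact.
      by apply: contra nr => /eqP ->.
    under eq_fun do rewrite big_seq.
    apply: emeasurable_prod => j jr; have [|//] := mf j.
    by apply: contra nr => /eqP ->.
  have [m1 g1] := me _ ni'.
  have [m2 g2] := mseq r1 _ nr1 (fun j nj => mfun_copy_alive_pred ni' nj).
  have [m3 g3] := mseq r2 _ nr2 (fun j nj => mfun_copy_alive_at ni' nj).
  have := alive_replace (g := g) ni' _ _.
  under eq_integral => w _.
    rewrite (_ : _ * _ = e w * (\prod_(j <- r1) alive_pred j w (xi k.+1 j w) *
                    \prod_(j <- n :: r2) alive_at j w (xi k.+1 j w))); last first.
      by rewrite /g big_cons -!muleA; congr (_ * (_ * _)); exact: muleC.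
    over.
  under [X in _ = X]eq_integral => w _.
    rewrite (_ : _ * _ = e w * (\prod_(j <- rcons r1 n) alive_pred j w (xi k.+1 j w) *
                    \prod_(j <- r2) alive_at j w (xi k.+1 j w))); last first.
      by rewrite /g big_rcons /= -muleA; congr (_ * _); exact: muleAC.
    over.
  apply.
    split; last by move=> w; rewrite /g mule_ge0// mule_ge0.
    by apply: emeasurable_funM => //; exact: emeasurable_funM.
  move=> w zT; rewrite /g /e indicE memNset ?mul0e//= => -[_ /=].
  by rewrite leNgt zT.
have := hyb [::] (enum [pred j | j != i]); rewrite /= enum_uniq mem_enum /= !inE eqxx.
move=> /(_ isT isT); under eq_integral do rewrite big_nil mul1e big_enum.
by under [X in _ = X]eq_integral do rewrite big_enum.
Qed.

End fv_one_step.

Section fv_one_step2.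
Context (R : realType) (E : ptopologicalType) (F : set E)
  (dW : measure_display) (W : measurableType dW) (Y : R -> W -> E)
  (PY : R.-pker (measurableTypeR R * borel E) ~> W)
  (dO : measure_display) (Om : measurableType dO) (P : probability Om R)
  (N : nat) (xi : nat -> 'I_N -> Om -> W) (U : nat -> 'I_N -> Om -> 'I_N).
Hypothesis mF : measurable (F : set (borel E)).
Hypothesis dp : driving_process F Y PY.
Hypothesis fv : fleming_viot F Y PY P xi U.

Let X := copy_path Y xi.
Let tau := jump_time F X.

Hypothesis ai : assumption_i F Y PY.
Hypothesis aii : assumption_ii F Y PY.

Local Notation past := (past F Y xi U).
Local Notation prejump := (prejump F Y xi U).
Local Notation exit_time := (exit_time F Y xi).

Local Notation restart_point := (restart_point F Y xi U).
Hypothesis N2 : (2 <= N)%N.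

Definition target (C : {set 'I_N}) (m : 'I_N) : set E :=
  if m \in C then F else ~` F.

Lemma measurable_target C m : measurable (target C m : set (borel E)).
Proof. by rewrite /target; case: ifP => // _; exact: measurableC. Qed.

(** The conditional probability, given the past of the stage, that at time [z] the paths now
    followed by the particles of [C] are in [F] and all the other paths are not. *)
Definition survive (z : R) C k w : \bar R :=
  \prod_(m < N) PY (restart_point k m w) (Y z @^-1` target C m).

Definition jump_point k m w : measurableTypeR R * borel E :=
  (fine (tau k.+1 w),
   if tau k.+1 w < +oo then X k.+1 m (fine (tau k.+1 w)) w else point).

(** The analogue at the moment of the jump, without the particle [i], which has left [F] and has no
    new position yet. *)
Definition jump_survive (z : R) C i k w : \bar R :=
  \prod_(m < N | m != i) PY (jump_point k m w) (Y z @^-1` target C m).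

Definition exit_at (z : R) k i : set Om :=
  [set w | tau k.+1 w <= z%:E /\ exiting F X k.+1 w = Some i].

Let mYz z C j : (0 <= z)%R -> measurable (Y z @^-1` target C j).
Proof.
by move=> z0; apply: (measurable_preimage_Y dp) => //; exact: measurable_target.
Qed.

Lemma measurable_survive z C k : (0 <= z)%R ->
  @mfun_ge0 _ (g_sigma_algebraType (past k)) _ (survive z C k).
Proof.
move=> z0; split; last by move=> w; apply: prode_ge0.
by apply: emeasurable_prod => m _; apply: measurable_kernel_restart => //; exact: mYz.
Qed.

Lemma measurable_jump_point k m :
  measurable_fun (setT : set (g_sigma_algebraType (prejump k))) (jump_point k m).
Proof.
have sub := @sub_sigma_algebra _ setT (prejump k).
have mt := measurable_jump_time_prejump sub.
apply: measurable_fun_pair.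
  by apply: measurableT_comp; [exact: fine_measurable|exact: mt].
move=> _ A mA; rewrite setTI.
pose S := g_sigma_algebraType (prejump k).
have mfin : measurable ([set w | tau k.+1 w < +oo] : set S).
  by rewrite -[X in measurable X]setTI; exact: emeasurable_fun_infty_o mt _.
rewrite (_ : _ @^-1` _ =
  (~` [set w | tau k.+1 w < +oo] `&` (if `[< A point >] then setT else set0)) `|`
  [set w | tau k.+1 w < +oo /\ A (X k.+1 m (fine (tau k.+1 w)) w)]).
  apply: measurableU.
    by apply: measurableI; [exact: measurableC|case: ifP].
  exact: (measurable_jump_position sub m mA).
apply/seteqP; split => w /=.
  case: ifPn => [koo Aw|/negP koo Aw]; first by right.
  by left; split => //; case: asboolP.
by move=> [[/negP/negbTE ->]|[-> Aw]//]; case: asboolP.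
Qed.

Lemma measurable_jump_survive z C i k : (0 <= z)%R ->
  @mfun_ge0 _ (g_sigma_algebraType (prejump k)) _ (jump_survive z C i k).
Proof.
move=> z0; split; last by move=> w; apply: prode_ge0.
apply: emeasurable_prod => m _.
apply: (measurableT_comp (f := fun x => PY x (Y z @^-1` target C m))).
  by apply: measurable_kernel; exact: mYz.
exact: measurable_jump_point.
Qed.

Lemma measurable_exit_at z i k :
  measurable (exit_at z k i : set (g_sigma_algebraType (prejump k))).
Proof.
have sub := @sub_sigma_algebra _ setT (prejump k).
have mt := measurable_jump_time_prejump sub.
rewrite (_ : exit_at z k i = [set w | tau k.+1 w <= z%:E] `&`
   [set w | tau k.+1 w < +oo /\ exiting F X k.+1 w = Some i]).
  apply: measurableI; last exact: (measurable_exiting mF sub).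
  rewrite -[X in measurable X]setTI; exact: emeasurable_fun_infty_c mt _.
apply/seteqP; split => w /= [h1 h2]; last by split => //; case: h2.
by split => //; split => //; apply: le_lt_trans h1 (ltry _).
Qed.

Lemma past_sub_prejump k (H : set Om) : <<s past k >> H -> <<s prejump k >> H.
Proof. by apply: sub_sigma_algebra2 => A pA; left; left. Qed.

Lemma prejump_measurable k : prejump k `<=` measurable.
Proof. by move=> A pA; apply: (past_measurable dp fv (k := k.+1)); left. Qed.

(** Some particle lies outside [C], so the event behind [survive] forces a jump by time [z], and the
    first to exit cannot belong to [C]. The sum is over this particle [i]; the Markov property at
    its exit time turns the requirement on the others into [jump_survive]. The requirement on [i]
    itself is dropped, whence an inequality. *)
Lemma one_step (q : rat) k (C : {set 'I_N}) (H : set Om) (z := ratr q : R) :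
  (0 <= z)%R -> <<s past k >> H -> H `<=` [set w | tau k w <= z%:E] ->
  C != [set: 'I_N]%SET ->
  \int[P]_(w in H) survive z C k w <=
  \sum_(i | i \notin C) \int[P]_(w in H `&` exit_at z k i) jump_survive z C i k w.
Proof.
move=> z0 pH Hz CT.
have mH : measurable H by move: pH; apply: g_sigma_measurable; exact: past_measurable dp fv _.
have reg := regular_ae mF dp fv ai aii N2 k.
have cop : {ae P, forall w, tau k w < +oo} by apply: filterS reg => w [].
have good := good_stage_ae mF dp fv ai aii reg.
have mC m := measurable_target C m.
have mxi m : measurable_fun setT (xi k.+1 m) by exact: fv_xi_measurable fv _ _ _.
have mtk : measurable_fun setT (fun w : Om => fine (tau k w) : measurableTypeR R).
  apply: measurableT_comp; first exact: fine_measurable.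
  exact: (measurable_past_Om dp fv (measurable_jump_time_past (k := k))).
have mT i : measurable_fun setT (exit_time k i).
  by apply: (measurable_hitting_comp dp) => // w; exact: fine_jump_time_ge0.
have mHT i : measurable (H `&` [set w | exit_time k i w <= z%:E]).
  apply: measurableI => //; rewrite -[X in measurable X]setTI.
  exact: emeasurable_fun_infty_c.
pose at_ i j w := alive_at F Y xi k z (target C) i j w (xi k.+1 j w).
pose pr_ i j w := alive_pred F Y PY xi k z (target C) i j w (xi k.+1 j w).
have mat i j : mfun_ge0 (at_ i j) := @mfun_alive_at R E F _ W Y PY _ Om N xi dp
  k z z0 (target C) mC i _ Om id (xi k.+1 j) (mT i) mtk (mxi j) j.
have mpr i j : mfun_ge0 (pr_ i j) := @mfun_alive_pred R E F _ W Y PY _ Om N xi dp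
  k z z0 (target C) mC i _ Om id (xi k.+1 j) (mT i) mtk (mxi j) j.
pose HT i := H `&` [set w | exit_time k i w <= z%:E].
have mind (A : set Om) : measurable A -> @mfun_ge0 _ Om R (fun w => (\1_A w)%:E).
  move=> mA; split => [|w]; last by rewrite lee_fin.
  by apply/measurable_EFinP; rewrite (_ : \1_A = mindic R mA).
have mprod (f : 'I_N -> Om -> \bar R) i : (forall j, mfun_ge0 (f j)) ->
    mfun_ge0 (fun w => \prod_(j | j != i) f j w).
  move=> mf; split => [|w]; last by apply: prode_ge0 => j _; case: (mf j).
  by apply: emeasurable_prod => j _; case: (mf j).
have mmul (f g : Om -> \bar R) : mfun_ge0 f -> mfun_ge0 g ->
    mfun_ge0 (fun w => f w * g w).
  by move=> [mf f0] [mg g0]; split => [|w]; [exact: emeasurable_funM|exact: mule_ge0].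
have intE (A : set Om) (f : Om -> \bar R) :
    \int[P]_(w in A) f w = \int[P]_w ((\1_A w)%:E * f w).
  rewrite integral_mkcond; apply: eq_integral => w _.
  by rewrite patchE indicE; case: (w \in _); rewrite ?mul1e ?mul0e.
have sumE (f : 'I_N -> \bar R) : \sum_(i | i \notin C) f i =
    \sum_(i <- enum [pred i | i \notin C]) f i by rewrite big_enum.
have step1 : \int[P]_(w in H) survive z C k w <=
    \sum_(i | i \notin C) \int[P]_(w in HT i) \prod_(j | j != i) at_ i j w.
  rewrite /survive -(fv_copies mF dp fv cop pH (fun m => mYz C m z0)).
  set S0 := _ `&` _.
  have mS0 : measurable S0.
    apply: measurableI => //; apply: fin_bigcap_measurable => // m _.
    by rewrite -[X in measurable X]setTI; apply: mxi => //; exact: mYz.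
  rewrite -[S0]setIT -integral_indic// sumE.
  under eq_bigr do rewrite intE.
  have mfi i : mfun_ge0 (fun w => (\1_(HT i) w)%:E * \prod_(j | j != i) at_ i j w).
    exact: mmul (mind _ (mHT i)) (mprod _ i (mat i)).
  rewrite -ge0_integral_sum//; last 2 first.
  - by move=> i; have [] := mfi i.
  - by move=> i w _; have [_] := mfi i; exact.
  apply: ae_ge0_le_integral => //.
  - by have [] := mind _ mS0.
  - by move=> w _; apply: sume_ge0 => i _; have [_] := mfi i; exact.
  - by apply: emeasurable_sum => i; have [] := mfi i.
  apply: filterS good => w gw _.
  rewrite indicE; case: (boolP (w \in S0)) => [/set_mem [Hw Sw]|_]; last first.
    by apply: sume_ge0 => i _; have [_] := mfi i; exact.
  have [i [ti _ lti _ _]] := next_jump N2 gw.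
  have [koo _ _ /(_ q)hq] := gw.
  have kz : tau k w <= z%:E by exact: Hz.
  have [j jC] : exists j, j \notin C.
    apply/existsP; rewrite -negb_forall; apply: contra CT => /forallP allC.
    by apply/eqP/setP => j; rewrite inE allC.
  have jz : exit_time k j w <= z%:E.
    have := Sw j Logic.I; rewrite /= /target (negbTE jC) => nF.
    by rewrite leNgt; apply/negP => /(hq j kz).2.
  have iz : exit_time k i w <= z%:E.
    apply: le_trans jz; rewrite -ti.
    have [->|ji] := eqVneq j i; first by rewrite ti.
    by exact: ltW (lti j ji).
  have iC : i \notin C.
    apply/negP => iC; have := Sw i Logic.I; rewrite /= /target iC.
    by move=> /(hq i kz).1; rewrite ltNge iz.
  rewrite -sumE (bigD1 i)//= -[leLHS]adde0; apply: leeD; last first.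
    by apply: sume_ge0 => j' _; have [_] := mfi j'; exact.
  rewrite indicE mem_set//= mul1e big1// => m mi.
  rewrite /at_ /alive_at indicE mem_set//; split; last exact: Sw.
  by rewrite -/(exit_time k m w) -ti lti.
(* The product of predictions vanishes unless [i] exits before all the others, and then its exit
   time is the next jump time. *)
apply: le_trans step1 _; apply: lee_sum => i iC.
rewrite (alive_all mF dp fv ai aii N2 z0 mC i pH) intE [leRHS]intE.
have mJ := measurable_jump_survive C i k z0.
have mJ' : mfun_ge0 (jump_survive z C i k).
  case: mJ => mJ J0; split => //; apply: measurable_fun_g_sigma mJ.
  exact: prejump_measurable.
have mHe : measurable (H `&` exit_at z k i).
  apply: measurableI => //; move: (measurable_exit_at z i (k := k)).
  by apply: g_sigma_measurable; exact: prejump_measurable.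
have m1 := mmul _ _ (mind _ (mHT i)) (mprod (pr_ i) i (mpr i)).
have m2 := mmul _ _ (mind _ mHe) mJ'.
apply: ae_ge0_le_integral => //.
- by move=> w _; case: m1 => _; exact.
- by case: m1.
- by move=> w _; case: m2 => _; exact.
- by case: m2.
apply: filterS good => w gw _.
rewrite [X in X%:E * _]indicE; case: (boolP (w \in _)) => [/set_mem [Hw iz]|_]; last first.
  by rewrite mul0e; case: m2 => _; exact.
rewrite mul1e.
have [[j [ji nlt]]|allT] := pselect (exists j, j != i /\
    ~ (exit_time k i w < exit_time k j w)).
  rewrite (bigD1 j)//= {1}/alive_pred indicE memNset ?mul0e//.
  by case: m2 => _; exact.
have [i' [ti' tlt lti' ei' _]] := next_jump N2 gw.
have ii' : i = i'.
  apply/eqP; apply: contrapT => /negP ni; have h1 := lti' i ni.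
  have h2 : exit_time k i w < exit_time k i' w.
    by apply: contrapT => h; apply: allT; exists i'; rewrite eq_sym.
  by have := lt_trans h1 h2; rewrite ti' ltxx.
subst i'.
have inS : (H `&` exit_at z k i) w.
  split; first exact: Hw.
  by split; [rewrite /= /tau ti'; exact: iz | exact: ei'].
rewrite indicE (mem_set inS) mul1e.
rewrite le_eqVlt; apply/orP; left; apply/eqP; apply: eq_bigr => j ji.
have /andP[_ koo] := tlt.
rewrite /alive_pred indicE mem_set ?mul1e /jump_point; last first.
  by rewrite /= -/(exit_time k j w) -ti' lti'.
by rewrite -ti' -/tau koo.
Qed.

End fv_one_step2.

(** * Coalescence of ancestral lines *)

Lemma prode_le1 (R : realType) (I : Type) (r : seq I) (Q : pred I)
    (f : I -> \bar R) : (forall i, Q i -> 0 <= f i <= 1) ->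
  \prod_(i <- r | Q i) f i <= 1.
Proof.
move=> f01; suff /andP[] : 0 <= \prod_(i <- r | Q i) f i <= 1 by [].
elim/big_ind: _ => [|x y /andP[x0 x1] /andP[y0 y1]|//].
  by rewrite lexx andbT lee_fin.
by rewrite mule_ge0//= -[leRHS]mule1 lee_pmul.
Qed.

Section fv_coalescence.
Context (R : realType) (E : ptopologicalType) (F : set E)
  (dW : measure_display) (W : measurableType dW) (Y : R -> W -> E)
  (PY : R.-pker (measurableTypeR R * borel E) ~> W)
  (dO : measure_display) (Om : measurableType dO) (P : probability Om R)
  (N : nat) (xi : nat -> 'I_N -> Om -> W) (U : nat -> 'I_N -> Om -> 'I_N).
Hypothesis mF : measurable (F : set (borel E)).
Hypothesis dp : driving_process F Y PY.
Hypothesis fv : fleming_viot F Y PY P xi U.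

Let X := copy_path Y xi.
Let tau := jump_time F X.

Hypothesis ai : assumption_i F Y PY.
Hypothesis aii : assumption_ii F Y PY.

Local Notation past := (past F Y xi U).
Local Notation prejump := (prejump F Y xi U).

Local Notation restart_point := (restart_point F Y xi U).
Hypothesis N2 : (2 <= N)%N.

Local Notation survive := (survive F Y PY xi U).
Local Notation jump_survive := (jump_survive F Y PY xi).
Local Notation exit_at := (exit_at F Y xi).
Local Notation prejump_sigma k := (g_sigma_algebraType (prejump k)).
Local Notation past_sigma k := (g_sigma_algebraType (past k)).

(** The particle of stage [k] from which [j] of stage [k + n] descends. The recursion peels off the
    jump that follows stage [k], as the induction in [descend_bound] does. *)
Fixpoint ancestor k n (j : 'I_N) (w : Om) : 'I_N :=
  if n is n'.+1 then parent F X U k.+1 (ancestor k.+1 n' j w) w else j.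

Definition descend k n (C : {set 'I_N}) : set Om :=
  [set w | tau (k + n) w < +oo /\ forall j, ancestor k n j w \in C].

Let jump_time_leD k n w : tau k w <= tau (k + n) w.
Proof.
elim: n => [|n IH]; first by rewrite addn0.
by rewrite addnS; apply: le_trans IH _; exact: jump_time_le.
Qed.

Lemma past_le k n : <<s past k >> `<=` <<s past (k + n) >>.
Proof.
elim: n => [|n IH]; first by rewrite addn0.
move=> A /IH; rewrite addnS; apply: sub_sigma_algebra2 => B.
exact: past_sub.
Qed.

Let mjump k : measurable ([set w | tau k w < +oo] : set (past_sigma k)).
Proof.
have mt := @measurable_jump_time_past R E F dW W Y dO Om N xi U k.
rewrite -[X in measurable X]setTI; exact: emeasurable_fun_infty_o mt _.
Qed.

Lemma measurable_ancestor k n j p :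
  measurable ([set w | tau (k + n) w < +oo /\ ancestor k n j w = p]
    : set (past_sigma (k + n))).
Proof.
elim: n k p => [|n IH] k p.
  rewrite (_ : mkset _ = [set w | tau (k + 0) w < +oo] `&`
    (if j == p then setT else set0)).
    by apply: measurableI => //; case: ifP.
  apply/seteqP; split => w /= [h]; first by move=> ->; rewrite eqxx.
  by case: eqP.
rewrite (_ : mkset _ = \bigcup_(p' in [set: 'I_N])
   ([set w | tau (k.+1 + n) w < +oo /\ ancestor k.+1 n j w = p'] `&`
    [set w | tau k.+1 w < +oo /\ parent F X U k.+1 p' w = p])).
  rewrite -addSnnS; apply: fin_bigcup_measurable => // p' _.
  apply: measurableI; first exact: IH.
  by apply: past_le; exact: (measurable_parent (F := F)).
rewrite -addSnnS; apply/seteqP; split => w /=.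
  move=> [h e]; exists (ancestor k.+1 n j w) => //; split => //; split => //.
  by apply: le_lt_trans h; exact: (jump_time_leD k.+1).
by move=> [p' _ [[h <-] [_ e]]].
Qed.

Lemma measurable_descend k n C : <<s past (k + n) >> (descend k n C).
Proof.
suff : measurable (descend k n C : set (past_sigma (k + n))) by [].
rewrite (_ : descend k n C = [set w | tau (k + n) w < +oo] `&`
  \bigcap_(j in [set: 'I_N]) \bigcup_(p in [set p | p \in C])
    [set w | tau (k + n) w < +oo /\ ancestor k n j w = p]).
  apply: measurableI => //; apply: fin_bigcap_measurable => // j _.
  apply: fin_bigcup_measurable => // p _; exact: measurable_ancestor.
apply/seteqP; split => w /= [h1 h2]; split => // j.
  by move=> _; exists (ancestor k n j w) => //=.
by have [p pC [_ ->]] := h2 j Logic.I.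
Qed.

(** When [i] is reborn on [m] in [C], the particle [i] and the members of [C] at stage [k.+1] all
    have their parent in [C]. *)
Lemma descendS k n (C : {set 'I_N}) i m w : exiting F X k.+1 w = Some i -> U k.+1 i w = m ->
  m \in C -> descend k.+1 n (i |: C)%SET w -> descend k n.+1 C w.
Proof.
move=> ei Um mC [h1 h2]; split; first by rewrite -addSnnS.
move=> j /=; rewrite /parent ei; have := h2 j; rewrite in_setU1.
case: (eqVneq (ancestor k.+1 n j w) i) => [-> _|ne /= jC].
  by rewrite eqxx Um.
by case: eqP => // -[e]; rewrite e eqxx in ne.
Qed.

Let Pfin A : measurable A -> P A \is a fin_num.
Proof. by move=> mA; exact: fin_num_measure. Qed.

(** [exiting] has one value at each jump, so the events are disjoint. *)
Lemma sum_exit_le (Q : pred 'I_N) (A : 'I_N -> set Om) B z k :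
  (forall i, measurable (A i)) -> measurable B ->
  (forall i, Q i -> A i `<=` B `&` exit_at z k i) ->
  \sum_(i < N | Q i) P (A i) <= P B.
Proof.
move=> mA mB AB; rewrite -measure_bigsetU_ord_cond//.
  apply: le_measure; rewrite ?inE//; first exact: bigsetU_measurable.
  elim/big_ind: _ => // [C D CB DB|i Qi]; first by rewrite subUset.
  by apply: subset_trans (AB i Qi) _; exact: subIsetl.
move=> i j Qi Qj [w [/(AB i Qi)[_ [_ ei]] /(AB j Qj)[_ [_]]]].
by rewrite ei => -[].
Qed.

(* A set C of particles that all survive time z, while the others do not, with
   conditional probability at least delta, takes over the whole population in
   #|~: C| jumps with a conditional probability bounded below. *)
Lemma descend_bound n (delta : R) : (0 < delta <= 1)%R ->
  exists eps : R, (0 < eps)%R /\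
  forall k (q : rat) (C : {set 'I_N}) (H : set Om) (z := ratr q : R),
  (0 <= z)%R -> C != finset.set0 -> #|~: C| = n -> <<s past k >> H ->
  H `<=` [set w | tau k w <= z%:E] ->
  (forall w, H w -> delta%:E <= survive z C k w) ->
  eps%:E * P H <= P (H `&` descend k n C).
Proof.
elim: n delta => [|n IH] delta /andP[d0 d1].
  exists 1%R; split => // k q C H z z0 C0 Cn pH Hz _.
  have CT : C = [set: 'I_N]%SET by rewrite -[C]finset.setCK (cards0_eq Cn) finset.setC0.
  rewrite mul1e (_ : H `&` descend k 0 C = H)//.
  apply/setIidPl => w Hw; split; last by move=> j; rewrite CT inE.
  by rewrite addn0; apply: le_lt_trans (Hz w Hw) (ltry _).
(* Half of [delta] is given up in [stepa] to discard the part of the event where [jump_survive] is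
   below [c]. *)
pose c := (delta / 2)%R.
have c0 : (0 < c)%R by rewrite /c; lra.
(* After the rebirth, [survive] consists of the product [jump_survive] and of one more factor, that
   of [m] repeated for [i]; each of the two is at least [c]. *)
have [|eps [eps0 IHe]] := IH (c * c)%R.
  by rewrite mulr_gt0//= mulr_ile1//; rewrite /c; lra.
have N1 : (0 < N.-1%:R^-1 :> R)%R by rewrite invr_gt0 ltr0n -subn1 subn_gt0.
(* The three factors pay for the remaining jumps, for the choice of [m] as the parent, and for
   restricting to the events [Hi]. *)
exists (eps * N.-1%:R^-1 * c)%R; split; first by rewrite !mulr_gt0.
move=> k q C H z z0 C0 Cn pH Hz Hd.
have mprej := prejump_measurable dp fv (k := k).
have mpast := past_measurable dp fv (k := k).
have mH : measurable H by move: pH; exact: g_sigma_measurable.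
have pH' := past_sub_prejump pH.
have CT : C != [set: 'I_N]%SET.
  by apply/eqP => CT; move: Cn; rewrite CT finset.setCT cards0.
have /set0Pn[m mC] := C0.
pose Hi i := H `&` exit_at z k i `&` [set w | c%:E <= jump_survive z C i k w].
have mJ i : @mfun_ge0 _ (prejump_sigma k) _ (jump_survive z C i k).
  exact: measurable_jump_survive.
have pE i : measurable (exit_at z k i : set (prejump_sigma k)).
  exact: measurable_exit_at.
have pHE i : measurable (H `&` exit_at z k i : set (prejump_sigma k)).
  exact: measurableI.
have pHi i : measurable (Hi i : set (prejump_sigma k)).
  apply: measurableI => //; rewrite -[X in measurable X]setTI.
  by apply: emeasurable_fun_c_infty => //; case: (mJ i).
have mHE i : measurable (H `&` exit_at z k i).
  by move: (pHE i); exact: g_sigma_measurable.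
have mHi i : measurable (Hi i) by move: (pHi i); exact: g_sigma_measurable.
(* [jump_survive] is at most 1 on [Hi i] and less than [c] on the rest of the exit event; the exit
   events being disjoint, the rests cost at most [c * P H] in all. *)
have stepa : c%:E * P H <= \sum_(i | i \notin C) P (Hi i).
  have := one_step mF dp fv ai aii N2 z0 pH Hz CT.
  have le1 : delta%:E * P H <= \int[P]_(w in H) survive z C k w.
    rewrite -integral_cst//; apply: ge0_le_integral => //.
    - by move=> w _; rewrite lee_fin ltW.
    - apply: measurable_funTS; apply: (measurable_past_Om dp fv (k := k)).
      have [] // : @mfun_ge0 _ (past_sigma k) _ (survive z C k).
      exact: measurable_survive.
  have le2 i : \int[P]_(w in H `&` exit_at z k i) jump_survive z C i k w <=
      P (Hi i) + c%:E * P (H `&` exit_at z k i).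
    apply: (@le_trans _ _ (\int[P]_(w in H `&` exit_at z k i)
        ((\1_(Hi i) w)%:E + c%:E))).
      apply: ge0_le_integral => //.
      - by move=> w _; case: (mJ i).
      - apply: measurable_funTS; apply: (measurable_fun_g_sigma mprej).
        by case: (mJ i).
      - apply: measurable_funTS; apply: emeasurable_funD => //.
        by apply/measurable_EFinP; rewrite (_ : \1_(Hi i) = mindic R (mHi i)).
      move=> w HEw; rewrite indicE; case: (boolP (w \in Hi i)) => [_|/negP nHi].
        apply: (@le_trans _ _ 1); last by rewrite leeDl// lee_fin ltW.
        apply: prode_le1 => m' _; apply/andP; split => //.
        apply: pker_le1; apply: (measurable_preimage_Y dp) => //.
        exact: measurable_target.
      rewrite add0e leNgt; apply/negP => h; apply: nHi.
      by rewrite inE; split => //; exact: ltW.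
    rewrite ge0_integralD//; last 2 first.
    - apply: measurable_funTS; apply/measurable_EFinP.
      by rewrite (_ : \1_(Hi i) = mindic R (mHi i)).
    - by move=> w _; rewrite lee_fin ltW.
    rewrite integral_indic// integral_cst//; apply: leeD2r.
    by apply: le_measure; rewrite ?inE//; exact: measurableI.
  move=> le3; have {le3} := le_trans le1 (le_trans le3 (lee_sum _ (fun i _ => le2 i))).
  rewrite big_split /= -ge0_sume_distrr//.
  have le4 := @sum_exit_le (fun i => i \notin C) (fun i => H `&` exit_at z k i) H z k
    mHE mH (fun i _ => @subset_refl _ _).
  have le5 : c%:E * (\sum_(i < N | i \notin C) P (H `&` exit_at z k i)) <= c%:E * P H.
    by apply: lee_wpmul2l => //; rewrite lee_fin ltW.
  move=> le6; have := le_trans le6 (leeD2l _ le5).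
  rewrite -(fineK (Pfin mH)) -!EFinM -leeBlDr// -EFinB.
  by congr (_%:E <= _); rewrite /c; field.
pose Hm i := Hi i `&` U k.+1 i @^-1` [set m].
have pHm i : measurable (Hm i : set (past_sigma k.+1)).
  apply: (@measurableI _ (past_sigma k.+1)).
    have : <<s prejump k >> `<=` <<s past k.+1 >>.
      by apply: sub_sigma_algebra2 => B; exact: prejump_past.
    by apply; exact: pHi.
  by apply: sub_sigma_algebra; right; exists i, m.
have mHm i : measurable (Hm i).
  by move: (pHm i); apply: g_sigma_measurable; exact: (past_measurable dp fv).
have PHm i : i \notin C -> P (Hm i) = (N.-1%:R^-1)%:E * P (Hi i).
  move=> iC; apply: (choice_indep mF dp fv ai aii N2 (pHi i)).
  by apply: contra iC => /eqP <-.
(* On [Hm i] the particle [i] continues from the position of [m], so the family for the induction is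
   [C] with [i] added and its complement has lost one particle. *)
have stepc i : i \notin C ->
    eps%:E * P (Hm i) <= P (Hm i `&` descend k.+1 n (i |: C)%SET).
  move=> iC; apply: (IHe k.+1 q) => //.
  - by apply/set0Pn; exists m; rewrite in_setU1 mC orbT.
  - apply/eqP; rewrite -eqSS -Cn (cardsD1 i (~: C)) finset.in_setC iC add1n eqSS.
    by apply/eqP/eq_card => j; rewrite !inE negb_or.
  - exact: pHm.
  - by move=> w [[[_ [h _]] _] _].
  - move=> w [[[Hw [tz ei]] cJ] Um].
    have koo : tau k.+1 w < +oo by apply: le_lt_trans tz (ltry _).
    have rp j : restart_point k.+1 j w = jump_point F Y xi k (if j == i then m else j) w.
      rewrite /restart_point /jump_point /= -/tau koo /parent ei.
      by congr (_, X _ _ _ _); case: (eqVneq j i) => [->|ji]; rewrite ?eqxx// ;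
         case: eqP => // -[e]; rewrite e eqxx in ji.
    have mi : m != i by apply: contra iC => /eqP <-.
    have le1 j A : measurable A -> PY (jump_point F Y xi k j w) A <= 1.
      by move=> mA; exact: pker_le1.
    have mYz C' j : measurable (Y z @^-1` target F C' j).
      by apply: (measurable_preimage_Y dp) => //; exact: measurable_target.
    have tE j : j != i -> target F (i |: C)%SET j = target F C j.
      by move=> ji; rewrite /target in_setU1 (negbTE ji).
    rewrite /survive (bigD1 i)//= EFinM; apply: lee_pmul.
    - by rewrite lee_fin ltW.
    - by rewrite lee_fin ltW.
    (* The factor of [i] is that of [m], which is at least the whole product because the other
       factors are at most 1. *)
    - apply: le_trans cJ _; rewrite /jump_survive (bigD1 m)//= rp eqxx.
      have -> : target F (i |: C)%SET i = target F C m.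
        by rewrite /target in_setU1 eqxx mC.
      rewrite -[leRHS]mule1.
      apply: lee_wpmul2l => //; apply: prode_le1 => j _; apply/andP; split => //.
      exact: le1.
    - apply: le_trans cJ _; rewrite /jump_survive.
      rewrite le_eqVlt; apply/orP; left; apply/eqP; apply: eq_bigr => j ji.
      by rewrite rp (negbTE ji) tE.
have stepd : \sum_(i | i \notin C) P (Hm i `&` descend k.+1 n (i |: C)%SET) <=
    P (H `&` descend k n.+1 C).
  have md k' n' C' : measurable (descend k' n' C').
    move: (@measurable_descend k' n' C').
    by apply: g_sigma_measurable; exact: (past_measurable dp fv).
  apply: (@sum_exit_le _ _ _ z k) => [i||i iC]; first exact: measurableI.
    exact: measurableI.
  move=> w [[[[Hw ee] cJ] Um] dw]; split => //; split => //.
  by case: ee => _ ei; exact: (descendS ei Um mC).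
apply: le_trans stepd.
apply: le_trans (lee_sum _ stepc).
under eq_bigr => i iC do rewrite PHm// muleA -EFinM.
rewrite -ge0_sume_distrr// (EFinM _ c) -muleA; apply: lee_wpmul2l => //.
by rewrite lee_fin mulr_ge0// ltW.
Qed.

End fv_coalescence.

Section fv_coalescence_ae.
Context (R : realType) (E : ptopologicalType) (F : set E)
  (dW : measure_display) (W : measurableType dW) (Y : R -> W -> E)
  (PY : R.-pker (measurableTypeR R * borel E) ~> W)
  (dO : measure_display) (Om : measurableType dO) (P : probability Om R)
  (N : nat) (xi : nat -> 'I_N -> Om -> W) (U : nat -> 'I_N -> Om -> 'I_N).
Hypothesis mF : measurable (F : set (borel E)).
Hypothesis dp : driving_process F Y PY.
Hypothesis fv : fleming_viot F Y PY P xi U.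

Let X := copy_path Y xi.
Let tau := jump_time F X.

Hypothesis ai : assumption_i F Y PY.
Hypothesis aii : assumption_ii F Y PY.

Local Notation past := (past F Y xi U).

Local Notation restart_point := (restart_point F Y xi U).
Local Notation regular := (regular F Y xi U).
Hypothesis N2 : (2 <= N)%N.

Local Notation survive := (survive F Y PY xi U).
Local Notation past_sigma k := (g_sigma_algebraType (past k)).

Local Notation ancestor := (ancestor F Y xi U).
Local Notation descend := (descend F Y xi U).

Let delta : R := (\prod_(m < N) 3^-1)%R.

Let delta01 : (0 < delta <= 1)%R.
Proof.
have [c0 c1] : (0 < 3^-1 :> R)%R /\ (3^-1 <= 1 :> R)%R by split; lra.
rewrite /delta; elim/big_ind: _ => [|x y /andP[x0 x1] /andP[y0 y1]|i _].
- by rewrite ltr01 lexx.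
- by rewrite mulr_gt0//= mulr_ile1// ltW.
- by rewrite c0 c1.
Qed.

Lemma survive_start k w : regular k w -> exists (m : 'I_N) (q : rat),
  [/\ (0 <= ratr q :> R)%R, tau k w <= (ratr q)%:E &
      delta%:E <= survive (ratr q) [set m]%SET k w].
Proof.
move=> [koo Fw].
have s0 : (0 <= fine (tau k w))%R by exact: fine_jump_time_ge0.
have kfin : tau k w \is a fin_num by rewrite ge0_fin_numE// jump_time_ge0.
have /choice[qs hq] : forall m, exists q : rat, (fine (tau k w) <= ratr q)%R /\
    (3^-1)%:E <= PY (restart_point k m w) (Y (ratr q) @^-1` F) <= (1 - 3^-1)%:E.
  by move=> m; exact: (survival_median mF dp ai aii).
have i0 : 'I_N by exact: Ordinal (ltnW N2).
pose m := [arg max_(i > i0) qs i]%O.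
have mmax j : (qs j <= qs m)%O.
  by rewrite /m; case: arg_maxP => // i' _ h; exact: h.
have [sm /andP[_ hm]] := hq m.
exists m, (qs m); split.
- exact: le_trans sm.
- by rewrite -(fineK kfin) lee_fin.
rewrite /delta -prodEFin /survive.
have mq j : (0 <= ratr (qs j) :> R)%R by apply: le_trans s0 _; case: (hq j).
have mYF j : measurable (Y (ratr (qs j)) @^-1` F).
  exact: (measurable_preimage_Y dp).
suff hj j : (3^-1)%:E <= PY (restart_point k j w) (Y (ratr (qs m)) @^-1` target F [set m]%SET j).
  suff /andP[] : 0 <= \prod_(j < N) (3^-1 : R)%:E <=
    \prod_(j < N) PY (restart_point k j w) (Y (ratr (qs m)) @^-1` target F [set m]%SET j) by [].
  elim/big_ind2: _ => [|x y x' y' /andP[? ?] /andP[? ?]|j _].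
  - by rewrite lexx andbT lee_fin.
  - by rewrite mule_ge0//= lee_pmul.
  - by rewrite lee_fin invr_ge0 ler0n hj.
rewrite /target finset.in_set1; case: (eqVneq j m) => [->|jm].
  by have [_ /andP[]] := hq m.
rewrite preimage_setC pker_setC; last exact: mYF.
have [sj /andP[_ hjq]] := hq j.
have le1 : PY (restart_point k j w) (Y (ratr (qs m)) @^-1` F) <= (1 - 3^-1)%:E.
  apply: le_trans hjq; apply: (survival_nonincreasing mF dp ai) => //.
  by rewrite ler_rat.
have /fineK <- := pker_fin_num PY (restart_point k j w) (mYF m).
rewrite -EFinB lee_fin.
have := le1; rewrite -{1}(fineK (pker_fin_num PY (restart_point k j w) (mYF m))) lee_fin.
by move=> h; lra.
Qed.

Definition coalesce k : set Om :=
  [set w | tau (k + N.-1) w < +oo /\ exists m, forall j, ancestor k N.-1 j w = m].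

Let coalesceE k : coalesce k =
  \bigcup_(m in [set: 'I_N]) descend k N.-1 [set m]%SET.
Proof.
apply/seteqP; split => w /=.
  by move=> [h [m hm]]; exists m => //; split => // j; rewrite finset.in_set1 hm.
move=> [m _ [h hm]]; split => //; exists m => j.
by apply/eqP; have := hm j; rewrite finset.in_set1.
Qed.

Let pcoalesce k : measurable (coalesce k : set (past_sigma (k + N.-1))).
Proof.
rewrite coalesceE; apply: fin_bigcup_measurable => // m _.
exact: measurable_descend.
Qed.

Let past_meas k (A : set Om) : <<s past k >> A -> measurable A.
Proof. by apply: g_sigma_measurable; exact: (past_measurable dp fv). Qed.

(** The survivor and the time given by [survive_start] depend on [w] but range over a countable set.
    [H] is cut into disjoint measurable pieces on each of which one pair works, and the bounds of
    [descend_bound], all with the same [eps], are added. *)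
Lemma coalesce_bound : exists eps : R, (0 < eps)%R /\
  forall k H, <<s past k >> H -> eps%:E * P H <= P (H `&` coalesce k).
Proof.
have [eps [eps0 heps]] := descend_bound mF dp fv ai aii N2 N.-1 delta01.
exists eps; split => // k H pH.
have mH := past_meas pH.
pose Ep (p : 'I_N * rat) : set Om := if (0 <= ratr p.2 :> R)%R then
   [set w | tau k w <= (ratr p.2)%:E] `&`
   [set w | delta%:E <= survive (ratr p.2) [set p.1]%SET k w] else set0.
have pE p : measurable (Ep p : set (past_sigma k)).
  rewrite /Ep; case: ifPn => [q0|_]; last exact: measurable0.
  have mt := @measurable_jump_time_past R E F dW W Y dO Om N xi U k.
  have [ms _] : @mfun_ge0 _ (past_sigma k) _ (survive (ratr p.2) [set p.1]%SET k).
    exact: measurable_survive.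
  apply: measurableI; rewrite -[X in measurable X]setTI.
    exact: emeasurable_fun_infty_c mt _.
  exact: emeasurable_fun_c_infty ms _.
pose G (n : nat) : set Om :=
  if choice.unpickle n is Some p then Ep p else set0.
have pG n : measurable (G n : set (past_sigma k)).
  by rewrite /G; case: (choice.unpickle n) => [p|]; [exact: pE|exact: measurable0].
have pD n : measurable (seqDU G n : set (past_sigma k)).
  exact: (@seqDU_measurable _ (past_sigma k)).
have mD n : measurable (seqDU G n) by exact: (@past_meas k _ (pD n)).
have mC : measurable (coalesce k) by exact: (@past_meas (k + N.-1)%N _ (@pcoalesce k)).
have tD : trivIset setT (fun n => H `&` seqDU G n).
  by apply: trivIset_setIl; exact: trivIset_seqDU.
have PH : P H <= P (\bigcup_n (H `&` seqDU G n)).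
  have [N0 [mN PN NS]] := regular_ae mF dp fv ai aii N2 k.
  have mB : measurable (\bigcup_n (H `&` seqDU G n)).
    by apply: bigcupT_measurable => n; exact: measurableI.
  rewrite -(measureU0 mB mN PN); apply: le_measure; rewrite ?inE//.
    exact: measurableU.
  move=> w Hw; have [Nw|nN] := pselect (N0 w); [by right|left].
  have rw : regular k w by apply: contrapT => h; apply: nN; exact: NS.
  have [m [q [q0 kq dq]]] := survive_start rw.
  rewrite -setI_bigcupr -seqDU_bigcup_eq; split => //.
  exists (choice.pickle (m, q)) => //; rewrite /G choice.pickleK /Ep /= q0.
  by split.
have step n : eps%:E * P (H `&` seqDU G n) <= P (H `&` seqDU G n `&` coalesce k).
  have : seqDU G n `<=` G n by exact: subset_seqDU.
  rewrite [X in _ `<=` X]/G.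
  case: (choice.unpickle n) => [[m q]|]; last first.
    by rewrite subset0 => ->; rewrite setI0 set0I measure0 mule0.
  rewrite /Ep /=; case: ifPn => [q0|_]; last first.
    by rewrite subset0 => ->; rewrite setI0 set0I measure0 mule0.
  move=> sub; apply: (le_trans (heps k q [set m]%SET (H `&` seqDU G n) q0 _ _ _ _ _)).
  - by apply/set0Pn; exists m; rewrite finset.in_set1.
  - by rewrite cardsC1 card_ord.
  - exact: (@measurableI _ (past_sigma k)).
  - by move=> w [_ /sub[]].
  - by move=> w [_ /sub[]].
  apply: le_measure; rewrite ?inE.
  - apply: measurableI; first exact: measurableI.
    by apply: (@past_meas (k + N.-1)%N); exact: measurable_descend.
  - by apply: measurableI => //; exact: measurableI.
  - by apply: setIS => w dw; rewrite coalesceE; exists m.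
apply: (@le_trans _ _ (eps%:E * P (\bigcup_n (H `&` seqDU G n)))).
  by apply: lee_wpmul2l => //; rewrite lee_fin ltW.
have mHD n : measurable (H `&` seqDU G n) by exact: measurableI.
rewrite measure_semi_bigcup//; last exact: bigcupT_measurable.
rewrite -nneseriesZl//.
apply: (@le_trans _ _ (\sum_(n <oo) P (H `&` seqDU G n `&` coalesce k))).
  apply: lee_nneseries => [n _ _|n _]; last exact: step.
  by rewrite mule_ge0// lee_fin ltW.
rewrite -measure_semi_bigcup//.
- apply: le_measure; rewrite ?inE//.
  + by apply: bigcupT_measurable => n; exact: measurableI.
  + exact: measurableI.
  + by move=> w [n _ [[Hw _] cw]].
- by move=> n; exact: measurableI.
- by apply: trivIset_setIr.
- by apply: bigcupT_measurable => n; exact: measurableI.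
Qed.

Lemma ancestor_add k n n' j w :
  ancestor k (n + n') j w = ancestor k n (ancestor (k + n) n' j w) w.
Proof.
elim: n k => [|n IH] k; first by rewrite addn0.
by rewrite addSn /= IH addSnnS.
Qed.

(** Trials start at stages [N.-1] jumps apart, so the outcome of each belongs to the past of the
    next, and the first [r] all fail with probability at most [(1 - eps) ^+ r]. *)
Lemma coalescence_ae : {ae P, forall w, forall k, exists n m, forall j,
  ancestor k n j w = m}.
Proof.
apply: ae_foralln => k.
have [eps [eps0 heps]] := coalesce_bound.
pose kr r := (k + r * N.-1)%N.
pose H r : set Om := \bigcap_(l in `I_r) ~` coalesce (kr l).
have krS r : kr r.+1 = (kr r + N.-1)%N by rewrite /kr mulSn (addnC N.-1) addnA.
have pH r : <<s past (kr r) >> (H r).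
  elim: r => [|r IH].
    rewrite /H II0 bigcap_set0; exact: (@measurableT _ (past_sigma _)).
  have -> : H r.+1 = H r `&` ~` coalesce (kr r).
    by rewrite /H IIS bigcap_setU bigcap_set1.
  rewrite krS; apply: (@measurableI _ (past_sigma _)).
    exact: past_le.
  by apply: measurableC; exact: pcoalesce.
have mH r : measurable (H r) by exact: (@past_meas _ _ (pH r)).
have mC r : measurable (coalesce (kr r)) by exact: (@past_meas (kr r + N.-1)%N _ (@pcoalesce (kr r))).
pose p r : R := fine (P (H r)).
have PE r : P (H r) = (p r)%:E by rewrite fineK//; exact: fin_num_measure.
have eps1 : (eps <= 1)%R.
  have := heps (kr 0%N) setT (@measurableT _ (past_sigma _)).
  rewrite probability_setT mule1 => /le_trans/(_ (probability_le1 _ _)).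
  by rewrite setTI lee_fin => ->.
have pS r : (p r.+1 <= (1 - eps) * p r)%R.
  have HS : H r.+1 = H r `\` coalesce (kr r).
    by rewrite /H IIS bigcap_setU bigcap_set1.
  have := heps (kr r) (H r) (pH r).
  have : P (H r.+1) = P (H r) - P (H r `&` coalesce (kr r)).
    by rewrite HS measureD// -ge0_fin_numE//; exact: fin_num_measure.
  have mI : measurable (H r `&` coalesce (kr r)) by exact: measurableI.
  rewrite !PE -(fineK (fin_num_measure P _ mI)) -EFinB -EFinM lee_fin => -[->].
  by rewrite mulrBl mul1r => h; rewrite lerD2l lerN2.
have pr r : (p r <= (1 - eps) ^+ r)%R.
  elim: r => [|r IH].
    by rewrite expr0 -lee_fin -PE; exact: probability_le1.
  apply: le_trans (pS r) _; rewrite exprS; apply: ler_wpM2l => //.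
  by rewrite subr_ge0.
have mHoo : measurable (\bigcap_r H r) by exact: bigcapT_measurable.
exists (\bigcap_r H r); split => //.
  apply/eqP; rewrite eq_le measure_ge0 andbT.
  have cv : ((1 - eps) ^+ r)%R @[r --> \oo] --> (0 : R)%R.
    by apply: cvg_expr; rewrite ger0_norm ?subr_ge0// ltrBlDr ltrDl.
  have cv' : ((1 - eps) ^+ r)%R%:E @[r --> \oo] --> (0 : \bar R).
    by apply: cvg_EFin => //; exact: nearW.
  rewrite -(cvg_lim _ cv')//; apply: lime_ge; first exact: cvgP cv'.
  apply: nearW => r; apply: (@le_trans _ _ (P (H r))).
    by apply: le_measure; rewrite ?inE//; exact: bigcap_inf.
  by rewrite PE lee_fin.
(* A successful trial from the later stage [kr l] gives coalescence from [k] by composing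
   ancestors. *)
move=> w nw r _ l _ cw; apply: nw.
have [_ [m hm]] := cw.
exists (l * N.-1 + N.-1)%N, (ancestor k (l * N.-1) m w) => j.
by rewrite ancestor_add hm.
Qed.

End fv_coalescence_ae.

(** * Combinatorics of labels *)

Section labels.
Variables (I : eqType) (L : nat -> I -> seq (I * nat)) (par : nat -> I -> I)
  (anc : nat -> nat -> I -> I).
Hypothesis two : exists i j : I, i != j.
Hypothesis L0 : forall i, L 0 i = [:: (i, 0%N)].
Hypothesis LS : forall k, exists i u, [/\ i != u,
  forall j, par k j = if j == i then u else j &
  forall j, L k.+1 j =
    if (j == u) || (j == i) then rcons (L k u) (j, k.+1) else L k j].
Hypothesis anc0 : forall k j, anc k 0 j = j.
Hypothesis ancS : forall k n j, anc k n.+1 j = par k (anc k.+1 n j).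
Hypothesis coal : forall k, exists n m, forall j, anc k n j = m.

Let prefix_rconsP (T : eqType) (s t : seq T) x :
  prefix s (rcons t x) -> s = rcons t x \/ prefix s t.
Proof.
case/prefixP => t'; case/lastP: t' => [|t' y] e; first by left; rewrite cats0 in e.
move: e; rewrite -rcons_cat => /rcons_inj[-> _]; right; exact: prefix_prefix.
Qed.

(** Induction on the stage. The two labels created at a jump have the same length and end with
    different particles; a comparison between a new and an old label would give one between [L k u]
    and the old label a stage earlier. *)
Lemma label_prefix_inj k i j : prefix (L k i) (L k j) -> i = j.
Proof.
elim: k i j => [|k IH] i j.
  by rewrite !L0 /= andbT => /eqP[].
have [e [u [eu _ HL]]] := LS k; rewrite !HL.
case: ifPn => hi; case: ifPn => hj.
- move=> /prefix_rconsP[/rcons_inj[]//|h].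
  have : prefix (L k u) (L k u) by exact: prefix_refl.
  by move: h => /prefixP[s /(congr1 size)]; rewrite size_cat size_rcons; lia.
- move=> h; have uj : u = j.
    by apply: IH; apply: prefix_trans h; rewrite -cats1 prefix_prefix.
  by rewrite -uj eqxx in hj.
- move=> /prefix_rconsP[h|/IH iu]; last by rewrite iu eqxx in hi.
  have : prefix (L k u) (L k i) by rewrite h -cats1 prefix_prefix.
  by move=> /IH ui; rewrite ui eqxx in hi.
- exact: IH.
Qed.

(** A jump adds at most one entry. The bound serves to show that a long label occurs only at a late
    stage. *)
Lemma label_size k i : (size (L k i) <= k.+1)%N.
Proof.
elim: k i => [|k IH] i; first by rewrite L0.
have [e [u [_ _ HL]]] := LS k; rewrite HL; case: ifP => _.
  by rewrite size_rcons ltnS.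
exact: leq_trans (IH i) (leqnSn _).
Qed.

Lemma label_ancestor k n j : prefix (L k (anc k n j)) (L (k + n) j).
Proof.
elim: n k j => [|n IH] k j; first by rewrite addn0 anc0 prefix_refl.
rewrite ancS -addSnnS; apply: prefix_trans (IH k.+1 j).
move: (anc k.+1 n j) => {}j.
have [e [u [_ Hp HL]]] := LS k; rewrite Hp HL.
have [->|_] := eqVneq j e; first by rewrite orbT -cats1 prefix_prefix.
rewrite orbF; case: eqP => [->|_]; last exact: prefix_refl.
by rewrite -cats1 prefix_prefix.
Qed.

(** Labels grow one entry at a time, so each nonempty initial piece was itself in use earlier. *)
Lemma label_take k i n : (0 < n <= size (L k i))%N ->
  exists k' i', take n (L k i) = L k' i'.
Proof.
elim: k i => [|k IH] i.
  rewrite L0 /= => /andP[n0 n1]; exists 0%N, i.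
  by have -> : n = 1%N by lia; rewrite L0.
have [e [u [_ _ HL]]] := LS k; have [hi|hi] := boolP ((i == u) || (i == e)).
  rewrite {1 2}HL hi size_rcons => /andP[n0]; rewrite leq_eqVlt => /predU1P[->|nk].
    by exists k.+1, i; rewrite HL hi -(size_rcons (L k u) (i, k.+1)) take_size.
  rewrite -cats1 takel_cat//; apply: IH; rewrite n0; exact: nk.
by rewrite HL (negbTE hi); exact: IH.
Qed.

Lemma anc_add k n n' j : anc k (n + n') j = anc k n (anc (k + n) n' j).
Proof.
elim: n k => [|n IH] k; first by rewrite anc0 addn0.
by rewrite addSn !ancS IH addSnnS.
Qed.

(** All labels at stage [k + n] extend [L k m]. If one of them were equal to it, it would be a
    prefix of all the others, against incomparability for two distinct particles. *)
Lemma label_grow k n m : (forall j, anc k n j = m) ->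
  forall j, (size (L k m) < size (L (k + n) j))%N.
Proof.
move=> am j; have pre i : prefix (L k m) (L (k + n) i).
  by rewrite -(am i); exact: label_ancestor.
rewrite ltn_neqAle size_prefix// andbT; apply/negP => /eqP sz.
have e : L k m = L (k + n) j.
  by have := pre j; rewrite prefixE sz take_size => /eqP.
have [i1 [i2 ne]] := two.
have all i : j = i by apply: (@label_prefix_inj (k + n)); rewrite -e.
by rewrite -(all i1) -(all i2) eqxx in ne.
Qed.

Lemma label_unbounded s : exists knm : nat * nat * I,
  (forall j, anc knm.1.1 knm.1.2 j = knm.2) /\
  (s <= size (L knm.1.1 knm.2))%N.
Proof.
elim: s => [|s [[[k n] m] /= [am sz]]].
  by have [n [m am]] := coal 0; exists (0%N, n, m).
have [n' [m' am']] := coal (k + n); exists ((k + n)%N, n', m'); split => //=.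
exact: leq_ltn_trans sz (label_grow am m').
Qed.

(** Existence: [c n] has length at least [n] and is extended by every label from stage [K n] on, so
    these labels are compatible and define [a]. Uniqueness: a long initial piece of [b] is the label
    of a late stage and so begins with [c n]. *)
Lemma unique_label_path : exists! a : nat -> I * nat,
  forall n : nat, (0 < n)%N -> exists i k, mkseq a n = L k i.
Proof.
have [f hf] := choice label_unbounded.
pose c n := L (f n).1.1 (f n).2.
pose K n := ((f n).1.1 + (f n).1.2)%N.
have cK n k j : (K n <= k)%N -> prefix (c n) (L k j).
  move=> Kk; have [am _] := hf n.
  have -> : k = ((f n).1.1 + ((f n).1.2 + (k - K n)))%N by rewrite addnA subnKC.
  rewrite /c -(am (anc (K n) (k - K n) j)) -anc_add; exact: label_ancestor.
have cs n : (n <= size (c n))%N by have [] := hf n.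
have [i0 _] := two.
have nthc n n' p : (p < size (c n))%N -> (p < size (c n'))%N ->
    nth (i0, 0%N) (c n) p = nth (i0, 0%N) (c n') p.
  move=> pn pn'.
  have /prefixP[s1 e1] := cK n (maxn (K n) (K n')) i0 (leq_maxl _ _).
  have /prefixP[s2 e2] := cK n' (maxn (K n) (K n')) i0 (leq_maxr _ _).
  have := congr1 (fun s => nth (i0, 0%N) s p) e1.
  by rewrite e2 !nth_cat pn pn'.
pose a p := nth (i0, 0%N) (c p.+1) p.
have aE n : mkseq a n = take n (c n).
  apply: (@eq_from_nth _ (i0, 0%N)).
    by rewrite size_mkseq size_takel.
  move=> p; rewrite size_mkseq => pn; rewrite nth_mkseq// nth_take//.
  by apply: nthc => //; apply: leq_trans (cs _).
exists a; split.
  move=> n n0; have [|k [i e]] := @label_take (f n).1.1 (f n).2 n.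
    by rewrite n0 cs.
  by exists i, k; rewrite aE.
move=> b hb; have bE n : mkseq b n = mkseq a n.
  (* By [label_size], a length above [K n] forces a stage not before [K n]. *)
  pose M := maxn n (K n).+1.
  have [|i [k e]] := hb M; first by rewrite /M leq_max orbT.
  have Kk : (K n <= k)%N.
    have := label_size k i; rewrite -e size_mkseq /M; lia.
  have := cK n k i Kk; rewrite -e => /prefixP[s es].
  rewrite aE -(takel_cat s (cs n)) -es; apply: (@eq_from_nth _ (i0, 0%N)).
    by rewrite size_takel !size_mkseq// leq_maxl.
  move=> p; rewrite size_mkseq => pn; rewrite nth_take//.
  by rewrite !nth_mkseq// (leq_trans pn)// leq_maxl.
apply/funext => p; have := congr1 (fun s => nth (i0, 0%N) s p) (bE p.+1).
by rewrite !nth_mkseq.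
Qed.

End labels.

(** * From stages to times *)

(** Stage [k] is in force at the time [tau k], which precedes the lifetime because jump times
    increase strictly. Hence labels at times and labels at stages are the same sequences, and the
    combinatorial result applies. *)
Lemma fv_unique_path (R : realType) (E : ptopologicalType) (F : set E)
    (dW : measure_display) (W : measurableType dW) (Y : R -> W -> E)
    (dO : measure_display) (Om : measurableType dO)
    (N : nat) (xi : nat -> 'I_N -> Om -> W) (U : nat -> 'I_N -> Om -> 'I_N)
    (X := copy_path Y xi) (w : Om) :
  (2 <= N)%N ->
  (forall k, jump_time F X k w < jump_time F X k.+1 w < +oo) ->
  (forall k, exists2 i, exiting F X k.+1 w = Some i & U k.+1 i w != i) ->
  (forall k, exists n m, forall j, ancestor F Y xi U k n j w = m) ->
  exists! a : nat -> 'I_N * nat, forall n : nat, (0 < n)%N ->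
     exists (i : 'I_N) (s : R),
       [/\ (0 <= s)%R, s%:E < lifetime F X w & mkseq a n = label F X U i s w].
Proof.
move=> N2 htau hex hcoal; set tau := jump_time F X.
have tau0 k : 0 <= tau k w by exact: jump_time_ge0.
have taufin k : tau k w \is a fin_num.
  rewrite ge0_fin_numE//; case: k => [|k]; first exact: ltry.
  by have /andP[] := htau k.
have mono : {homo (fun k => tau k w) : m n / (m < n)%N >-> m < n}.
  by apply: homo_ltn => [|k]; [exact: lt_trans|have /andP[] := htau k].
have monoW : {homo (fun k => tau k w) : m n / (m <= n)%N >-> m <= n}.
  by move=> m n; rewrite leq_eqVlt => /predU1P[->//|/mono/ltW].
have stageE k : stage F X (fine (tau k w)) w = k.
  rewrite /stage; case: xgetP => [j -> /=|/(_ k)/=]; rewrite fineK// -/tau.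
    move=> /andP[jk kj]; apply/eqP; rewrite eqn_leq; apply/andP; split.
      by rewrite leqNgt; apply/negP => /mono; rewrite ltNge jk.
    by rewrite -ltnS ltnNge; apply/negP => /monoW; rewrite leNgt kj.
  by rewrite lexx; have /andP[-> _] := htau k; case.
have ltlife k : tau k w < lifetime F X w.
  have /andP[h _] := htau k; apply: lt_le_trans h _.
  apply: lime_ge.
    by apply: ereal_nondecreasing_is_cvgn => m n; exact: monoW.
  by exists k.+1 => // n /= kn; exact: (monoW k.+1 n kn).
have equiv (s : seq ('I_N * nat)) :
    (exists (i : 'I_N) (t : R), [/\ (0 <= t)%R, t%:E < lifetime F X w &
       s = label F X U i t w]) <->
    (exists i k, s = stage_label F X U k i w).
  split => [[i [t [_ _ ->]]]|[i [k ->]]]; first by exists i, (stage F X t w).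
  exists i, (fine (tau k w)); rewrite fine_ge0// fineK//; split => //.
  by rewrite /label stageE.
have [||||||a [ha ua]] := @unique_label_path 'I_N
  (fun k i => stage_label F X U k i w) (fun k j => parent F X U k.+1 j w)
  (fun k n j => ancestor F Y xi U k n j w).
- by exists (Ordinal (ltnW N2)), (Ordinal N2).
- by [].
- move=> k; have [i ei Ui] := hex k; exists i, (U k.+1 i w); split.
  + by rewrite eq_sym.
  + move=> j; rewrite /parent ei; case: (eqVneq j i) => [->|ji]; first by rewrite eqxx.
    by case: eqP => // -[e]; rewrite e eqxx in ji.
  + by move=> j /=; rewrite -/X ei.
- by [].
- by [].
- exact: hcoal.
exists a; split => [n n0|b hb].
  by apply/equiv; exact: ha.
by apply: ua => n n0; apply/equiv; exact: hb.
Qed.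

Local Close Scope ereal_scope.

Theorem theorem3p1 (R : realType) (E : ptopologicalType) (F : set E)
    (dW : measure_display) (W : measurableType dW) (Y : R -> W -> E)
    (PY : R.-pker (measurableTypeR R * borel E) ~> W)
    (dO : measure_display) (Om : measurableType dO) (P : probability Om R)
    (N : nat) (xi : nat -> 'I_N -> Om -> W) (U : nat -> 'I_N -> Om -> 'I_N) :
  (2 <= N)%N ->
  measurable (F : set (borel E)) -> F `<` setT ->
  driving_process F Y PY ->
  assumption_i F Y PY ->
  assumption_ii F Y PY ->
  fleming_viot F Y PY P xi U ->
  let X := copy_path Y xi in
  {ae P, forall w, exists! a : nat -> 'I_N * nat, forall n : nat, (0 < n)%N ->
     exists (i : 'I_N) (s : R),
       [/\ 0 <= s, (s%:E < lifetime F X w)%E & mkseq a n = label F X U i s w]}.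
Proof.
move=> N2 mF _ dp ai aii fv X.
have good : {ae P, forall w k, good_stage F Y xi k w}.
  apply: ae_foralln => k; apply: (good_stage_ae mF dp fv ai aii).
  exact: (regular_ae mF dp fv ai aii N2).
have coal := coalescence_ae mF dp fv ai aii N2.
apply: filterS3 good (choice_neq_ae fv) coal => w gw hU hcoal.
apply: (fv_unique_path N2 _ _ hcoal) => k.
  by have [i [_ h _ _ _]] := next_jump N2 (gw k).
have [i [_ _ _ ei _]] := next_jump N2 (gw k).
by exists i => //; exact: hU (k, i).
Qed.
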